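(* $$\mathfrak{S}=\bigcap_{s\ge 0}\mathbb{M}^1_s .$$
   Context: $\mathfrak{S}$ (Schwartz operators) denotes the set of pseudo-differential operators on $\mathbb{R}^d$ with Weyl symbol in the Schwartz class $\mathcal{S}(\mathbb{R}^{2d})$, i.e. the operators $\mathrm{Op}_{1/2}(a)$ with $a\in\mathcal{S}(\mathbb{R}^{2d})$, where $\mathrm{Op}_{1/2}(a)f(t)=\iint e^{2\pi i(t-y)\xi}a\left(\tfrac{t+y}{2},\xi\right)f(y)\,dy\,d\xi$. Feichtinger algebra: with $V_gf(x,\omega)=\int f(t)\overline{g(t-x)}e^{-2\pi i t\omega}\,dt$ and $g$ a fixed Gaussian, $S_0(\mathbb{R}^n)=\{f\in L^2(\mathbb{R}^n):V_gf\in L^1(\mathbb{R}^{2n})\}$ with $\|f\|_{S_0}=\|V_gf\|_{L^1}$; $S_0'(\mathbb{R}^n)$ is its conjugate-dual, with pairing $\langle\cdot,\cdot\rangle$ compatible with the $L^2$ inner product (linear in the first, conjugate-linear in the second argument). For $s\ge0$ let $v_s(z)=(1+|z|^2)^{s/2}$, $z\in\mathbb{R}^{2d}$, and $(v_s\otimes v_s)(z,w)=v_s(z)v_s(w)$ for $z,w\in\mathbb{R}^{2d}$. $M^1_{v_s\otimes v_s}(\mathbb{R}^{2d})$ is the weighted modulation space of those $F\in S_0(\mathbb{R}^{2d})$ whose short-time Fourier transform $V_GF$ ($G$ a Gaussian on $\mathbb{R}^{2d}$) lies in $L^1(\mathbb{R}^{4d})$ with respect to the weight $v_s\otimes v_s$,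 where for $V_GF((x,u),(\omega,v))$, $x,u,\omega,v\in\mathbb{R}^d$, the weight is $v_s(x,\omega)\,v_s(u,v)$; the norm is the weighted $L^1$ norm of $V_GF$. For $s\ge0$, $\mathbb{M}^1_s$ is the class of linear continuous operators $S\colon S_0'(\mathbb{R}^d)\to S_0(\mathbb{R}^d)$ with kernel $K_S\in M^1_{v_s\otimes v_s}(\mathbb{R}^{2d})$, i.e. $(S\sigma)(x)=\langle\sigma,\overline{K_S(x,\cdot)}\rangle$ for $\sigma\in S_0'(\mathbb{R}^d)$ (so $Sf(x)=\int K_S(x,y)f(y)\,dy$ for $f\in S_0(\mathbb{R}^d)$). Operators in $\mathfrak{S}$ and in $\mathbb{M}^1_s$ are identified through their kernels. *)

(* Defs.v *)
From HB Require Import structures.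
From mathcomp Require Import all_boot all_order all_algebra.
From mathcomp Require Import complex.
From mathcomp Require Import all_classical all_reals all_analysis.

Set Implicit Arguments.
Unset Strict Implicit.
Unset Printing Implicit Defensive.

Import Order.TTheory GRing.Theory Num.Theory.
Import numFieldNormedType.Exports.

Local Open Scope classical_set_scope.
Local Open Scope ring_scope.
Local Open Scope complex_scope.

Definition rV_display : measure_display.
Proof. exact: default_measure_display. Qed.

Definition rV_coord {R : realType} {n} (i : 'I_n) (x : 'rV[R]_n) :
  measurableTypeR R := x ord0 i.

(* The Borel sigma-algebra of R^n, generated by the coordinates (as the library
   does for [n.-tuple T]); the norm topology of ['rV[R]_n] is the product one. *)
Section measurable_rV.
Context {R : realType} (n : nat).

Let rV_set0 : g_sigma_preimage (@rV_coord R n) set0.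
Proof. exact: sigma_algebra0. Qed.

Let rV_setC A :
  g_sigma_preimage (@rV_coord R n) A -> g_sigma_preimage (@rV_coord R n) (~` A).
Proof. exact: sigma_algebraC. Qed.

Let rV_bigcup (F : _^nat) : (forall i, g_sigma_preimage (@rV_coord R n) (F i)) ->
  g_sigma_preimage (@rV_coord R n) (\bigcup_i (F i)).
Proof. exact: sigma_algebra_bigcup. Qed.

HB.instance Definition _ :=
  @isMeasurable.Build rV_display 'rV[R]_n
  (g_sigma_preimage (@rV_coord R n)) rV_set0 rV_setC rV_bigcup.

End measurable_rV.
Section lebesgue_rV.
Context {R : realType}.

Lemma measurable_rV_coord n (i : 'I_n) : measurable_fun setT (@rV_coord R n i).
Proof.
move=> _ Y mY; rewrite setTI; apply: sub_sigma_algebra => /=.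
rewrite -bigcup_seq/=; exists i => /=; first by rewrite mem_index_enum.
by exists Y => //; rewrite setTI.
Qed.

Lemma measurable_fun_rV d (T : measurableType d) n (f : T -> 'rV[R]_n) :
  (forall i, measurable_fun setT (rV_coord i \o f)) -> measurable_fun setT f.
Proof.
move=> mf _ Y mY; rewrite setTI.
have sub : g_sigma_preimage (fun i => rV_coord i \o f) `<=` measurable.
  apply: smallest_sub; first exact: sigma_algebra_measurable.
  move=> A; rewrite -bigcup_seq/= => -[i _ [B mB <-]].
  exact: mf.
apply: sub; rewrite g_sigma_preimage_comp.
by exists Y => //; rewrite setTI.
Qed.

Definition rV_cons n (p : measurableTypeR R * 'rV[R]_n) : 'rV[R]_n.+1 :=
  row_mx (p.1%:M : 'M[R]_1) p.2.

Definition rV_uncons n (v : 'rV[R]_(1 + n)) : measurableTypeR R * 'rV[R]_n :=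
  (lsubmx v ord0 ord0, rsubmx v).

Lemma rV_consK n : cancel (@rV_cons n) (@rV_uncons n).
Proof.
by move=> [x v]; rewrite /rV_uncons /rV_cons row_mxKl row_mxKr/= mxE eqxx mulr1n.
Qed.

Lemma measurable_rV_cons n : measurable_fun setT (@rV_cons n).
Proof.
apply: measurable_fun_rV => i; case: (split_ordP (i : 'I_(1 + n))) => j ->.
- rewrite (_ : _ \o _ = fst); first exact: measurable_fst.
  apply/funext => p /=; transitivity ((p.1%:M : 'M[R]_1) ord0 j).
    exact: row_mxEl.
  by rewrite !ord1 mxE eqxx mulr1n.
- rewrite (_ : _ \o _ = rV_coord j \o snd).
    exact: measurableT_comp (measurable_rV_coord j) measurable_snd.
  by apply/funext => p /=; exact: (row_mxEr (p.1%:M : 'M[R]_1)).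
Qed.

Lemma measurable_rV_uncons n : measurable_fun setT (@rV_uncons n).
Proof.
apply/measurable_fun_pairP; split.
  rewrite (_ : _ \o _ = rV_coord (lshift n (ord0 : 'I_1))).
    exact: measurable_rV_coord.
  by apply/funext => v; rewrite /rV_coord /rV_uncons /= mxE.
apply: measurable_fun_rV => i.
rewrite (_ : _ \o _ = rV_coord (rshift 1 i)); first exact: measurable_rV_coord.
by apply/funext => v; rewrite /rV_coord /rV_uncons /= mxE.
Qed.

(* Prefixing a coordinate pushes the product measure on R x R^n forward to
   R^n.+1; on R^0, a point, Lebesgue measure is the unit mass. *)
Section lebesgue_step.
Variables (n : nat) (mu : {sigma_finite_measure set 'rV[R]_n -> \bar R}).

Definition lebesgue_step : set 'rV[R]_n.+1 -> \bar R :=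
  pushforward (@lebesgue_measure R \x mu)%E (@rV_cons n).

Let mcons := @measurable_rV_cons n.

Let step0 : lebesgue_step set0 = 0%E.
Proof. by rewrite /lebesgue_step /pushforward preimage_set0 measure0. Qed.

Let step_ge0 A : (0 <= lebesgue_step A)%E.
Proof. exact: measure_ge0. Qed.

Let step_sigma_additive : semi_sigma_additive lebesgue_step.
Proof.
move=> F mF tF mUF; rewrite /lebesgue_step /pushforward preimage_bigcup.
apply: measure_semi_sigma_additive.
- by move=> k; rewrite -[X in measurable X]setTI; exact: mcons.
- apply/trivIsetP => /= i j _ _ ij; rewrite -preimage_setI.
  by move/trivIsetP : tF => /(_ _ _ _ _ ij) ->//; rewrite preimage_set0.
- by rewrite -preimage_bigcup -[X in measurable X]setTI; exact: mcons.
Qed.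

HB.instance Definition _ := isMeasure.Build _ _ _ lebesgue_step
  step0 step_ge0 step_sigma_additive.

Let step_sigma_finite : sigma_finite setT lebesgue_step.
Proof.
have /sigma_finiteP[F [TF ndF Foo]] := sigma_finiteT (@lebesgue_measure R).
have /sigma_finiteP[G [TG ndG Goo]] := sigma_finiteT mu.
exists (fun k => @rV_uncons n @^-1` (F k `*` G k)).
  rewrite -preimage_bigcup (_ : \bigcup_i _ = setT) ?preimage_setT//.
  rewrite -subTset => -[x y] _.
  have [[i _ Fx] [j _ Gy]] : (\bigcup_k F k) x /\ (\bigcup_k G k) y.
    by rewrite -TF -TG.
  exists (maxn i j) => //; split.
  - by move: x Fx; exact/subsetPset/ndF/leq_maxl.
  - by move: y Gy; exact/subsetPset/ndG/leq_maxr.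
move=> k; have [mF Fk] := Foo k; have [mG Gk] := Goo k; split.
  rewrite -[X in measurable X]setTI.
  by apply: measurable_rV_uncons => //; exact: measurableX.
rewrite /lebesgue_step /pushforward -comp_preimage.
rewrite (_ : _ \o _ = id); last by apply/funext => p; exact: rV_consK.
by rewrite preimage_id product_measure1E// lte_mul_pinfty// ge0_fin_numE.
Qed.

HB.instance Definition _ := Measure_isSigmaFinite.Build _ _ _ lebesgue_step
  step_sigma_finite.

End lebesgue_step.

Fixpoint lebesgue_rV n : {sigma_finite_measure set 'rV[R]_n -> \bar R} :=
  match n with
  | 0 => dirac (0 : 'rV[R]_0)
  | m.+1 => lebesgue_step (lebesgue_rV m)
  end.

End lebesgue_rV.

Section functions_on_Rn.
Context {R : realType}.

Definition cis (t : R) : R[i] := cos t +i* sin t.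

Definition dotv n (x y : 'rV[R]_n) : R := \sum_i x ord0 i * y ord0 i.

(* Euclidean norm: the norm [`|x|] of ['rV[R]_n] is the sup norm. *)
Definition enorm n (x : 'rV[R]_n) : R := Num.sqrt (dotv x x).

Definition Cintegral d (T : measurableType d) (mu : {measure set T -> \bar R})
    (f : T -> R[i]) : R[i] :=
  (\int[mu]_x complex.Re (f x))%R +i* (\int[mu]_x complex.Im (f x))%R.

Definition partialC n (i : 'I_n) (f : 'rV[R]_n -> R[i]) (x : 'rV[R]_n) : R[i] :=
  ('D_(delta_mx ord0 i) (fun y => complex.Re (f y)) x) +i*
  ('D_(delta_mx ord0 i) (fun y => complex.Im (f y)) x).

Definition iter_partialC n (l : seq 'I_n) (f : 'rV[R]_n -> R[i]) :=
  foldr (@partialC n) f l.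

(* Smoothness: every iterated partial derivative is (Frechet) differentiable. *)
Definition schwartz n : set ('rV[R]_n -> R[i]) :=
  [set f | forall l : seq 'I_n,
    (forall x, differentiable (fun y => complex.Re (iter_partialC l f y)) x /\
               differentiable (fun y => complex.Im (iter_partialC l f y)) x) /\
    (forall k : nat, exists C : R, forall x,
       (1 + enorm x) ^+ k * Normc.normc (iter_partialC l f x) <= C)].

Definition square_integrable n : set ('rV[R]_n -> R[i]) :=
  [set f : 'rV[R]_n -> R[i] |
    [/\ measurable_fun setT (fun x => complex.Re (f x)),
        measurable_fun setT (fun x => complex.Im (f x)) &
        (lebesgue_rV n).-integrable setT
          (fun x => (Normc.normc (f x) ^+ 2)%:E)]].

Definition gaussian n (t : 'rV[R]_n) : R[i] := (expR (- (pi * dotv t t)))%:C.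

Definition stft n (g f : 'rV[R]_n -> R[i]) (z : 'rV[R]_n * 'rV[R]_n) : R[i] :=
  Cintegral (lebesgue_rV n)
    (fun t => f t * conjc (g (t - z.1)) * cis (- (2 * pi * dotv t z.2))).

Definition phase_measure n : {measure set ('rV[R]_n * 'rV[R]_n) -> \bar R} :=
  (lebesgue_rV n \x lebesgue_rV n)%E.

(* Elements of S_0 are represented by functions, up to equality almost
   everywhere. *)
Definition S0 n : set ('rV[R]_n -> R[i]) :=
  [set f | square_integrable f /\
     (phase_measure n).-integrable setT
       (fun z => (Normc.normc (stft (@gaussian n) f z))%:E)].

Definition S0norm n (f : 'rV[R]_n -> R[i]) : \bar R :=
  (\int[phase_measure n]_z (Normc.normc (stft (@gaussian n) f z))%:E)%E.

Definition S0dual_norm n (sigma : ('rV[R]_n -> R[i]) -> R[i]) : \bar R :=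
  ereal_sup [set (Normc.normc (sigma f))%:E |
             f in [set f | S0 f /\ (S0norm f <= 1)%E]].

(* The conjugate-dual S_0': bounded conjugate-linear functionals, [sigma f]
   being the pairing <sigma, f>.  Only the values on S_0 matter; boundedness
   makes [sigma] constant on classes of a.e. equal functions. *)
Definition S0dual n : set (('rV[R]_n -> R[i]) -> R[i]) :=
  [set sigma |
    (forall (a : R[i]) f g, S0 f -> S0 g ->
       sigma (fun x => a * f x + g x) = conjc a * sigma f + sigma g) /\
    (S0dual_norm sigma < +oo)%E].

Definition vweight (s : R) d (z : 'rV[R]_d * 'rV[R]_d) : R :=
  (1 + dotv z.1 z.1 + dotv z.2 z.2) `^ (s / 2).

(* For the STFT at ((x,u),(w,v)) the weight is v_s(x,w) v_s(u,v). *)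
Definition M1 d (s : R) : set ('rV[R]_(d + d) -> R[i]) :=
  [set F | S0 F /\
     (phase_measure (d + d)).-integrable setT
       (fun z => (Normc.normc (stft (@gaussian (d + d)) F z) *
                  (vweight s (lsubmx z.1, lsubmx z.2) *
                   vweight s (rsubmx z.1, rsubmx z.2)))%:E)].

End functions_on_Rn.

Section operators.
Context {R : realType} (d : nat).

Local Notation fct := ('rV[R]_d -> R[i]).

(* A function K of (x, y) is a function of [row_mx x y] on R^(d+d). *)
Definition conj_section (K : 'rV[R]_(d + d) -> R[i]) (x : 'rV[R]_d) : fct :=
  fun y => conjc (K (row_mx x y)).

(* (S sigma)(x) = <sigma, conj K(x,.)> *)
Definition has_kernel (S : (fct -> R[i]) -> fct)
    (K : 'rV[R]_(d + d) -> R[i]) : Prop :=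
  {ae lebesgue_rV d, forall x, S0 (conj_section K x)} /\
  forall sigma, S0dual sigma ->
    {ae lebesgue_rV d, forall x, S sigma x = sigma (conj_section K x)}.

(* Linear continuous operators from S_0'(R^d) to S_0(R^d) with a kernel in
   M^1_{v_s (x) v_s}(R^2d); identities between values hold a.e. *)
Definition M1_operators (s : R) : set ((fct -> R[i]) -> fct) :=
  [set S |
    [/\ forall sigma, S0dual sigma -> S0 (S sigma),
        forall (a : R[i]) sigma tau, S0dual sigma -> S0dual tau ->
          {ae lebesgue_rV d, forall x,
            S (fun f => a * sigma f + tau f) x = a * S sigma x + S tau x},
        forall sigma0, S0dual sigma0 ->
          forall e : R, 0 < e -> exists2 delta : R, 0 < delta &
            forall sigma, S0dual sigma ->
              (S0dual_norm (fun f => (sigma f - sigma0 f)%R) < delta%:E)%E ->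
              (S0norm (fun x => (S sigma x - S sigma0 x)%R) < e%:E)%E &
        exists2 K, M1 s K & has_kernel S K]].

Definition weyl (a : 'rV[R]_(d + d) -> R[i]) (f : fct) : fct :=
  fun t => Cintegral (phase_measure d)
    (fun z => let: (y, xi) := z in
       cis (2 * pi * dotv (t - y) xi) * a (row_mx (2^-1 *: (t + y)) xi) * f y).

(* Operators are considered on S_0(R^d), where the integral defining Op_{1/2}(a)
   converges absolutely, and up to equality a.e. *)
Definition schwartz_operators : set (fct -> fct) :=
  [set T | exists2 a, schwartz a &
     forall f, S0 f -> {ae lebesgue_rV d, forall t, T f t = weyl a f t}].

Definition integral_kernel (T : fct -> fct) (K : 'rV[R]_(d + d) -> R[i]) : Prop :=
  forall f, S0 f -> {ae lebesgue_rV d, forall x,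
    T f x = Cintegral (lebesgue_rV d) (fun y => K (row_mx x y) * f y)}.

(* The operators on S_0 identified, through their kernels, with those of a class
   of operators from S_0' to S_0. *)
Definition identified_by_kernel (M : set ((fct -> R[i]) -> fct)) :
    set (fct -> fct) :=
  [set T | exists2 S, M S & exists2 K, has_kernel S K & integral_kernel T K].

End operators.

Arguments M1_operators {R} d s.
Arguments schwartz_operators R d : clear implicits.

(* Main.v *)
From HB Require Import structures.
Require Import Defs.
From mathcomp Require Import all_boot all_order all_algebra.
From mathcomp Require Import complex.
From mathcomp Require Import all_classical all_reals all_analysis.
From mathcomp Require Import measurable_realfun ring lra.

(** The theorem says that being a Weyl operator with a Schwartz symbol is a
property of the integral kernel, which can be measured by the decay of its
short-time Fourier transform. Two facts make it work.

The symbol [a] and the kernel [K] determine each other through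
[K(x, y) = (F a)((x + y) / 2, x - y)], where [F] is the Fourier transform in the
second block of variables. The transform and the linear change of variables
preserve the Schwartz space, so Schwartz symbols correspond exactly to Schwartz
kernels ([schwartz_weyl_kernel], [weyl_integral], [schwartz_symbol]).

Up to null sets, a function of [S0] is Schwartz if and only if its short-time
Fourier transform is
integrable against all polynomial weights. In one direction the transform of a
Schwartz function decreases rapidly, by integration by parts ([stft_decay]); in
the other a function of [S0] is, up to a constant and a null set, the
superposition of the time-frequency shifts of the Gaussian with its transform
as coefficients ([stft_inversion]), and such a superposition is Schwartz when
the coefficients have all weights ([schwartz_synth]). The weights
[v_s(x, w) v_s(u, v)], for all [s], are cofinal with the polynomial ones
([vweight_le], [jb_le_vweight]).

What remains is the passage between kernels and operators on the dual of [S0].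

If [K] is Schwartz, then [x |-> sigma (conj K(x, .))] is a Schwartz function of
[x] for each functional [sigma], with seminorms bounded by the norm of [sigma]:
the Taylor expansion of [K] in [x] has a remainder that is small in [S0], so
the functional can be applied to the expansion ([cdiff_dual_section],
[bnd_dual_section]). This gives an operator in each of the classes
([schwartz_kernel_M1_operators]).

Conversely an operator [S] of the intersection has for each [s] a kernel of
class [M1 s], a priori depending on [s]. A function [f] of [S0] acts on [S0] by
integration ([pairing_S0dual]), so each of these kernels is an integral kernel
of the operator [T] identified with [S] ([kernel_action]). At the point
[((z1, z2), (w1, w2))] their short-time Fourier transforms are all equal to the
integral of [T] applied to a shifted Gaussian against another one
([stft_kernel_unique]). So one transform has all weights, its synthesis is
Schwartz and represents one of the kernels, and the symbol is recovered from it.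

The inversion formula for the short-time Fourier transform rests on Fourier
inversion almost everywhere for integrable functions with integrable transform.
It is obtained by damping with Gaussians, which are their own Fourier transforms
([fourier_gaussian]); the limit is taken after integration against continuous
functions, and these determine an integrable function
([ae0_of_continuous]). *)

Set Implicit Arguments.
Unset Strict Implicit.
Unset Printing Implicit Defensive.

Import Order.TTheory GRing.Theory Num.Theory.
Import numFieldNormedType.Exports.
Import Normc.

Local Open Scope classical_set_scope.
Local Open Scope ring_scope.
Local Open Scope complex_scope.

Local Notation Re := complex.Re.
Local Notation Im := complex.Im.

(** * Complex numbers and vectors *)

Lemma mvt0 {R : realType} (f df : R -> R) (s : R) : 0 <= s ->
  (forall x : R, is_derive x (1 : R) f (df x)) ->
  exists2 c, 0 <= c <= s & f s - f 0 = df c * s.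
Proof.
move=> s0 fdf; have [|c] := @MVT_segment R f df 0 s s0 (fun x _ => fdf x).
  apply: continuous_subspaceT => {}x.
  exact/differentiable_continuous/derivable1_diffP/(@ex_derive _ _ _ _ _ _ _ (fdf x)).
by rewrite in_itv/= subr0 => ? ?; exists c.
Qed.

Section complex_numbers.
Context {R : realType}.
Implicit Types z w : R[i].

Lemma ReM z w : Re (z * w) = Re z * Re w - Im z * Im w.
Proof. by case: z w => [a b] [c d]. Qed.

Lemma ImM z w : Im (z * w) = Re z * Im w + Im z * Re w.
Proof. by case: z w => [a b] [c d]. Qed.

Lemma ReD z w : Re (z + w) = Re z + Re w.
Proof. by case: z w => [a b] [c d]. Qed.

Lemma ImD z w : Im (z + w) = Im z + Im w.
Proof. by case: z w => [a b] [c d]. Qed.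

Lemma ReN z : Re (- z) = - Re z. Proof. by case: z. Qed.

Lemma ImN z : Im (- z) = - Im z. Proof. by case: z. Qed.

Lemma Reconj z : Re (conjc z) = Re z. Proof. by case: z. Qed.

Lemma Imconj z : Im (conjc z) = - Im z. Proof. by case: z. Qed.

Definition ReImE := (ReD, ImD, ReN, ImN, ReM, ImM, Reconj, Imconj).

Lemma complex_ext z w : Re z = Re w -> Im z = Im w -> z = w.
Proof. by case: z w => [a b] [c d] /= -> ->. Qed.

Lemma Re_sum I (r : seq I) (P : pred I) (F : I -> R[i]) :
  Re (\sum_(i <- r | P i) F i) = \sum_(i <- r | P i) Re (F i).
Proof. by apply: (big_morph _ ReD). Qed.

Lemma Im_sum I (r : seq I) (P : pred I) (F : I -> R[i]) :
  Im (\sum_(i <- r | P i) F i) = \sum_(i <- r | P i) Im (F i).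
Proof. by apply: (big_morph _ ImD). Qed.

Lemma conjcM z w : conjc (z * w) = conjc z * conjc w.
Proof. exact: rmorphM. Qed.

Lemma conjcD z w : conjc (z + w) = conjc z + conjc w.
Proof. exact: rmorphD. Qed.

Lemma conjcN z : conjc (- z) = - conjc z.
Proof. exact: rmorphN. Qed.

Lemma normc_ge0 z : 0 <= normc z.
Proof. by case: z => a b; exact: sqrtr_ge0. Qed.

Lemma normcD z w : normc (z + w) <= normc z + normc w.
Proof. exact: le_normcD. Qed.

Lemma normcB z w : normc (z - w) <= normc z + normc w.
Proof. by rewrite (le_trans (normcD _ _))// normcN. Qed.

Lemma normc_conj z : normc (conjc z) = normc z.
Proof. by case: z => a b; rewrite /normc/= sqrrN. Qed.

Lemma normc_real (x : R) : normc x%:C = `|x|.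
Proof. by rewrite /normc/= expr0n/= addr0 sqrtr_sqr. Qed.

Lemma normc_i : normc ('i%C : R[i]) = 1.
Proof. by rewrite /normc/= expr0n/= expr1n add0r sqrtr1. Qed.

Lemma normc_Re z : `|Re z| <= normc z.
Proof.
case: z => a b; rewrite /normc/= -sqrtr_sqr ler_wsqrtr// lerDl.
exact: sqr_ge0.
Qed.

Lemma normc_Im z : `|Im z| <= normc z.
Proof.
case: z => a b; rewrite /normc/= -(sqrtr_sqr b) ler_wsqrtr// lerDr.
exact: sqr_ge0.
Qed.

Lemma normc_le z : normc z <= `|Re z| + `|Im z|.
Proof.
rewrite {1}(complexE z); apply: (le_trans (normcD _ _)).
by rewrite normcM normc_i mul1r !normc_real.
Qed.

Lemma normc_sum I (r : seq I) (P : pred I) (F : I -> R[i]) :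
  normc (\sum_(i <- r | P i) F i) <= \sum_(i <- r | P i) normc (F i).
Proof.
elim/big_ind2 : _ => //; first by rewrite normc0.
by move=> x a y b xa yb; rewrite (le_trans (normcD _ _))// lerD.
Qed.

Lemma normc_cis (t : R) : normc (cis t) = 1.
Proof. by rewrite /normc/= cos2Dsin2 sqrtr1. Qed.

Lemma cisD (s t : R) : cis (s + t) = cis s * cis t.
Proof. by apply: complex_ext; rewrite ReImE /= ?cosD ?sinD// addrC. Qed.

Lemma cis0 : cis (0 : R) = 1.
Proof. by rewrite /cis cos0 sin0. Qed.

Lemma ler_abs_sin (s : R) : `|sin s| <= `|s|.
Proof.
wlog s0 : s / 0 <= s.
  move=> H; case: (leP 0 s) => [/H//|s0].
  by rewrite -normrN -sinN -(normrN s) H// oppr_ge0 ltW.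
have [c _ E] := @mvt0 R (@sin R) (@cos R) s s0 _.
rewrite sin0 !subr0 in E; rewrite E normrM ler_piMl// ler_norml.
by rewrite cos_geN1 cos_le1.
Qed.

Lemma ler_abs_cosB1 (s : R) : `|cos s - 1| <= s ^+ 2.
Proof.
wlog s0 : s / 0 <= s.
  move=> H; case: (leP 0 s) => [/H//|s0].
  by rewrite -cosN -(sqrrN s) H// oppr_ge0 ltW.
have [c cs E] := @mvt0 R (@cos R) (fun x => - sin x) s s0 _.
rewrite cos0 in E; rewrite E normrM normrN expr2 (ger0_norm s0).
rewrite ler_wpM2r// (le_trans (ler_abs_sin c))//.
by move: cs => /andP[c0 cs]; rewrite ger0_norm.
Qed.

Lemma ler_abs_sinB (s : R) : `|sin s - s| <= s ^+ 2.
Proof.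
wlog s0 : s / 0 <= s.
  move=> H; case: (leP 0 s) => [/H//|s0].
  move: (H (- s)); rewrite sinN sqrrN oppr_ge0 ltW// -opprD normrN.
  exact.
have [c cs E] := @mvt0 R (@sin R) (@cos R) s s0 _.
rewrite sin0 !subr0 in E.
have -> : sin s - s = (cos c - 1) * s by rewrite E; ring.
rewrite normrM expr2 (ger0_norm s0) ler_wpM2r//.
move: cs => /andP[c0 cs]; apply: le_trans cs.
have [e es Ee] := @mvt0 R (@cos R) (fun x => - sin x) c c0 _.
rewrite cos0 in Ee; rewrite Ee normrM normrN (ger0_norm c0).
by rewrite ler_piMl// ler_norml sin_geN1 sin_le1.
Qed.

Lemma normc_cisB1 (s : R) : normc (cis s - 1) <= 2 * `|s|.
Proof.
have h : `|cos s - 1| <= `|s|.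
  wlog s0 : s / 0 <= s.
    move=> H; case: (leP 0 s) => [/H//|s0].
    by rewrite -cosN -(normrN s) H// oppr_ge0 ltW.
  have [c cs E] := @mvt0 R (@cos R) (fun x => - sin x) s s0 _.
  rewrite cos0 in E; rewrite E normrM normrN.
  by rewrite ler_piMl// ler_norml sin_geN1 sin_le1.
apply: (le_trans (normc_le _)); rewrite !ReImE/= subr0 mulr_natl mulr2n.
by rewrite lerD// ler_abs_sin.
Qed.

Lemma normc_cisB2 (s : R) : normc (cis s - 1 - 'i%C * s%:C) <= 2 * s ^+ 2.
Proof.
apply: (le_trans (normc_le _)).
have -> : Re (cis s - 1 - 'i%C * s%:C) = cos s - 1 by rewrite !ReImE/=; ring.
have -> : Im (cis s - 1 - 'i%C * s%:C) = sin s - s by rewrite !ReImE/=; ring.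
rewrite mulr_natl mulr2n.
by rewrite lerD ?ler_abs_sinB ?ler_abs_cosB1.
Qed.

End complex_numbers.

Section vectors.
Context {R : realType}.

Definition l1 n (x : 'rV[R]_n) : R := \sum_i `|x ord0 i|.

(** Up to constants [jb x] is [1 + |x|], the weight of the Schwartz seminorms;
unlike the latter it is read off coordinate by coordinate, and it is
submultiplicative. *)
Definition jb n (x : 'rV[R]_n) : R := 1 + l1 x.

(** A tensor product, hence with an integral that is a power of a
one-dimensional one; it serves as the integrable majorant of everything that
decays fast. *)
Definition ijb n (x : 'rV[R]_n) : R := \prod_i (1 + x ord0 i ^+ 2)^-1.

Section fixed_dimension.
Context {n : nat}.
Implicit Types x y h : 'rV[R]_n.

Lemma l1_ge0 x : 0 <= l1 x. Proof. by apply: sumr_ge0. Qed.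

Lemma jb_ge1 x : 1 <= jb x. Proof. by rewrite lerDl l1_ge0. Qed.

Lemma jb_gt0 x : 0 < jb x. Proof. exact: lt_le_trans (jb_ge1 x). Qed.

Lemma jb_ge0 x : 0 <= jb x. Proof. exact/ltW/jb_gt0. Qed.

Lemma jbX_ge1 x k : 1 <= jb x ^+ k.
Proof. by rewrite exprn_ege1// jb_ge1. Qed.

Lemma jbX_ge0 x k : 0 <= jb x ^+ k.
Proof. by rewrite exprn_ge0// jb_ge0. Qed.

Lemma jbX_le x k m : (k <= m)%N -> jb x ^+ k <= jb x ^+ m.
Proof. by move=> km; rewrite ler_weXn2l// jb_ge1. Qed.

Lemma l1D x y : l1 (x + y) <= l1 x + l1 y.
Proof.
by rewrite /l1 -big_split/=; apply: ler_sum => i _; rewrite mxE ler_normD.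
Qed.

Lemma l1N x : l1 (- x) = l1 x.
Proof. by apply: eq_bigr => i _; rewrite mxE normrN. Qed.

Lemma l1Z a x : l1 (a *: x) = `|a| * l1 x.
Proof. by rewrite mulr_sumr; apply: eq_bigr => i _; rewrite mxE normrM. Qed.

Lemma jbN x : jb (- x) = jb x. Proof. by rewrite /jb l1N. Qed.

Lemma jbD x y : jb (x + y) <= jb x * jb y.
Proof.
rewrite /jb mulrDr mulr1 mulrDl mul1r !addrA.
have := l1D x y; have := mulr_ge0 (l1_ge0 x) (l1_ge0 y); lra.
Qed.

Lemma jbB x y : jb (x - y) <= jb x * jb y.
Proof. by rewrite -(jbN y) jbD. Qed.

Lemma coord_l1 x i : `|x ord0 i| <= l1 x.
Proof. by rewrite /l1 (bigD1 i)//= lerDl sumr_ge0. Qed.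

Lemma coord_jb x i : `|x ord0 i| <= jb x.
Proof. by rewrite (le_trans (coord_l1 x i))// lerDr. Qed.

Lemma l1_jb x : l1 x <= jb x. Proof. by rewrite lerDr. Qed.

Lemma l1_norm x : l1 x <= n%:R * `|x|.
Proof.
rewrite /l1 -[n in n%:R]card_ord -sum1_card natr_sum mulr_suml.
apply: ler_sum => i _; rewrite mul1r.
by rewrite [`|x|]mx_normrE; exact: (le_bigmax _ (fun i => `|x i.1 i.2|) (ord0, i)).
Qed.

Lemma dotvDl x y z : dotv (x + y) z = dotv x z + dotv y z.
Proof. by rewrite -big_split; apply: eq_bigr => i _; rewrite mxE mulrDl. Qed.

Lemma dotvC x y : dotv x y = dotv y x.
Proof. by apply: eq_bigr => i _; rewrite mulrC. Qed.

Lemma dotvDr x y z : dotv x (y + z) = dotv x y + dotv x z.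
Proof. by rewrite dotvC dotvDl !(dotvC x). Qed.

Lemma dotvZl a x y : dotv (a *: x) y = a * dotv x y.
Proof. by rewrite mulr_sumr; apply: eq_bigr => i _; rewrite mxE mulrA. Qed.

Lemma dotvZr a x y : dotv x (a *: y) = a * dotv x y.
Proof. by rewrite dotvC dotvZl dotvC. Qed.

Lemma dotvNl x y : dotv (- x) y = - dotv x y.
Proof. by rewrite -scaleN1r dotvZl mulN1r. Qed.

Lemma dotvNr x y : dotv x (- y) = - dotv x y.
Proof. by rewrite -scaleN1r dotvZr mulN1r. Qed.

Lemma dotv0 x : dotv x 0 = 0.
Proof. by rewrite -(scale0r 0) dotvZr mul0r. Qed.

Lemma dotvv_ge0 x : 0 <= dotv x x.
Proof. by apply: sumr_ge0 => i _; rewrite -expr2 sqr_ge0. Qed.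

Lemma normr_dotv x y : `|dotv x y| <= l1 x * l1 y.
Proof.
apply: (le_trans (ler_norm_sum _ _ _)).
rewrite /l1 mulr_suml; apply: ler_sum => i _; rewrite normrM ler_wpM2l//.
exact: coord_l1.
Qed.

Lemma coord_enorm x i : `|x ord0 i| <= enorm x.
Proof.
rewrite -sqrtr_sqr ler_wsqrtr// /dotv (bigD1 i)//= -expr2 lerDl.
by apply: sumr_ge0 => j _; rewrite -expr2 sqr_ge0.
Qed.

Lemma enorm_ge0 x : 0 <= enorm x. Proof. exact: sqrtr_ge0. Qed.

Lemma enorm_l1 x : enorm x <= l1 x.
Proof.
rewrite -[leRHS]ger0_norm ?l1_ge0// -sqrtr_sqr ler_wsqrtr//.
by rewrite (le_trans (ler_norm _))// (le_trans (normr_dotv _ _)).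
Qed.

Lemma l1_enorm x : l1 x <= n%:R * enorm x.
Proof.
rewrite /l1 -[n in n%:R]card_ord -sum1_card natr_sum mulr_suml.
by apply: ler_sum => i _; rewrite mul1r coord_enorm.
Qed.

Lemma enorm_jb x : 1 + enorm x <= jb x.
Proof. by rewrite lerD2l enorm_l1. Qed.

Lemma jb_enorm x : jb x <= n.+1%:R * (1 + enorm x).
Proof.
rewrite -natr1 mulrDl mulrDr mulr1 mul1r /jb.
have := l1_enorm x; have := enorm_ge0 x; have := ler0n R n; lra.
Qed.

Lemma dotv_jb x : 1 + dotv x x <= jb x ^+ 2.
Proof.
have := normr_dotv x x; have := l1_ge0 x; have := ler_norm (dotv x x).
by rewrite /jb; nra.
Qed.

(** From [l1 x <= n |x|] and [(1 + |x|)^2 <= 2 (1 + |x|^2)]. *)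
Lemma jb_dotv x : jb x ^+ 2 <= (2 * n.+1%:R ^+ 2) * (1 + dotv x x).
Proof.
have -> : dotv x x = enorm x ^+ 2 by rewrite sqr_sqrtr// dotvv_ge0.
have h := jb_enorm x; have e0 := enorm_ge0 x.
apply: (@le_trans _ _ ((n.+1%:R * (1 + enorm x)) ^+ 2)).
  by rewrite lerXn2r ?nnegrE ?jb_ge0// mulr_ge0// addr_ge0.
rewrite exprMn (_ : 2 * _ * _ = n.+1%:R ^+ 2 * (2 * (1 + enorm x ^+ 2))); last by ring.
rewrite ler_wpM2l ?sqr_ge0//.
have := sqr_ge0 (1 - enorm x); nra.
Qed.

Lemma ijb_gt0 x : 0 < ijb x.
Proof.
by apply: prodr_gt0 => i _; rewrite invr_gt0 ltr_pwDl// sqr_ge0.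
Qed.

Lemma ijb_ge0 x : 0 <= ijb x. Proof. exact/ltW/ijb_gt0. Qed.

Lemma ijb_jb x : 1 <= ijb x * jb x ^+ (2 * n).
Proof.
rewrite /ijb prodfV mulrC ler_pdivlMr ?mul1r; last first.
  by apply: prodr_gt0 => i _; rewrite ltr_pwDl// sqr_ge0.
rewrite exprM -[n in _ ^+ n]card_ord -prodr_const.
apply: ler_prod => i _; rewrite addr_ge0 ?sqr_ge0//=.
have := coord_l1 x i; rewrite -(real_normK (num_real (x ord0 i))) /jb.
have := normr_ge0 (x ord0 i); nra.
Qed.

(** Decay of order [2 n] is turned into an integrable bound: each factor [1 +
x_i^2] is at most [jb x ^+ 2]. *)
Lemma le_ijb x (a C : R) : 0 <= a -> jb x ^+ (2 * n) * a <= C -> a <= C * ijb x.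
Proof.
move=> a0 aC; apply: (@le_trans _ _ ((ijb x * jb x ^+ (2 * n)) * a)).
  by rewrite ler_peMl// ijb_jb.
by rewrite -mulrA mulrC ler_wpM2r// ijb_ge0.
Qed.

End fixed_dimension.

Lemma l1_row_mx m n (x : 'rV[R]_m) (y : 'rV[R]_n) :
  l1 (row_mx x y) = l1 x + l1 y.
Proof.
rewrite /l1 big_split_ord/=; congr (_ + _); apply: eq_bigr => i _.
  by rewrite row_mxEl.
by rewrite row_mxEr.
Qed.

Lemma jb_row_mxl m n (x : 'rV[R]_m) (y : 'rV[R]_n) : jb x <= jb (row_mx x y).
Proof. by rewrite /jb l1_row_mx; have := l1_ge0 y; lra. Qed.

Lemma jb_row_mxr m n (x : 'rV[R]_m) (y : 'rV[R]_n) : jb y <= jb (row_mx x y).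
Proof. by rewrite /jb l1_row_mx; have := l1_ge0 x; lra. Qed.

Lemma dotv_row_mx m n (x x' : 'rV[R]_m) (y y' : 'rV[R]_n) :
  dotv (row_mx x y) (row_mx x' y') = dotv x x' + dotv y y'.
Proof.
rewrite /dotv big_split_ord/=; congr (_ + _); apply: eq_bigr => i _.
  by rewrite !row_mxEl.
by rewrite !row_mxEr.
Qed.

End vectors.

(** * Lebesgue measure on row vectors *)

Section measurability.
Context {R : realType}.

Lemma measurable_coord n (i : 'I_n) :
  measurable_fun setT (fun x : 'rV[R]_n => x ord0 i).
Proof. exact: measurable_rV_coord. Qed.

Lemma measurable_rVP d (T : measurableType d) n (f : T -> 'rV[R]_n) :
  (forall i, measurable_fun setT (fun t => f t ord0 i)) -> measurable_fun setT f.
Proof. by move=> mf; apply: measurable_fun_rV => i; exact: mf. Qed.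

Section operations.
Context d (T : measurableType d).

Lemma measurable_rV_comp n (f : T -> 'rV[R]_n) i :
  measurable_fun setT f -> measurable_fun setT (fun t => f t ord0 i).
Proof. by move=> mf; apply: (measurableT_comp (measurable_coord i)). Qed.

Lemma measurable_rVD n (f g : T -> 'rV[R]_n) :
  measurable_fun setT f -> measurable_fun setT g ->
  measurable_fun setT (fun t => f t + g t).
Proof.
move=> mf mg; apply: measurable_rVP => i.
under eq_fun do rewrite mxE.
by apply: measurable_funD; exact: measurable_rV_comp.
Qed.

Lemma measurable_rVZ n (a : R) (f : T -> 'rV[R]_n) :
  measurable_fun setT f -> measurable_fun setT (fun t => a *: f t).
Proof.
move=> mf; apply: measurable_rVP => i.
under eq_fun do rewrite mxE.
by apply: measurable_funM => //; exact: measurable_rV_comp.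
Qed.

Lemma measurable_rVB n (f g : T -> 'rV[R]_n) :
  measurable_fun setT f -> measurable_fun setT g ->
  measurable_fun setT (fun t => f t - g t).
Proof.
move=> mf mg; under eq_fun do rewrite -scaleN1r.
by apply: measurable_rVD => //; exact: measurable_rVZ.
Qed.

Lemma measurable_dotv n (f g : T -> 'rV[R]_n) :
  measurable_fun setT f -> measurable_fun setT g ->
  measurable_fun setT (fun t => dotv (f t) (g t)).
Proof.
move=> mf mg; apply: measurable_sum => i.
by apply: measurable_funM; exact: measurable_rV_comp.
Qed.

Lemma measurable_row_mx m n (f : T -> 'rV[R]_m) (g : T -> 'rV[R]_n) :
  measurable_fun setT f -> measurable_fun setT g ->
  measurable_fun setT (fun t => row_mx (f t) (g t)).
Proof.
move=> mf mg; apply: measurable_rVP => i; case: (split_ordP i) => j ->.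
  by under eq_fun do rewrite row_mxEl; exact: measurable_rV_comp.
by under eq_fun do rewrite row_mxEr; exact: measurable_rV_comp.
Qed.

Lemma measurable_lsubmx m n (f : T -> 'rV[R]_(m + n)) :
  measurable_fun setT f -> measurable_fun setT (fun t => lsubmx (f t)).
Proof.
move=> mf; apply: measurable_rVP => i.
by under eq_fun do rewrite mxE; exact: measurable_rV_comp.
Qed.

Lemma measurable_rsubmx m n (f : T -> 'rV[R]_(m + n)) :
  measurable_fun setT f -> measurable_fun setT (fun t => rsubmx (f t)).
Proof.
move=> mf; apply: measurable_rVP => i.
by under eq_fun do rewrite mxE; exact: measurable_rV_comp.
Qed.

Lemma measurable_jb n (f : T -> 'rV[R]_n) :
  measurable_fun setT f -> measurable_fun setT (fun t => jb (f t)).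
Proof.
move=> mf; apply: measurable_funD => //; apply: measurable_sum => i.
by apply: measurableT_comp => //; exact: measurable_rV_comp.
Qed.

Lemma measurable_ijb n (f : T -> 'rV[R]_n) :
  measurable_fun setT f -> measurable_fun setT (fun t => ijb (f t)).
Proof.
move=> mf; apply: measurable_prod => i _.
have h : measurable_fun setT (fun x : R => (1 + x ^+ 2)^-1).
  by apply: continuous_measurable_fun; exact: continuous_oneDsqrV.
by apply: (measurableT_comp h); exact: measurable_rV_comp.
Qed.

End operations.

(** A continuous function is the pointwise limit of its values on ever finer
grids, and a grid has only countably many cells, which are products of
intervals. *)
Lemma continuous_measurable_rV n (f : 'rV[R]_n -> R) :
  continuous f -> measurable_fun setT f.
Proof.
move=> cf.
(* The cell of [x] in the grid of mesh [1 / (k + 1)], and its corner. *)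
pose cell k (x : 'rV[R]_n) : 'rV[int]_n :=
  \row_i Num.floor (k.+1%:R * x ord0 i).
pose pt k (v : 'rV[int]_n) : 'rV[R]_n := \row_i ((v ord0 i)%:~R / k.+1%:R).
have mcell k v : measurable [set x | cell k x = v].
  have -> : [set x | cell k x = v] = \big[setI/setT]_(i < n)
      [set x : 'rV[R]_n | Num.floor (k.+1%:R * x ord0 i) = v ord0 i].
    rewrite -bigcap_seq; apply/seteqP; split => x /=.
      by move=> <- i _ /=; rewrite mxE.
    by move=> xv; apply/rowP => i; rewrite mxE; apply: xv; rewrite /= mem_index_enum.
  apply: bigsetI_measurable => i _.
  have -> : [set x : 'rV[R]_n | Num.floor (k.+1%:R * x ord0 i) = v ord0 i] =
    (fun x => k.+1%:R * x ord0 i) @^-1` `[(v ord0 i)%:~R, (v ord0 i + 1)%:~R[.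
    apply/seteqP; split => x /=; rewrite in_itv/=.
      by move=> /eqP; rewrite floor_eq.
    by move=> ?; apply/eqP; rewrite floor_eq.
  rewrite -[X in measurable X]setTI.
  have : measurable_fun setT (fun x : 'rV[R]_n => k.+1%:R * x ord0 i).
    by apply: measurable_funM => //; exact: measurable_coord.
  by apply => //; exact: measurable_itv.
apply: (@measurable_fun_cvg _ _ _ _ (fun k x => f (pt k (cell k x)))).
- move=> k _ Y mY; rewrite setTI.
  have -> : (fun x => f (pt k (cell k x))) @^-1` Y =
      \bigcup_(v in [set v | Y (f (pt k v))]) [set x | cell k x = v].
    apply/seteqP; split => [x Yx|x [v Yv xv]]; last by rewrite /preimage/= xv.
    by exists (cell k x).
  rewrite bigcup_mkcond; apply: countable_bigcupT_measurable.
    exact: countableP.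
  by move=> v; case: ifP.
- move=> x _; apply: continuous_cvg; first exact: cf.
  apply/cvgrPdist_le => e e0.
  near=> k.
  rewrite /Num.norm/= mx_normrE; apply: bigmax_le; first exact: ltW.
  move=> [i j] _ /=; rewrite ord1 !mxE.
  have /andP[h1 h2] := floor_itv (k.+1%:R * x ord0 j).
  have k0 : 0 < k.+1%:R :> R by rewrite ltr0n.
  set t := Num.floor _ in h1 h2 *.
  have -> : x ord0 j - t%:~R / k.+1%:R = (k.+1%:R * x ord0 j - t%:~R) / k.+1%:R.
    by rewrite mulrBl mulrAC mulfV ?mul1r// gt_eqF.
  rewrite ger0_norm; last by rewrite divr_ge0 ?subr_ge0// ltW.
  rewrite ler_pdivrMr//; move: h2; rewrite rmorphD/= => h2.
  have : 1 <= e * k.+1%:R.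
    rewrite mulrC -ler_pdivrMr// mul1r; near: k.
    exists (Num.truncn e^-1) => // m /= tm.
    by rewrite ltW// (lt_le_trans (truncnS_gt _))// ler_nat ltnS.
  lra.
Unshelve. all: by end_near. Qed.

End measurability.

Section integration.
Context {R : realType}.
Local Open Scope ereal_scope.
Notation lam := (@lebesgue_rV R).

Lemma rV_consE n (v : 'rV[R]_n.+1) : v = rV_cons (rV_uncons v).
Proof.
transitivity (row_mx (lsubmx (v : 'rV_(1 + n))) (rsubmx (v : 'rV_(1 + n)))).
  by rewrite hsubmxK.
rewrite /rV_cons /rV_uncons/=.
rewrite [in RHS](_ : _%:M = lsubmx (v : 'rV_(1 + n)))//.
by apply/rowP => i; rewrite !ord1 !mxE eqxx mulr1n.
Qed.

Lemma rV_cons0 n s (v : 'rV[R]_n) : rV_cons (s, v) ord0 ord0 = s.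
Proof.
have -> : ord0 = lshift n (ord0 : 'I_1) :> 'I_n.+1 by exact: val_inj.
apply: eq_trans (@row_mxEl R 1 1 n _ _ ord0 ord0) _.
by rewrite mxE eqxx mulr1n.
Qed.

Lemma rV_consS n s (v : 'rV[R]_n) j : rV_cons (s, v) ord0 (lift ord0 j) = v ord0 j.
Proof.
have -> : lift ord0 j = rshift 1 j by exact: val_inj.
exact: (@row_mxEr R 1 1 n _ _ ord0 j).
Qed.

Lemma ge0_integral_rV_cons n (f : 'rV[R]_n.+1 -> \bar R) :
  measurable_fun setT f -> (forall x, 0 <= f x) ->
  \int[lam n.+1]_x f x = \int[lebesgue_measure]_s \int[lam n]_v f (rV_cons (s, v)).
Proof.
move=> mf f0; rewrite /= /lebesgue_step (ge0_integral_pushforward (@measurable_rV_cons R n))//.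
rewrite preimage_setT fubini_tonelli1//; last by move=> x; exact: f0.
by apply: measurableT_comp => //; exact: measurable_rV_cons.
Qed.

Lemma row_mx_cons m n s (x : 'rV[R]_m) (y : 'rV[R]_n) :
  row_mx (rV_cons (s, x)) y = rV_cons (s, row_mx x y).
Proof.
apply/rowP => i; case: (unliftP ord0 i) => [j ->|->]; last first.
  rewrite rV_cons0.
  have -> : ord0 = lshift n (ord0 : 'I_m.+1) :> 'I_(m.+1 + n) by exact: val_inj.
  by rewrite row_mxEl rV_cons0.
rewrite rV_consS; case: (split_ordP j) => k ->.
  rewrite row_mxEl.
  have -> : lift ord0 (lshift n k) = lshift n (lift ord0 k) :> 'I_(m.+1 + n).
    exact: val_inj.
  by rewrite row_mxEl rV_consS.
rewrite row_mxEr.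
have -> : lift ord0 (rshift m k) = rshift m.+1 k :> 'I_(m.+1 + n).
  exact: val_inj.
by rewrite row_mxEr.
Qed.

(** Both sides peel off the coordinates of the first factor one at a time. *)
Lemma ge0_integral_row_mx m n (f : 'rV[R]_(m + n) -> \bar R) :
  measurable_fun setT f -> (forall x, 0 <= f x) ->
  \int[lam (m + n)]_z f z = \int[lam m]_x \int[lam n]_y f (row_mx x y).
Proof.
have mrow k : measurable_fun setT
    (fun p : 'rV[R]_k * 'rV[R]_n => row_mx p.1 p.2).
  by apply: measurable_row_mx; [exact: measurable_fst|exact: measurable_snd].
elim: m f => [|m IH] f mf f0.
  rewrite [RHS]integral_dirac//.
    rewrite diracT mul1e; apply: eq_integral => y _; congr f.
    apply/rowP => i; rewrite -[i in RHS](_ : rshift 0 i = i) ?row_mxEr//.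
    exact: val_inj.
  apply: (measurable_fun_fubini_tonelli_F (fun p => f (row_mx p.1 p.2))) => //.
  exact: (measurableT_comp mf (mrow _)).
rewrite [LHS]ge0_integral_rV_cons// ge0_integral_rV_cons; first last.
- by move=> x; exact: integral_ge0.
- apply: (measurable_fun_fubini_tonelli_F (fun p => f (row_mx p.1 p.2))) => //.
  exact: (measurableT_comp mf (mrow m.+1)).
apply: eq_integral => s _.
have mfs : measurable_fun setT (fun v : 'rV[R]_(m + n) => f (rV_cons (s, v))).
  apply: (measurableT_comp mf); apply: measurableT_comp => //.
  exact: measurable_rV_cons.
rewrite (IH _ mfs (fun v => f0 _)).
apply: eq_integral => x _; apply: eq_integral => y _.
by rewrite row_mx_cons.
Qed.

(** The rescaled image of Lebesgue measure gives every interval its length, so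
it is Lebesgue measure. *)
Lemma ge0_integral_aff1 (e z : R) (f : R -> \bar R) : (0 < e)%R ->
  measurable_fun setT f -> (forall x, 0 <= f x) ->
  e%:E * \int[lebesgue_measure]_s f (e * s + z)%R = \int[lebesgue_measure]_s f s.
Proof.
move=> e0 mf f0.
pose aff : measurableTypeR R -> measurableTypeR R := fun s => (e * s + z)%R.
have maff : measurable_fun setT aff.
  by apply: measurable_funD => //; apply: measurable_funM.
pose k : {nonneg R}%R := NngNum (ltW e0).
have E : \int[lebesgue_measure]_s f s =
    \int[mscale k (pushforward lebesgue_measure aff)]_s f s.
  move=> m; apply: eq_measure_integral => //= A mA _.
  apply: lebesgue_measure_unique => //= _ [[a b]] _ <-/=.
  rewrite /mscale/= /pushforward.
  have -> : aff @^-1` `]a, b] = `]((a - z) / e)%R, ((b - z) / e)%R]%classic.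
    apply/seteqP; split => s /=; rewrite !in_itv/= /aff.
      by rewrite ltr_pdivrMr// ler_pdivlMr// ltrBlDr lerBrDr (mulrC s).
    by rewrite ltr_pdivrMr// ler_pdivlMr// ltrBlDr lerBrDr (mulrC s).
  rewrite !lebesgue_measure_itv/= !lte_fin ltr_pM2r ?invr_gt0// ltrD2r.
  case: ifP => _; last by rewrite mule0.
  rewrite -!EFinB -EFinM; congr (_%:E); field.
  by rewrite gt_eqF.
rewrite (E maff) ge0_integral_mscale//= ge0_integral_pushforward//.
Qed.

(** One coordinate at a time, from the one-dimensional law; [e = 1] is the
invariance under translations. *)
Lemma ge0_integral_aff n (e : R) (z : 'rV[R]_n) (f : 'rV[R]_n -> \bar R) :
  (0 < e)%R -> measurable_fun setT f -> (forall x, 0 <= f x) ->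
  (e ^+ n)%:E * \int[lam n]_x f (e *: x + z)%R = \int[lam n]_x f x.
Proof.
move=> e0; elim: n z f => [|n IH] z f mf f0.
  rewrite expr0 mul1e; apply: eq_integral => x _; congr f.
  by apply/rowP; case.
have maff m (y : 'rV[R]_m) : measurable_fun setT (fun x : 'rV[R]_m => e *: x + y)%R.
  by apply: measurable_rVD => //; exact: measurable_rVZ.
rewrite ge0_integral_rV_cons//; last exact: (measurableT_comp mf (maff _ z)).
pose G s := \int[lam n]_v f (rV_cons (s, v)).
have mG : measurable_fun setT G.
  apply: (measurable_fun_fubini_tonelli_F (f \o @rV_cons R n)) => //.
    by apply: measurableT_comp => //; exact: measurable_rV_cons.
  by move=> x; exact: f0.
have G0 s : 0 <= G s by exact: integral_ge0.
rewrite (ge0_integral_rV_cons mf f0) -/G -[RHS](ge0_integral_aff1 (rV_uncons z).1 e0 mG G0).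
rewrite exprS EFinM -muleA; congr (_ * _).
have -> : \int[lebesgue_measure]_s G (e * s + (rV_uncons z).1)%R =
    \int[lebesgue_measure]_s ((e ^+ n)%:E *
       \int[lam n]_v f (e *: rV_cons (s, v) + z)%R).
  apply: eq_integral => s _; rewrite /G -(IH (rV_uncons z).2); last 2 first.
  - by apply: measurableT_comp => //; apply: measurableT_comp;
      [exact: measurable_rV_cons|exact: measurable_pair1].
  - by move=> x; exact: f0.
  congr (_ * _); apply: eq_integral => v _; congr f.
  rewrite [in RHS](rV_consE z); case: (rV_uncons z) => a b; apply/rowP => i.
  by case: (unliftP ord0 i) => [j ->|->];
    rewrite [RHS]mxE [in RHS]mxE ?rV_consS ?rV_cons0 ?mxE.
rewrite ge0_integralZl//.
- apply: (measurable_fun_fubini_tonelli_F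
    (fun p => f (e *: rV_cons p + z)%R)) => //.
  apply: measurableT_comp => //; apply: (measurableT_comp (maff _ z)).
  exact: measurable_rV_cons.
- by move=> s _; exact: integral_ge0.
- by rewrite lee_fin exprn_ge0// ltW.
Qed.

Lemma ge0_integral_shift n (z : 'rV[R]_n) (f : 'rV[R]_n -> \bar R) :
  measurable_fun setT f -> (forall x, 0 <= f x) ->
  \int[lam n]_x f (x + z)%R = \int[lam n]_x f x.
Proof.
move=> mf f0; rewrite -[RHS](@ge0_integral_aff n 1%R z)// expr1n mul1e.
by apply: eq_integral => x _; rewrite scale1r.
Qed.

(** Both [ijb] and the Gaussian are products of functions of one variable. *)
Lemma ge0_integral_prod n (f : R -> R) : measurable_fun setT f ->
  (forall x, 0 <= f x)%R ->
  \int[lam n]_x (\prod_i f (x ord0 i))%:E =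
  (\int[lebesgue_measure]_s (f s)%:E) ^+ n.
Proof.
move=> mf f0; elim: n => [|n IH].
  rewrite [LHS]integral_dirac//; first by rewrite diracT big_ord0 mul1e.
  rewrite (_ : (fun x => _) = cst 1)//.
  by apply/funext => x; rewrite big_ord0.
have mp m : measurable_fun setT (fun x : 'rV[R]_m => (\prod_i f (x ord0 i))%:E).
  apply/measurable_EFinP; apply: measurable_prod => i _.
  by apply: measurableT_comp => //; exact: measurable_coord.
have p0 m (x : 'rV[R]_m) : 0 <= (\prod_i f (x ord0 i))%:E.
  by rewrite lee_fin; apply: prodr_ge0.
rewrite ge0_integral_rV_cons//.
under eq_integral => s _.
  have -> : \int[lam n]_v (\prod_(i < n.+1) f (rV_cons (s, v) ord0 i))%:E =
    (f s)%:E * \int[lam n]_v (\prod_(i < n) f (v ord0 i))%:E.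
    rewrite -ge0_integralZl//; [|exact: mp|by rewrite lee_fin].
    apply: eq_integral => v _; rewrite -EFinM; congr (_%:E).
    rewrite big_ord_recl rV_cons0; congr (_ * _)%R.
    by apply: eq_bigr => i _; rewrite rV_consS.
  over.
rewrite ge0_integralZr//.
- by rewrite IH expeS.
- exact/measurable_EFinP.
- by move=> s _; rewrite lee_fin.
- exact: integral_ge0.
Qed.

End integration.

(** * Integrals of complex functions *)

Section complex_integration.
Context {R : realType} d (T : measurableType d).
Implicit Types f g : T -> R[i].

Definition cmeas f :=
  measurable_fun setT (fun x => Re (f x)) /\ measurable_fun setT (fun x => Im (f x)).

Lemma cmeas_cst c : cmeas (fun _ => c).
Proof. by split; exact: measurable_cst. Qed.

Lemma cmeasD f g : cmeas f -> cmeas g -> cmeas (fun x => f x + g x).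
Proof.
move=> [f1 f2] [g1 g2]; split; under eq_fun do rewrite ReImE.
  exact: measurable_funD.
exact: measurable_funD.
Qed.

Lemma cmeasM f g : cmeas f -> cmeas g -> cmeas (fun x => f x * g x).
Proof.
move=> [f1 f2] [g1 g2]; split; under eq_fun do rewrite ReImE.
  by apply: measurable_funB; exact: measurable_funM.
by apply: measurable_funD; exact: measurable_funM.
Qed.

Lemma cmeas_conj f : cmeas f -> cmeas (fun x => conjc (f x)).
Proof.
move=> [f1 f2]; split; first by under eq_fun do rewrite Reconj.
by under eq_fun do rewrite Imconj; exact: measurableT_comp.
Qed.

Lemma cmeas_real (f : T -> R) : measurable_fun setT f -> cmeas (fun x => (f x)%:C).
Proof. by move=> mf; split => //=; exact: measurable_cst. Qed.

Lemma cmeas_cis (f : T -> R) : measurable_fun setT f -> cmeas (fun x => cis (f x)).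
Proof.
move=> mf; split; apply: measurableT_comp mf; apply: continuous_measurable_fun.
  exact: continuous_cos.
exact: continuous_sin.
Qed.

Lemma measurable_normc f : cmeas f -> measurable_fun setT (fun x => normc (f x)).
Proof.
move=> [f1 f2].
have -> : (fun x => normc (f x)) =
    (fun x => (Re (f x) ^+ 2 + Im (f x) ^+ 2) `^ (2^-1)).
  apply/funext => x; case: (f x) => a b /=.
  by rewrite powR12_sqrt// addr_ge0// sqr_ge0.
apply: (measurableT_comp (measurable_powR _)).
by apply: measurable_funD; exact: measurable_funX.
Qed.

Variable mu : {measure set T -> \bar R}.

Definition cint f := mu.-integrable setT (EFin \o (fun x => Re (f x))) /\
  mu.-integrable setT (EFin \o (fun x => Im (f x))).

Lemma cint_cmeas f : cint f -> cmeas f.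
Proof. by move=> [] /integrableP[+ _] /integrableP[+ _]; split; exact/measurable_EFinP. Qed.

Lemma integrable_dom (h G : T -> R) : measurable_fun setT h ->
  mu.-integrable setT (EFin \o G) -> (forall x, `|h x| <= G x) ->
  mu.-integrable setT (EFin \o h).
Proof.
move=> mh iG hG; apply: le_integrable iG => //; first exact/measurable_EFinP.
by move=> x _ /=; rewrite lee_fin (le_trans (hG x))// ler_norm.
Qed.

Lemma cint_dom f (G : T -> R) : cmeas f -> mu.-integrable setT (EFin \o G) ->
  (forall x, normc (f x) <= G x) -> cint f.
Proof.
move=> [f1 f2] iG fG; split; apply: integrable_dom iG _ => // x;
  apply: le_trans (fG x); [exact: normc_Re|exact: normc_Im].
Qed.

Lemma cint_normc f : cint f -> mu.-integrable setT (EFin \o (fun x => normc (f x))).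
Proof.
move=> cf; have mf := cint_cmeas cf; case: cf => f1 f2.
have iG := integrableD measurableT (integrable_norm f1) (integrable_norm f2).
apply: le_integrable iG => //; first exact/measurable_EFinP/measurable_normc.
move=> x _ /=; rewrite lee_fin ger0_norm ?normc_ge0//.
rewrite (le_trans (normc_le _))//.
exact: ler_norm.
Qed.

Lemma cintP f : cmeas f -> mu.-integrable setT (EFin \o (fun x => normc (f x))) ->
  cint f.
Proof. by move=> mf /cint_dom; apply. Qed.

Lemma cintD f g : cint f -> cint g -> cint (fun x => f x + g x).
Proof.
move=> [f1 f2] [g1 g2]; split; rewrite /comp; under eq_fun do rewrite ReImE EFinD.
  exact: integrableD.
exact: integrableD.
Qed.

Lemma cintZ c f : cint f -> cint (fun x => c * f x).
Proof.
move=> cf; apply: cintP; first by apply: cmeasM; [exact: cmeas_cst|exact: cint_cmeas].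
have := integrableZl measurableT (normc c) (cint_normc cf).
by apply: eq_integrable => // x _ /=; rewrite normcM EFinM.
Qed.

Lemma cintN f : cint f -> cint (fun x => - f x).
Proof. by move=> /(cintZ (-1)); under eq_fun do rewrite mulN1r. Qed.

Lemma CintegralD f g : cint f -> cint g ->
  Cintegral mu (fun x => f x + g x) = Cintegral mu f + Cintegral mu g.
Proof.
move=> [f1 f2] [g1 g2]; apply: complex_ext; rewrite ReImE/= -RintegralD//;
  by apply: eq_Rintegral => x _; rewrite ReImE.
Qed.

Lemma CintegralZ c f : cint f ->
  Cintegral mu (fun x => c * f x) = c * Cintegral mu f.
Proof.
move=> [f1 f2]; have i1 r := integrableZl measurableT r f1.
have i2 r := integrableZl measurableT r f2.
apply: complex_ext; rewrite ReImE/=.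
  under eq_Rintegral do rewrite ReImE.
  by rewrite RintegralB ?RintegralZl//; [exact: i1|exact: i2].
under eq_Rintegral do rewrite ReImE.
by rewrite RintegralD ?RintegralZl//; [exact: i2|exact: i1].
Qed.

Lemma CintegralN f : cint f -> Cintegral mu (fun x => - f x) = - Cintegral mu f.
Proof.
by move=> cf; under eq_fun do rewrite -mulN1r; rewrite CintegralZ// mulN1r.
Qed.

Lemma CintegralB f g : cint f -> cint g ->
  Cintegral mu (fun x => f x - g x) = Cintegral mu f - Cintegral mu g.
Proof. by move=> cf cg; rewrite CintegralD ?CintegralN//; exact: cintN. Qed.

Lemma cint_sum (I : Type) (s : seq I) (F : I -> T -> R[i]) :
  (forall i, cint (F i)) -> cint (fun x => \sum_(i <- s) F i x).
Proof.
move=> cF; elim: s => [|i s IH].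
  under eq_fun do rewrite big_nil.
  by split; apply: (eq_integrable _ (cst 0%E)) => //; exact: integrable0.
by under eq_fun do rewrite big_cons; exact: cintD.
Qed.

Lemma Cintegral_sum (I : Type) (s : seq I) (F : I -> T -> R[i]) :
  (forall i, cint (F i)) ->
  Cintegral mu (fun x => \sum_(i <- s) F i x) = \sum_(i <- s) Cintegral mu (F i).
Proof.
move=> cF; elim: s => [|i s IH].
  under eq_fun do rewrite big_nil; rewrite big_nil.
  by apply: complex_ext; rewrite /= Rintegral_cst// mul0r.
under eq_fun do rewrite big_cons.
by rewrite CintegralD//; [rewrite big_cons IH|exact: cint_sum].
Qed.

(** The factor 2 is the price of bounding the real and imaginary parts
separately; no constant matters in what follows. *)
Lemma normc_Cintegral f (G : T -> R) : cmeas f ->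
  mu.-integrable setT (EFin \o G) -> (forall x, normc (f x) <= G x) ->
  normc (Cintegral mu f) <= 2 * (\int[mu]_x G x)%R.
Proof.
move=> mf iG fG; have [f1 f2] := cint_dom mf iG fG.
apply: (le_trans (normc_le _)); rewrite mulr_natl mulr2n /=; apply: lerD.
  apply: (le_trans (le_normr_Rintegral _ f1)) => //.
  apply: le_Rintegral => //; first exact: integrable_norm.
  by move=> x _; exact: le_trans (normc_Re _) (fG x).
apply: (le_trans (le_normr_Rintegral _ f2)) => //.
apply: le_Rintegral => //; first exact: integrable_norm.
by move=> x _; exact: le_trans (normc_Im _) (fG x).
Qed.

Lemma ae_eq_Cintegral f g : cmeas f -> cmeas g ->
  {ae mu, forall x, f x = g x} -> Cintegral mu f = Cintegral mu g.
Proof.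
move=> [f1 f2] [g1 g2] fg; apply: complex_ext => /=; congr fine;
  apply: ae_eq_integral => //; try exact/measurable_EFinP;
  by apply: filterS fg => x fgx _ /=; rewrite fgx.
Qed.

Definition ccvg (u : nat -> R[i]) (l : R[i]) :=
  (fun k => Re (u k)) @ \oo --> Re l /\ (fun k => Im (u k)) @ \oo --> Im l.

Lemma ccvg_unique u l l' : ccvg u l -> ccvg u l' -> l = l'.
Proof.
by move=> [u1 u2] [v1 v2]; apply: complex_ext;
  [exact: (cvg_unique _ u1 v1)|exact: (cvg_unique _ u2 v2)].
Qed.

Lemma Rintegral_dominated_cvg (h_ : nat -> T -> R) (h G : T -> R) :
  (forall k, measurable_fun setT (h_ k)) -> measurable_fun setT h ->
  mu.-integrable setT (EFin \o G) -> (forall k x, `|h_ k x| <= G x) ->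
  (forall x, h_ ^~ x @ \oo --> h x) ->
  (fun k => \int[mu]_x h_ k x)%R @ \oo --> (\int[mu]_x h x)%R.
Proof.
move=> mh_ mh iG hG hcvg.
have hE x : (fun k => (h_ k x)%:E) @ \oo --> (h x)%:E.
  by apply: cvg_EFin; [exact: nearW|exact: hcvg].
have [ih _ cv] := @dominated_convergence _ _ _ mu setT measurableT
  (fun k => EFin \o h_ k) (EFin \o h) (EFin \o G)
  (fun k => (measurable_EFinP _ _).2 (mh_ k)) ((measurable_EFinP _ _).2 mh)
  (aeW _ (fun x _ => hE x)) iG
  (aeW _ (fun x k _ => hG k x)).
apply: fine_cvg; rewrite fineK; first exact: cv.
exact: integrable_fin_num.
Qed.

Lemma Cintegral_dominated_cvg (f_ : nat -> T -> R[i]) f (G : T -> R) :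
  (forall k, cmeas (f_ k)) -> cmeas f ->
  mu.-integrable setT (EFin \o G) -> (forall k x, normc (f_ k x) <= G x) ->
  (forall x, ccvg (f_ ^~ x) (f x)) ->
  ccvg (fun k => Cintegral mu (f_ k)) (Cintegral mu f).
Proof.
move=> mf_ mf iG fG fcvg; split; apply: Rintegral_dominated_cvg iG _ _.
- by move=> k; case: (mf_ k).
- by case: mf.
- by move=> k x; exact: le_trans (normc_Re _) (fG k x).
- by move=> x; case: (fcvg x).
- by move=> k; case: (mf_ k).
- by case: mf.
- by move=> k x; exact: le_trans (normc_Im _) (fG k x).
- by move=> x; case: (fcvg x).
Qed.

End complex_integration.

Lemma cmeas_comp {R : realType} d (T : measurableType d) d' (S : measurableType d')
  (h : S -> T) (f : T -> R[i]) :
  cmeas f -> measurable_fun setT h -> cmeas (fun x => f (h x)).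
Proof.
by move=> [f1 f2] mh; split; [exact: (measurableT_comp f1 mh)|
  exact: (measurableT_comp f2 mh)].
Qed.

Section product.
Context {R : realType} d1 d2 (T1 : measurableType d1) (T2 : measurableType d2).
Variables (m1 : {sigma_finite_measure set T1 -> \bar R})
          (m2 : {sigma_finite_measure set T2 -> \bar R}).

Lemma measurable_Rintegral_param (h : T1 * T2 -> R) : measurable_fun setT h ->
  measurable_fun setT (fun x => \int[m2]_y h (x, y))%R.
Proof.
move=> mh; apply: measurableT_comp => //.
have mE : measurable_fun setT (EFin \o h) by exact/measurable_EFinP.
have -> : (fun x => \int[m2]_y (h (x, y))%:E)%E =
    (fun x => \int[m2]_y ((EFin \o h)^\+ (x, y)) -
              \int[m2]_y ((EFin \o h)^\- (x, y)))%E.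
  apply/funext => x; rewrite -[LHS]/(\int[m2]_y ((EFin \o h) \o pair x) y)%E.
  by rewrite integralE funepos_comp funeneg_comp.
apply: emeasurable_funB.
  have m0 := measurable_funepos mE.
  exact: (@measurable_fun_fubini_tonelli_F _ _ _ _ _ m2 _ m0 (funepos_ge0 _)).
have m0 := measurable_funeneg mE.
exact: (@measurable_fun_fubini_tonelli_F _ _ _ _ _ m2 _ m0 (funeneg_ge0 _)).
Qed.

Lemma cmeas_Cintegral_param (F : T1 * T2 -> R[i]) : cmeas F ->
  cmeas (fun x => Cintegral m2 (fun y => F (x, y))).
Proof.
by move=> [F1 F2]; split => /=; [exact: (measurable_Rintegral_param F1)|
  exact: (measurable_Rintegral_param F2)].
Qed.

(** A real-valued integral discards the points where the inner integral
diverges; these form a null set. *)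
Lemma Rintegral_fubini (h : T1 * T2 -> R) :
  (m1 \x m2)%E.-integrable setT (EFin \o h) ->
  [/\ m1.-integrable setT (EFin \o (fun x => \int[m2]_y h (x, y))%R) ,
   (\int[(m1 \x m2)%E]_z h z = \int[m1]_x \int[m2]_y h (x, y))%R &
   (\int[(m1 \x m2)%E]_z h z = \int[m2]_y \int[m1]_x h (x, y))%R].
Proof.
move=> ih.
have iF := integrable_fubini_F ih.
have mh : measurable_fun setT h.
  by apply/measurable_EFinP; exact: measurable_int ih.
have E1 : ae_eq m1 setT (fubini_F m2 (EFin \o h))
    (EFin \o (fun x => \int[m2]_y h (x, y))%R).
  apply: filterS (integrable_ae measurableT iF) => x /(_ I) Fx _.
  by rewrite /= fineK.
have iG : m2.-integrable setT (fubini_G m1 (EFin \o h)).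
  apply/integrableP; split; first exact: (measurable_fubini_G ih).
  apply: (@le_lt_trans _ _ (\int[m2]_y \int[m1]_x `|(EFin \o h) (x, y)|)%E).
    apply: ge0_le_integral => //.
    - by apply: measurableT_comp => //; exact: (measurable_fubini_G ih).
    - apply: (measurable_fun_fubini_tonelli_G (abse \o (EFin \o h))) => //.
      by apply: measurableT_comp => //; exact/measurable_EFinP.
    - by move=> z; exact: abse_ge0.
    - move=> y _; apply: le_abse_integral => //.
      by apply/measurable_EFinP; exact: measurableT_comp.
  have := integrable21ltyP m1 m2 ((measurable_EFinP _ _).2 mh).
  by move=> [/(_ ih)].
have E2 : ae_eq m2 setT (fubini_G m1 (EFin \o h))
    (EFin \o (fun y => \int[m1]_x h (x, y))%R).
  apply: filterS (integrable_ae measurableT iG) => x /(_ I) Fx _.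
  by rewrite /= fineK.
have mF : measurable_fun setT (EFin \o (fun x => \int[m2]_y h (x, y))%R).
  by apply/measurable_EFinP; exact: measurable_Rintegral_param.
split.
- have fle (y : \bar R) : (`|fine y|%:E <= `|y|)%E.
    by case: y => [r||] //=; rewrite normr0 leey.
  by apply: le_integrable iF => // x _; exact: fle.
- rewrite /Rintegral -integral12_prod_meas1//; congr fine.
  by apply: ae_eq_integral => //; exact: (measurable_fubini_F ih).
- rewrite /Rintegral -integral21_prod_meas1//; congr fine.
  apply: ae_eq_integral => //; first exact: (measurable_fubini_G ih).
  apply/measurable_EFinP; apply: measurableT_comp => //.
  have -> : (fun y => \int[m1]_x (h (x, y))%:E)%E = fubini_G m1 (EFin \o h) by [].
  exact: (measurable_fubini_G ih).
Qed.

Lemma Cintegral_fubini1 (F : T1 * T2 -> R[i]) : cint (m1 \x m2)%E F ->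
  Cintegral (m1 \x m2)%E F = Cintegral m1 (fun x => Cintegral m2 (fun y => F (x, y))).
Proof.
by move=> [/Rintegral_fubini[_ e1 _] /Rintegral_fubini[_ e2 _]];
  apply: complex_ext.
Qed.

Lemma Cintegral_fubini2 (F : T1 * T2 -> R[i]) : cint (m1 \x m2)%E F ->
  Cintegral (m1 \x m2)%E F = Cintegral m2 (fun y => Cintegral m1 (fun x => F (x, y))).
Proof.
by move=> [/Rintegral_fubini[_ _ e1] /Rintegral_fubini[_ _ e2]];
  apply: complex_ext.
Qed.

Lemma ae_cint_fubini (F : T1 * T2 -> R[i]) : cint (m1 \x m2)%E F ->
  {ae m1, forall x, cint m2 (fun y => F (x, y))}.
Proof.
by move=> [/ae_integrable1 h1 /ae_integrable1 h2]; apply: filterS2 h1 h2.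
Qed.

Lemma integrable_prod (G1 : T1 -> R) (G2 : T2 -> R) :
  m1.-integrable setT (EFin \o G1) -> m2.-integrable setT (EFin \o G2) ->
  (m1 \x m2)%E.-integrable setT (EFin \o (fun z => G1 z.1 * G2 z.2)).
Proof.
move=> i1 i2; have m1' : measurable_fun setT G1.
  by apply/measurable_EFinP; exact: measurable_int i1.
have m2' : measurable_fun setT G2.
  by apply/measurable_EFinP; exact: measurable_int i2.
have mG : measurable_fun setT (EFin \o (fun z : T1 * T2 => G1 z.1 * G2 z.2)).
  apply/measurable_EFinP; apply: measurable_funM.
    exact: (measurableT_comp m1' measurable_fst).
  exact: (measurableT_comp m2' measurable_snd).
apply/(integrable12ltyP m1 m2 mG) => /=.
under eq_integral => x _.
  under eq_integral do rewrite normrM EFinM.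
  rewrite ge0_integralZl//; last first.
    by apply/measurable_EFinP; exact: measurableT_comp.
  over.
rewrite ge0_integralZr//.
- case/integrableP : i1 => _ i1; case/integrableP : i2 => _ i2.
  apply: lte_mul_pinfty; [exact: integral_ge0| |exact: i2].
  by rewrite ge0_fin_numE//; exact: integral_ge0.
- by apply/measurable_EFinP; exact: measurableT_comp.
- exact: integral_ge0.
Qed.

End product.

(** * Changes of variables and Gaussian integrals *)

Section euclidean_integration.
Context {R : realType}.
Notation lam := (@lebesgue_rV R).
Notation phase n := (@phase_measure R n).

Lemma integral_shift n (z : 'rV[R]_n) (f : 'rV[R]_n -> \bar R) :
  measurable_fun setT f ->
  (\int[lam n]_x f (x + z)%R = \int[lam n]_x f x)%E.
Proof.
move=> mf; rewrite [LHS](integralE _ _ (f \o +%R^~ z)) [RHS]integralE.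
rewrite funepos_comp funeneg_comp.
by congr (_ - _)%E; apply: ge0_integral_shift; [exact: measurable_funepos|
  exact: funepos_ge0|exact: measurable_funeneg|exact: funeneg_ge0].
Qed.

Lemma integrable_shift n (z : 'rV[R]_n) (f : 'rV[R]_n -> R) :
  (lam n).-integrable setT (EFin \o f) ->
  (lam n).-integrable setT (EFin \o (fun x => f (x + z))).
Proof.
move=> /integrableP[mf fi]; apply/integrableP; split.
  by apply: (measurableT_comp mf); exact: measurable_rVD.
have := @ge0_integral_shift R n z (abse \o (EFin \o f)) _ (fun x => abse_ge0 _).
by move=> /= -> //; exact: measurableT_comp.
Qed.

Lemma cint_shift n (z : 'rV[R]_n) (f : 'rV[R]_n -> R[i]) :
  cint (lam n) f -> cint (lam n) (fun x => f (x + z)).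
Proof. by move=> [f1 f2]; split; [exact: (integrable_shift z f1)|
  exact: (integrable_shift z f2)]. Qed.

Lemma Rintegral_shift n (z : 'rV[R]_n) (f : 'rV[R]_n -> R) :
  measurable_fun setT f ->
  \int[lam n]_x f (x + z) = \int[lam n]_x f x.
Proof.
by move=> mf; congr fine; apply: (integral_shift z (f := EFin \o f));
  exact/measurable_EFinP.
Qed.

Lemma Cintegral_shift n (z : 'rV[R]_n) (f : 'rV[R]_n -> R[i]) : cmeas f ->
  Cintegral (lam n) (fun x => f (x + z)) = Cintegral (lam n) f.
Proof.
by move=> [f1 f2]; apply: complex_ext; [exact: (Rintegral_shift z f1)|
  exact: (Rintegral_shift z f2)].
Qed.

Lemma Rintegral_aff n (e : R) (z : 'rV[R]_n) (f : 'rV[R]_n -> R) : 0 < e ->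
  measurable_fun setT f ->
  \int[lam n]_x (e ^+ n * f (e *: x + z)) = \int[lam n]_x f x.
Proof.
move=> e0 mf; congr fine.
have maff : measurable_fun setT (fun x : 'rV[R]_n => e *: x + z).
  by apply: measurable_rVD => //; exact: measurable_rVZ.
have mE : measurable_fun setT (EFin \o f) by exact/measurable_EFinP.
have en : 0 <= e ^+ n by rewrite exprn_ge0// ltW.
have K (g : 'rV[R]_n -> \bar R) : measurable_fun setT g -> (forall x, 0 <= g x)%E ->
    (\int[lam n]_x ((e ^+ n)%:E * g (e *: x + z)%R) = \int[lam n]_x g x)%E.
  move=> mg g0; rewrite ge0_integralZl//; first exact: ge0_integral_aff.
  exact: (measurableT_comp mg maff).
rewrite [RHS]integralE [LHS]integralE.
rewrite -(K _ (measurable_funepos mE) (funepos_ge0 _)).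
rewrite -(K _ (measurable_funeneg mE) (funeneg_ge0 _)).
congr (_ - _)%E; apply: eq_integral => x _.
  rewrite -[X in X^\+%E]/(fun x => (e ^+ n)%:E * ((EFin \o f) \o (fun x => (e *: x + z)%R)) x)%E.
  by rewrite ge0_funeposM// funepos_comp.
rewrite -[X in X^\-%E]/(fun x => (e ^+ n)%:E * ((EFin \o f) \o (fun x => (e *: x + z)%R)) x)%E.
by rewrite ge0_funenegM// funeneg_comp.
Qed.

Lemma Cintegral_aff n (e : R) (z : 'rV[R]_n) (f : 'rV[R]_n -> R[i]) : 0 < e ->
  cmeas f ->
  Cintegral (lam n) (fun x => (e ^+ n)%:C * f (e *: x + z)) = Cintegral (lam n) f.
Proof.
move=> e0 [f1 f2]; apply: complex_ext; rewrite /=.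
  rewrite -[RHS](Rintegral_aff z e0 f1); apply: eq_Rintegral => x _.
  by rewrite ReImE/= mul0r subr0.
rewrite -[RHS](Rintegral_aff z e0 f2); apply: eq_Rintegral => x _.
by rewrite ReImE/= mul0r addr0.
Qed.

Lemma measurable_row_mx2 m n :
  measurable_fun setT (fun p : 'rV[R]_m * 'rV[R]_n => row_mx p.1 p.2).
Proof.
by apply: measurable_row_mx; [exact: measurable_fst|exact: measurable_snd].
Qed.

Lemma integral_row_mx m n (f : 'rV[R]_(m + n) -> \bar R) :
  measurable_fun setT f ->
  (\int[lam (m + n)]_z f z = \int[lam m \x lam n]_p f (row_mx p.1 p.2))%E.
Proof.
have H (g : 'rV[R]_(m + n) -> \bar R) : measurable_fun setT g ->
    (forall x, 0 <= g x)%E ->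
    (\int[lam (m + n)]_z g z = \int[lam m \x lam n]_p g (row_mx p.1 p.2))%E.
  move=> mg g0; rewrite ge0_integral_row_mx// fubini_tonelli1//.
  exact: (measurableT_comp mg (@measurable_row_mx2 m n)).
move=> mf; rewrite [LHS]integralE.
pose q (p : 'rV[R]_m * 'rV[R]_n) := row_mx p.1 p.2.
rewrite [RHS](integralE _ _ (f \o q)) (funepos_comp f q) (funeneg_comp f q).
rewrite (H _ (measurable_funepos mf) (funepos_ge0 f)).
by rewrite (H _ (measurable_funeneg mf) (funeneg_ge0 f)).
Qed.

Lemma integrable_row_mx m n (f : 'rV[R]_(m + n) -> R) :
  (lam (m + n)).-integrable setT (EFin \o f) ->
  (lam m \x lam n)%E.-integrable setT (EFin \o (fun p => f (row_mx p.1 p.2))).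
Proof.
move=> /integrableP[mf fi]; apply/integrableP; split.
  exact: (measurableT_comp mf (@measurable_row_mx2 m n)).
rewrite -(@integral_row_mx _ _ (abse \o (EFin \o f)))//.
exact: measurableT_comp.
Qed.

Lemma cint_row_mx m n (f : 'rV[R]_(m + n) -> R[i]) : cint (lam (m + n)) f ->
  cint (lam m \x lam n)%E (fun p => f (row_mx p.1 p.2)).
Proof.
by move=> [f1 f2]; split; [exact: (integrable_row_mx f1)|
  exact: (integrable_row_mx f2)].
Qed.

Lemma Cintegral_row_mx m n (f : 'rV[R]_(m + n) -> R[i]) : cmeas f ->
  Cintegral (lam (m + n)) f = Cintegral (lam m \x lam n)%E (fun p => f (row_mx p.1 p.2)).
Proof.
move=> [f1 f2]; apply: complex_ext; rewrite /=; congr fine.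
  exact: (integral_row_mx ((measurable_EFinP _ _).2 f1)).
exact: (integral_row_mx ((measurable_EFinP _ _).2 f2)).
Qed.

Lemma measurable_oneDsqrV : measurable_fun setT (fun s : R => (1 + s ^+ 2)^-1).
Proof.
by apply: continuous_measurable_fun; exact: continuous_oneDsqrV.
Qed.

(** The one-dimensional factor integrates to [pi]. *)
Lemma integrable_ijb n : (lam n).-integrable setT (EFin \o (@ijb R n)).
Proof.
apply/integrableP; split; first exact/measurable_EFinP/measurable_ijb.
under eq_integral do rewrite /= ger0_norm ?ijb_ge0//.
rewrite (@ge0_integral_prod R n (fun s => (1 + s ^+ 2)^-1)); last 2 first.
- exact: measurable_oneDsqrV.
- by move=> x; rewrite invr_ge0 addr_ge0// sqr_ge0.
have mo : measurable_fun setT (fun s : R => ((1 + s ^+ 2)^-1)%:E).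
  by apply/measurable_EFinP; exact: measurable_oneDsqrV.
have o0 (s : R) : (0 <= ((1 + s ^+ 2)^-1)%:E)%E.
  by rewrite lee_fin invr_ge0 addr_ge0// sqr_ge0.
have h : (\int[lebesgue_measure]_s ((1 + s ^+ 2)^-1)%:E)%E = pi%:E :> \bar R.
  rewrite ge0_symfun_integralT//.
  - rewrite (_ : [set x | _] = `[0, +oo[%classic); last first.
      by apply/seteqP; split => x/=; rewrite in_itv/= andbT.
    by rewrite integral0y_oneDsqr -EFinM mulrCA divff// mulr1.
  - exact: continuous_oneDsqrV.
  - by move=> x/=; rewrite sqrrN.
by rewrite h -EFin_expe ltry.
Qed.

Lemma measurable_gauss1 : measurable_fun setT (fun s : R => expR (- (pi * s ^+ 2))).
Proof.
apply: measurableT_comp => //; apply: measurableT_comp => //.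
by apply: measurable_funM => //; exact: measurable_funX.
Qed.

(** The Gaussian integral with variance normalised so that its value is 1. *)
Lemma integral_gauss1 :
  (\int[lebesgue_measure]_s (expR (- (pi * s ^+ 2)))%:E)%E = 1%E :> \bar R.
Proof.
pose g (s : R) := (gauss_fun s)%:E.
have mg : measurable_fun setT g.
  by apply/measurable_EFinP; exact: measurable_gauss_fun.
have g0 x : (0 <= g x)%E by rewrite lee_fin gauss_fun_ge0.
have p0 : 0 < Num.sqrt pi :> R by rewrite sqrtr_gt0 pi_gt0.
have := ge0_integral_aff1 0 p0 mg g0; rewrite [RHS]integralT_gauss.
have -> : (\int[lebesgue_measure]_s g (Num.sqrt pi * s + 0)%R =
    \int[lebesgue_measure]_s (expR (- (pi * s ^+ 2)))%:E)%E.
  apply: eq_integral => s _; rewrite /g /gauss_fun addr0 exprMn sqr_sqrtr//.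
  exact: pi_ge0.
move: (\int[lebesgue_measure]_s (expR (- (pi * s ^+ 2)))%:E)%E => [r||].
- by rewrite -EFinM => -[/eqP]; rewrite -subr_eq0 -{2}(mulr1 (Num.sqrt pi)) -mulrBr mulf_eq0
    gt_eqF//= subr_eq0 => /eqP ->.
- by rewrite gt0_muley ?lte_fin.
- by rewrite gt0_muleNy ?lte_fin.
Qed.

Lemma gaussianE n (x : 'rV[R]_n) :
  gaussian x = (\prod_i expR (- (pi * x ord0 i ^+ 2)))%:C.
Proof.
rewrite /gaussian -expR_sum; congr (expR _)%:C.
rewrite /dotv mulr_sumr -sumrN; apply: eq_bigr => i _.
by rewrite -expr2.
Qed.

Lemma normc_gaussian n (x : 'rV[R]_n) : normc (gaussian x) = Re (gaussian x).
Proof. by rewrite normc_real ger0_norm// expR_ge0. Qed.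

Lemma normc_gaussian_le1 n (x : 'rV[R]_n) : normc (gaussian x) <= 1.
Proof.
rewrite normc_gaussian /= expR_le1 oppr_le0 mulr_ge0 ?pi_ge0//.
exact: dotvv_ge0.
Qed.

Lemma conj_gaussian n (x : 'rV[R]_n) : conjc (gaussian x) = gaussian x.
Proof. by rewrite /gaussian conjc_real. Qed.

Lemma gaussianN n (x : 'rV[R]_n) : gaussian (- x) = gaussian x.
Proof. by rewrite /gaussian dotvNl dotvNr opprK. Qed.

Lemma cmeas_gaussian d (T : measurableType d) n (f : T -> 'rV[R]_n) :
  measurable_fun setT f -> cmeas (fun t => gaussian (f t)).
Proof.
move=> mf; apply: cmeas_real; apply: measurableT_comp => //.
apply: measurableT_comp => //; apply: measurable_funM => //.
exact: measurable_dotv.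
Qed.

Lemma cint_gaussian n : cint (lam n) (@gaussian R n).
Proof.
apply: cintP; first exact: (@cmeas_gaussian _ _ n id).
apply/integrableP; split.
  by apply/measurable_EFinP/measurable_normc; exact: (@cmeas_gaussian _ _ n id).
have E x : (`|normc (gaussian x)|%:E =
    (\prod_i expR (- (pi * x ord0 i ^+ 2)))%:E :> \bar R)%E.
  by rewrite normc_gaussian gaussianE ger0_norm//= prodr_ge0// => i _; exact: expR_ge0.
rewrite /comp (eq_integral _ _ (fun x _ => E n x)).
rewrite (@ge0_integral_prod R n (fun s => expR (- (pi * s ^+ 2)))) ?integral_gauss1 -?EFin_expe ?ltry//.
exact: measurable_gauss1.
Qed.

Lemma Cintegral_gaussian n : Cintegral (lam n) (@gaussian R n) = 1.
Proof.
apply: complex_ext => /=; last by rewrite Rintegral_cst// mul0r.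
rewrite /Rintegral.
under eq_integral do rewrite -[expR _]/(Re (gaussian _)) gaussianE/=.
rewrite (@ge0_integral_prod R n (fun s => expR (- (pi * s ^+ 2)))) ?integral_gauss1 -?EFin_expe ?expr1n//.
exact: measurable_gauss1.
Qed.

End euclidean_integration.

(** * Differential calculus *)

Section linear_maps.
Context {R : realType}.

Lemma row_sum_coord n (h : 'rV[R]_n) : h = \sum_i h ord0 i *: delta_mx ord0 i.
Proof. exact: row_sum_delta. Qed.

Lemma linear_rV_continuous n (V : normedModType R) (f : {linear 'rV[R]_n -> V}) :
  continuous f.
Proof.
apply/linear_bounded_continuous.
exists (\sum_i `|f (delta_mx ord0 i)|); split; first exact: num_real.
move=> M hM; apply/nbhs_ballP; exists 1 => //= x; rewrite -ball_normE/= sub0r normrN => x1.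
apply: ltW; apply: le_lt_trans hM.
rewrite (row_sum_coord x) linear_sum; apply: (le_trans (ler_norm_sum _ _ _)).
apply: ler_sum => i _; rewrite linearZ normrZ ler_piMl//.
apply: le_trans (ltW x1).
by rewrite [`|x|]mx_normrE; exact: (le_bigmax _ (fun i => `|x i.1 i.2|) (ord0, i)).
Qed.

Section differential.
Variables V W : normedModType R.

Lemma diff_of_bound (f : V -> W) (df : {linear V -> W}) (x : V) :
  continuous df ->
  (forall e : R, 0 < e -> exists2 r : R, 0 < r & forall h, `|h| < r ->
    `|f (h + x) - f x - df h| <= e * `|h|) ->
  differentiable f x /\ 'd f x = df :> (V -> W).
Proof.
move=> cdf H.
have E : f \o shift x = cst (f x) + df +o_ 0 id.
  apply/eqaddoP => e e0; have [r r0 Hr] := H e e0.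
  apply/nbhs_ballP; exists r => //= h; rewrite -ball_normE/= sub0r normrN => hr.
  by have := Hr h hr; rewrite !fctE/= opprD addrA.
have dE := diff_unique cdf E.
by split => //; apply/diff_locallyP; rewrite dE.
Qed.

Lemma diff_affine (f : {linear V -> W}) (b : W) (x : V) : continuous f ->
  differentiable (fun x => f x + b) x /\ 'd (fun x => f x + b) x = f :> (V -> W).
Proof.
move=> cf; apply: diff_of_bound => // e e0; exists 1 => // h _.
by rewrite linearD opprD addrACA subrr addr0 addrK subrr normr0 mulr_ge0// ltW.
Qed.

End differential.

Lemma diff_line (V : normedModType R) (h b : V) (s : R) :
  differentiable (fun s : R => s *: h + b) s /\
  'd (fun s : R => s *: h + b) s = ( *:%R^~ h) :> (R -> V).
Proof.
have sx_lin : linear ( *:%R ^~ h : R -> V).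
  by move=> u y z; rewrite scalerDl scalerA.
pose sxL : {linear R -> V} := HB.pack ( *:%R ^~ h) (GRing.isLinear.Build _ _ _ _ _ sx_lin).
by apply: (@diff_affine R V sxL b s); exact: scalel_continuous.
Qed.

End linear_maps.

Section differentiation.
Context {R : realType}.

(** All derivatives below are found in this way: a remainder that is quadratic
in the increment gives differentiability and identifies the partial
derivatives, without any limit being taken. *)
Lemma quad_differentiable n (u : 'rV[R]_n -> R) (D : 'I_n -> R) (x : 'rV[R]_n) C :
  (forall h, l1 h <= 1 ->
    `|u (x + h) - u x - \sum_i h ord0 i * D i| <= C * l1 h ^+ 2) ->
  differentiable u x /\ forall i, 'D_(delta_mx ord0 i) u x = D i.
Proof.
move=> uD.
have lin : linear (fun h : 'rV[R]_n => (\sum_i h ord0 i * D i : R)).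
  move=> a h k; rewrite scaler_sumr -big_split; apply: eq_bigr => i _ /=.
  by rewrite !mxE mulrDl -mulrA.
pose df : {linear 'rV[R]_n -> R} := HB.pack
  (fun h : 'rV[R]_n => (\sum_i h ord0 i * D i : R)) (GRing.isLinear.Build _ _ _ _ _ lin).
have cdf : continuous df by exact: linear_rV_continuous.
have [du dE] : differentiable u x /\ 'd u x = df :> ('rV[R]_n -> R).
  apply: diff_of_bound => // e e0.
  have C0 : 0 <= `|C| * n%:R ^+ 2 by rewrite mulr_ge0// sqr_ge0.
  (* The first bound keeps the increment in the unit [l1] ball, the second
  beats [e]; the norm of the space is the maximum of the coordinates. *)
  pose r := Num.min (n%:R + 1)^-1 (e / (`|C| * n%:R ^+ 2 + 1)).
  have r0 : 0 < r.
    rewrite lt_min invr_gt0 ltr_wpDl// divr_gt0// ltr_wpDl//.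
  exists r => //= h hr.
  have /andP[h1 h2] : (`|h| <= (n%:R + 1)^-1) && (`|h| <= e / (`|C| * n%:R ^+ 2 + 1)).
    by rewrite -le_min ltW.
  have lh := l1_norm h.
  have l1h : l1 h <= 1.
    apply: (le_trans lh); apply: (@le_trans _ _ ((n%:R + 1) * `|h|)).
      by rewrite ler_wpM2r// lerDl.
    by rewrite mulrC -ler_pdivlMr ?mul1r// ltr_wpDl.
  rewrite [h + x]addrC.
  apply: (le_trans (uD h l1h)).
  apply: (@le_trans _ _ ((`|C| * n%:R ^+ 2 * `|h|) * `|h|)).
    apply: (@le_trans _ _ (`|C| * l1 h ^+ 2)); first by rewrite ler_wpM2r ?sqr_ge0 ?ler_norm.
    have -> : `|C| * n%:R ^+ 2 * `|h| * `|h| = `|C| * (n%:R * `|h|) ^+ 2 by ring.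
    by rewrite ler_wpM2l// lerXn2r ?nnegrE ?l1_ge0 ?mulr_ge0.
  rewrite ler_wpM2r//; apply: (@le_trans _ _ ((`|C| * n%:R ^+ 2 + 1) * `|h|)).
    by rewrite ler_wpM2r// lerDl.
  by rewrite mulrC -ler_pdivlMr// ltr_wpDl.
split=> // i; rewrite deriveE// dE /= (bigD1 i)//= mxE !eqxx mul1r big1 ?addr0//.
by move=> j ji; rewrite mxE eqxx/= (negbTE ji) mul0r.
Qed.

Lemma differentiable_aff m n (A : 'M[R]_(n, m)) (b : 'rV[R]_m) (u : 'rV[R]_m -> R) x :
  differentiable u (x *m A + b) ->
  differentiable (fun x => u (x *m A + b)) x /\
  forall i, 'D_(delta_mx ord0 i) (fun x => u (x *m A + b)) x =
    \sum_j A i j * 'D_(delta_mx ord0 j) u (x *m A + b).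
Proof.
move=> du.
pose f : {linear 'rV[R]_n -> 'rV[R]_m} := mulmxr A.
have cf := @linear_rV_continuous _ _ _ f.
have [dg E] := @diff_affine _ _ _ f b x cf.
have duf : differentiable (fun x => u (x *m A + b)) x.
  exact: (differentiable_comp dg du).
split => // i; rewrite deriveE// (diff_comp dg du)/= E /=.
rewrite -rowE (row_sum_coord (row i A)) linear_sum/=.
by apply: eq_bigr => j _; rewrite linearZ/= mxE deriveE.
Qed.

Lemma is_derive_line n (u : 'rV[R]_n -> R) x h (s : R) :
  differentiable u (s *: h + x) ->
  is_derive s (1 : R) (fun s : R => u (s *: h + x))
    (\sum_i h ord0 i * 'D_(delta_mx ord0 i) u (s *: h + x)).
Proof.
move=> du.
have [dg E] := diff_line h x s.
have duf : differentiable (fun s : R => u (s *: h + x)) s.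
  exact: (differentiable_comp dg du).
apply: DeriveDef; first exact/derivable1_diffP.
rewrite deriveE// (diff_comp dg du)/= E scale1r.
rewrite [X in 'd _ _ X](row_sum_coord h) linear_sum.
by apply: eq_bigr => i _; rewrite linearZ/= deriveE.
Qed.

(** The partial derivatives are carried along as data, so that the rules of
calculus compute them. *)
Definition cdiff n (f : 'rV[R]_n -> R[i]) (D : 'I_n -> 'rV[R]_n -> R[i]) :=
  forall x, [/\ differentiable (fun y => Re (f y)) x,
    differentiable (fun y => Im (f y)) x & forall i, partialC i f x = D i x].

Definition rem n (f : 'rV[R]_n -> R[i]) D (x h : 'rV[R]_n) : R[i] :=
  f (x + h) - f x - \sum_(i < n) (h ord0 i)%:C * D i x.

Section cdiff_theory.
Context {n : nat}.
Implicit Types (f g : 'rV[R]_n -> R[i]) (D E : 'I_n -> 'rV[R]_n -> R[i]).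

Lemma cdiff_partial f D : cdiff f D -> (fun i => partialC i f) = D.
Proof. by move=> fD; apply/funext => i; apply/funext => x; case: (fD x). Qed.

Lemma cdiff_ext f g D E : cdiff f D -> f =1 g -> (forall i x, D i x = E i x) ->
  cdiff g E.
Proof.
move=> fD /funext fg DE; rewrite -fg => x; have [f1 f2 f3] := fD x.
by split => // i; rewrite f3 DE.
Qed.

Lemma quad_cdiff f D C :
  (forall x h, l1 h <= 1 -> normc (rem f D x h) <= C * l1 h ^+ 2) -> cdiff f D.
Proof.
move=> fD x.
have [] := @quad_differentiable n (fun y => Re (f y)) (fun i => Re (D i x)) x C.
  move=> h h1; apply: le_trans (fD x h h1).
  apply: le_trans (normc_Re _); rewrite /rem !ReImE Re_sum.
  under [in leRHS]eq_bigr do rewrite ReM/= mul0r subr0.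
  exact: lexx.
move=> d1 e1.
have [] := @quad_differentiable n (fun y => Im (f y)) (fun i => Im (D i x)) x C.
  move=> h h1; apply: le_trans (fD x h h1).
  apply: le_trans (normc_Im _); rewrite /rem !ReImE Im_sum.
  under [in leRHS]eq_bigr do rewrite ImM/= mul0r addr0.
  exact: lexx.
move=> d2 e2; split => // i; apply: complex_ext; [exact: e1|exact: e2].
Qed.

Lemma cdiff_lin a f g D E : cdiff f D -> cdiff g E ->
  cdiff (fun x => a * f x + g x) (fun i x => a * D i x + E i x).
Proof.
move=> fD gE x; have [f1 f2 f3] := fD x; have [g1 g2 g3] := gE x.
have h1 : (fun y => Re (a * f y + g y)) =
    (Re a *: (fun y => Re (f y)) - Im a *: (fun y => Im (f y))) + (fun y => Re (g y)).
  by apply/funext => y; rewrite !fctE !ReImE.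
have h2 : (fun y => Im (a * f y + g y)) =
    (Re a *: (fun y => Im (f y)) + Im a *: (fun y => Re (f y))) + (fun y => Im (g y)).
  by apply/funext => y; rewrite !fctE !ReImE.
have z1 r := differentiableZ r f1; have z2 r := differentiableZ r f2.
have b1 := differentiableB (z1 (Re a)) (z2 (Im a)).
have b2 := differentiableD (z2 (Re a)) (z1 (Im a)).
rewrite /partialC h1 h2; split; [exact: differentiableD|exact: differentiableD|].
move=> i; rewrite -f3 -g3; apply: complex_ext; rewrite !ReImE /=.
  rewrite deriveD; [|exact: diff_derivable..].
  rewrite deriveB; [|exact: diff_derivable..].
  by rewrite !deriveZ//; exact: diff_derivable.
rewrite deriveD; [|exact: diff_derivable..].
rewrite deriveD; [|exact: diff_derivable..].
by rewrite !deriveZ//; exact: diff_derivable.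
Qed.

Lemma cdiffM f g D E : cdiff f D -> cdiff g E ->
  cdiff (fun x => f x * g x) (fun i x => D i x * g x + f x * E i x).
Proof.
move=> fD gE x; have [f1 f2 f3] := fD x; have [g1 g2 g3] := gE x.
have h1 : (fun y => Re (f y * g y)) =
    (fun y => Re (f y)) * (fun y => Re (g y)) - (fun y => Im (f y)) * (fun y => Im (g y)).
  by apply/funext => y; rewrite !fctE !ReImE.
have h2 : (fun y => Im (f y * g y)) =
    (fun y => Re (f y)) * (fun y => Im (g y)) + (fun y => Im (f y)) * (fun y => Re (g y)).
  by apply/funext => y; rewrite !fctE !ReImE.
have m11 := differentiableM f1 g1; have m22 := differentiableM f2 g2.
have m12 := differentiableM f1 g2; have m21 := differentiableM f2 g1.
rewrite /partialC h1 h2; split; [exact: differentiableB|exact: differentiableD|].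
move=> i; rewrite -f3 -g3; set e := delta_mx ord0 i.
have dM (u v : 'rV[R]_n -> R) : differentiable u x -> differentiable v x ->
    'D_e (u * v) x = u x * 'D_e v x + v x * 'D_e u x.
  by move=> du dv; rewrite deriveM//; exact: diff_derivable.
apply: complex_ext; rewrite !ReImE /=.
  rewrite deriveB; [|exact: diff_derivable..].
  rewrite (dM _ _ f1 g1) (dM _ _ f2 g2).
  by move: ('D_e _ x) ('D_e _ x) ('D_e _ x) ('D_e _ x) => ? ? ? ?; ring.
rewrite deriveD; [|exact: diff_derivable..].
rewrite (dM _ _ f1 g2) (dM _ _ f2 g1).
by move: ('D_e _ x) ('D_e _ x) ('D_e _ x) ('D_e _ x) => ? ? ? ?; ring.
Qed.

Lemma cdiff_conj f D : cdiff f D ->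
  cdiff (fun x => conjc (f x)) (fun i x => conjc (D i x)).
Proof.
move=> fD x; have [f1 f2 f3] := fD x.
have h1 : (fun y => Re (conjc (f y))) = (fun y => Re (f y)).
  by apply/funext => y; rewrite Reconj.
have h2 : (fun y => Im (conjc (f y))) = - (fun y => Im (f y)).
  by apply/funext => y; rewrite Imconj.
rewrite /partialC h1 h2; split => //; first exact: differentiableN.
move=> i; rewrite -f3; apply: complex_ext; rewrite !ReImE//=.
by rewrite deriveN//; exact: diff_derivable.
Qed.

Lemma cdiff_cst (a : R[i]) : cdiff (fun _ : 'rV[R]_n => a) (fun _ _ => 0).
Proof.
move=> x; split; [exact: differentiable_cst|exact: differentiable_cst|move=> i].
by apply: complex_ext => /=; exact: derive_cst.
Qed.

Lemma cdiff_coord (j : 'I_n) :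
  cdiff (fun x : 'rV[R]_n => (x ord0 j)%:C) (fun i _ => (i == j)%:R).
Proof.
apply: (@quad_cdiff _ _ 0) => x h _; rewrite mul0r /rem.
rewrite mxE (bigD1 j)//= eqxx mulr1 big1 ?addr0; last first.
  by move=> i ij; rewrite (negbTE ij) mulr0.
rewrite (_ : _ - _ = 0) ?normc0//.
by apply: complex_ext; rewrite !ReImE/=; ring.
Qed.

Lemma cdiff_continuous f D : cdiff f D ->
  continuous (fun x => Re (f x)) /\ continuous (fun x => Im (f x)).
Proof.
by move=> fD; split => x; case: (fD x) => f1 f2 _; exact: differentiable_continuous.
Qed.

Lemma cdiff_cmeas f D : cdiff f D -> cmeas f.
Proof.
by move=> /cdiff_continuous[c1 c2]; split; exact: continuous_measurable_rV.
Qed.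

End cdiff_theory.

Lemma cdiff_aff m n (A : 'M[R]_(n, m)) (b : 'rV[R]_m) f D : cdiff f D ->
  cdiff (fun x : 'rV[R]_n => f (x *m A + b))
    (fun i x => \sum_j (A i j)%:C * D j (x *m A + b)).
Proof.
move=> fD x; have [f1 f2 f3] := fD (x *m A + b).
have [d1 e1] := differentiable_aff f1; have [d2 e2] := differentiable_aff f2.
split => // i; apply: complex_ext; rewrite /= ?e1 ?e2 ?Re_sum ?Im_sum.
  by apply: eq_bigr => j _; rewrite -f3 !ReImE/= mul0r subr0.
by apply: eq_bigr => j _; rewrite -f3 !ReImE/= mul0r addr0.
Qed.

(** The mean value theorem on the segment from [x] to [x + h], for the real and
the imaginary part. *)
Lemma cdiff_lip n (f : 'rV[R]_n -> R[i]) D x h M : cdiff f D ->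
  (forall s : R, 0 <= s <= 1 -> forall i, normc (D i (s *: h + x)) <= M) ->
  normc (f (x + h) - f x) <= 2 * (M * l1 h).
Proof.
move=> fD DM.
have B (u : R[i] -> R) : (forall z, `|u z| <= normc z) ->
    (forall x, differentiable (fun y => u (f y)) x) ->
    (forall x i, 'D_(delta_mx ord0 i) (fun y => u (f y)) x = u (D i x)) ->
    `|u (f (x + h)) - u (f x)| <= M * l1 h.
  move=> un du Du.
  have [c c01] := mvt0 (@ler01 R) (fun s => is_derive_line (du (s *: h + x))).
  rewrite scale1r scale0r add0r [h + x]addrC mulr1 => ->.
  apply: (le_trans (ler_norm_sum _ _ _)); rewrite mulr_sumr; apply: ler_sum => i _.
  rewrite normrM mulrC ler_wpM2r// Du.
  by apply: (le_trans (un _)); apply: DM.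
apply: (le_trans (normc_le _)); rewrite mulr_natl mulr2n !ReImE.
apply: lerD; apply: B.
- exact: normc_Re.
- by move=> y; case: (fD y).
- by move=> y i; case: (fD y) => _ _ <-.
- exact: normc_Im.
- by move=> y; case: (fD y).
- by move=> y i; case: (fD y) => _ _ <-.
Qed.

(** The mean value theorem replaces the increment of [f] by derivatives at an
intermediate point, and the Lipschitz bound compares these with the
derivatives at [x]. *)
Lemma cdiff_taylor n (f : 'rV[R]_n -> R[i]) D D2 x h M : cdiff f D ->
  (forall i, cdiff (D i) (D2 i)) ->
  (forall s : R, 0 <= s <= 1 -> forall i j, normc (D2 i j (s *: h + x)) <= M) ->
  normc (rem f D x h) <= 4 * (M * l1 h ^+ 2).
Proof.
move=> fD DD2 DM.
have B (u : R[i] -> R) : (forall z, `|u z| <= normc z) -> {morph u : x y / x + y} ->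
    (forall r z, u (r%:C * z) = r * u z) ->
    (forall x, differentiable (fun y => u (f y)) x) ->
    (forall x i, 'D_(delta_mx ord0 i) (fun y => u (f y)) x = u (D i x)) ->
    `|u (rem f D x h)| <= 2 * (M * l1 h ^+ 2).
  move=> un uD uZ du Du.
  have u0 : u 0 = 0 by rewrite -(mul0r 0) (uZ 0 0) mul0r.
  have uN z : u (- z) = - u z by apply/eqP; rewrite -addr_eq0 -uD addNr u0.
  have [c c01] := mvt0 (@ler01 R) (fun s => is_derive_line (du (s *: h + x))).
  rewrite scale1r scale0r add0r [h + x]addrC mulr1 => e.
  rewrite /rem uD uD !uN e (big_morph _ uD u0) -sumrB.
  apply: (le_trans (ler_norm_sum _ _ _)).
  have -> : 2 * (M * l1 h ^+ 2) = \sum_i `|h ord0 i| * (2 * (M * l1 h)).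
    by rewrite -mulr_suml -/(l1 h); ring.
  apply: ler_sum => i _; rewrite uZ Du -mulrBr normrM ler_wpM2l//.
  have M0 : 0 <= M * l1 h.
    by rewrite mulr_ge0 ?l1_ge0// (le_trans (normc_ge0 _) (DM 0 _ i i))// lexx ler01.
  have /andP[c0 c1] := c01.
  rewrite -uN -uD (le_trans (un _))// [c *: h + x]addrC.
  apply: (le_trans (cdiff_lip (M := M) (DD2 i) _)).
    move=> s /andP[s0 s1] j; rewrite scalerA; apply: DM.
    by rewrite mulr_ge0//= mulr_ile1.
  by rewrite l1Z (ger0_norm c0) ler_wpM2l// mulrCA ler_piMl.
apply: (le_trans (normc_le _)).
have -> : 4 * (M * l1 h ^+ 2) = 2 * (M * l1 h ^+ 2) + 2 * (M * l1 h ^+ 2) by ring.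
apply: lerD; apply: B.
- exact: normc_Re.
- exact: ReD.
- by move=> r z; rewrite ReM/= mul0r subr0.
- by move=> y; case: (fD y).
- by move=> y i; case: (fD y) => _ _ <-.
- exact: normc_Im.
- exact: ImD.
- by move=> r z; rewrite ImM/= mul0r addr0.
- by move=> y; case: (fD y).
- by move=> y i; case: (fD y) => _ _ <-.
Qed.

End differentiation.

(** * Schwartz functions *)

Section schwartz_functions.
Context {R : realType}.

Lemma le0_small (a C : R) : (forall s, 0 < s <= 1 -> a <= C * s) -> a <= 0.
Proof.
move=> H; apply/ler_addgt0Pl => e e0; rewrite addr0.
have C1 : 0 < `|C| + 1 by rewrite ltr_wpDl.
pose s := Num.min 1 (e / (`|C| + 1)).
have s0 : 0 < s by rewrite lt_min ltr01 divr_gt0.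
have s1 : s <= 1 by rewrite ge_min lexx.
have : s <= e / (`|C| + 1) by rewrite ge_min lexx orbT.
rewrite ler_pdivlMr// => se; apply: le_trans se.
apply: (le_trans (H s _)); first by rewrite s0 s1.
by rewrite [leRHS]mulrC ler_wpM2r ?(ltW s0)// (le_trans (ler_norm _))// lerDl.
Qed.

Definition rapid n (f : 'rV[R]_n -> R[i]) :=
  forall k : nat, exists C : R, forall x, jb x ^+ k * normc (f x) <= C.

(** The seminorms of weight [k] and order at most [m]; the recursion follows the
order, so that bounds for derivatives are obtained by structural induction. *)
Fixpoint bnd n (m k : nat) (B : R) (f : 'rV[R]_n -> R[i]) : Prop :=
  (forall x, jb x ^+ k * normc (f x) <= B) /\
  if m is m'.+1 then forall i, bnd m' k B (partialC i f) else True.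

Arguments bnd n (m k)%_nat_scope B f.

Section fixed_dimension.
Context {n : nat}.
Implicit Types (f g : 'rV[R]_n -> R[i]).

Lemma bnd0 m k B f : bnd m k B f -> forall x, jb x ^+ k * normc (f x) <= B.
Proof. by case: m => [|m] []. Qed.

Lemma bndS m k B f i : bnd m.+1 k B f -> bnd m k B (partialC i f).
Proof. by move=> [_ /(_ i)]. Qed.

Lemma bnd_le m k B B' f : B <= B' -> bnd m k B f -> bnd m k B' f.
Proof.
move=> BB'; elim: m f => [|m IH] f [f0 fS]; split => //.
- by move=> x; exact: le_trans BB'.
- by move=> x; exact: le_trans BB'.
- by move=> i; apply: IH; exact: fS.
Qed.

Lemma bndW m m' k B f : (m' <= m)%N -> bnd m k B f -> bnd m' k B f.
Proof.
elim: m m' f => [|m IH] [|m'] f //= mm' [f0 fS]; split => // i.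
by apply: IH => //; exact: fS.
Qed.

Lemma bnd_ge0 m k B f : bnd m k B f -> 0 <= B.
Proof.
by move=> /bnd0/(_ 0); apply: le_trans; rewrite mulr_ge0 ?jbX_ge0 ?normc_ge0.
Qed.

Lemma bnd_normc m k B f x : bnd m k B f -> normc (f x) <= B.
Proof.
move=> /bnd0/(_ x); apply: le_trans.
by rewrite ler_peMl ?normc_ge0 ?jbX_ge1.
Qed.

Lemma bnd_ijb m k B f x : (2 * n <= k)%N -> bnd m k B f -> normc (f x) <= B * ijb x.
Proof.
move=> nk /bnd0/(_ x) H; apply: le_ijb; first exact: normc_ge0.
by apply: le_trans H; rewrite ler_wpM2r ?normc_ge0// jbX_le.
Qed.

Lemma schwartz_cdiff f : schwartz f -> cdiff f (fun i => partialC i f).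
Proof. by move=> /(_ [::])[/= fd _] x; have [] := fd x. Qed.

Lemma schwartz_partial i f : schwartz f -> schwartz (partialC i f).
Proof.
move=> fS l; have := fS (rcons l i).
by rewrite /iter_partialC foldr_rcons.
Qed.

Lemma rapid_enorm f : (forall k : nat, exists C : R, forall x,
    (1 + enorm x) ^+ k * normc (f x) <= C) <-> rapid f.
Proof.
split=> H k; have [C HC] := H k.
  exists (n.+1%:R ^+ k * C) => x.
  apply: (@le_trans _ _ ((n.+1%:R * (1 + enorm x)) ^+ k * normc (f x))).
    rewrite ler_wpM2r ?normc_ge0// lerXn2r ?nnegrE ?jb_ge0 ?jb_enorm//.
    by rewrite mulr_ge0// addr_ge0// enorm_ge0.
  by rewrite exprMn -mulrA ler_wpM2l// exprn_ge0.
exists C => x; apply: le_trans (HC x).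
rewrite ler_wpM2r ?normc_ge0// lerXn2r ?nnegrE ?jb_ge0 ?enorm_jb//.
by rewrite addr_ge0// enorm_ge0.
Qed.

Lemma schwartz_rapid f : schwartz f -> rapid f.
Proof. by move=> /(_ [::])[_ /rapid_enorm]. Qed.

Lemma rapid_ge0 f k : rapid f -> exists2 C, 0 <= C & forall x, jb x ^+ k * normc (f x) <= C.
Proof.
move=> /(_ k)[C HC]; exists C => //; apply: le_trans (HC 0).
by rewrite mulr_ge0 ?normc_ge0 ?jbX_ge0.
Qed.

Lemma rapid_lin a f g : rapid f -> rapid g -> rapid (fun x => a * f x + g x).
Proof.
move=> rf rg k; have [C HC] := rf k; have [C' HC'] := rg k.
exists (normc a * C + C') => x.
apply: (@le_trans _ _ (jb x ^+ k * (normc a * normc (f x) + normc (g x)))).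
  by rewrite ler_wpM2l ?jbX_ge0// -normcM normcD.
by rewrite mulrDr mulrCA lerD// ler_wpM2l ?normc_ge0.
Qed.

Lemma schwartz_bnd f (m k : nat) : schwartz f -> exists B, bnd m k B f.
Proof.
elim: m f => [|m IH] f fS.
  by have [C HC] := schwartz_rapid fS k; exists C.
have [C C0 HC] := rapid_ge0 k (schwartz_rapid fS).
have /choice[B HB] i := IH _ (schwartz_partial i fS).
exists (C + \sum_i `|B i|); split => [x|i].
  by rewrite (le_trans (HC x))// lerDl sumr_ge0.
apply: bnd_le (HB i); rewrite (bigD1 i)//= addrCA.
by rewrite (le_trans (ler_norm _))// lerDl addr_ge0// sumr_ge0.
Qed.

(** Derivatives of the functions considered below are sums of functions of the
same kind; the span absorbs these sums. *)
Inductive span (P : set ('rV[R]_n -> R[i])) : set ('rV[R]_n -> R[i]) :=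
| span_base f : P f -> span P f
| span_zero : span P (fun _ => 0)
| span_lin a f g : span P f -> span P g -> span P (fun x => a * f x + g x).

Lemma span_sum P (I : Type) (s : seq I) (a : I -> R[i]) (F : I -> 'rV[R]_n -> R[i]) :
  (forall i, span P (F i)) -> span P (fun x => \sum_(i <- s) a i * F i x).
Proof.
move=> PF; elim: s => [|i s IH].
  by under eq_fun do rewrite big_nil; exact: span_zero.
by under eq_fun do rewrite big_cons; exact: span_lin.
Qed.

(** The Schwartz space is the largest class of rapidly decreasing differentiable
functions that is stable by partial derivatives. All the stability
properties below come from this principle, applied to the class of functions
to be shown Schwartz. *)
Lemma schwartz_coind (P : set ('rV[R]_n -> R[i])) :
  (forall f, P f -> rapid f /\ exists2 D, cdiff f D & forall i, span P (D i)) ->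
  span P `<=` @schwartz R n.
Proof.
move=> HP.
have step f : span P f -> rapid f /\ exists2 D, cdiff f D & forall i, span P (D i).
  elim=> {f} [f /HP//| |a f g _ [rf [D fD PD]] _ [rg [E gE PE]]].
    split; last by exists (fun _ _ => 0); [exact: cdiff_cst|move=> _; exact: span_zero].
    by move=> k; exists 0 => x; rewrite normc0 mulr0.
  split; first exact: rapid_lin.
  exists (fun i x => a * D i x + E i x); first exact: cdiff_lin.
  by move=> i; exact: span_lin.
move=> f Pf l.
have {Pf} : span P (iter_partialC l f).
  elim: l => //= i l /step[_ [D fD PD]].
  by rewrite -/(iter_partialC l f) (congr1 (@^~ i) (cdiff_partial fD)).
move=> /step[rf [D fD _]]; split; last exact/rapid_enorm.
by move=> x; case: (fD x).
Qed.

Lemma schwartz_sum (I : Type) (s : seq I) (a : I -> R[i]) (F : I -> 'rV[R]_n -> R[i]) :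
  (forall i, schwartz (F i)) -> schwartz (fun x => \sum_(i <- s) a i * F i x).
Proof.
move=> SF; apply: (@schwartz_coind (@schwartz R n)) => [f fS|].
  split; first exact: schwartz_rapid.
  exists (fun i => partialC i f); first exact: schwartz_cdiff.
  by move=> i; apply: span_base; exact: schwartz_partial.
by apply: span_sum => i; exact: span_base.
Qed.

Lemma schwartz_lin a f g : schwartz f -> schwartz g ->
  schwartz (fun x => a * f x + g x).
Proof.
move=> fS gS.
have fgS (b : bool) : schwartz (if b then f else g) by case: b.
have := @schwartz_sum bool [:: true; false] (fun b => if b then a else 1) _ fgS.
by under eq_fun do rewrite big_cons big_seq1 mul1r.
Qed.

Lemma schwartz0 : schwartz (fun _ : 'rV[R]_n => 0).
Proof.
have := @schwartz_sum void [::] (fun _ => 0) (fun _ _ => 0) (fun i => match i with end).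
by under eq_fun do rewrite big_nil.
Qed.

Lemma schwartzZ a f : schwartz f -> schwartz (fun x => a * f x).
Proof.
by move=> fS; have := schwartz_lin a fS schwartz0; under eq_fun do rewrite addr0.
Qed.

Lemma schwartzB f g : schwartz f -> schwartz g -> schwartz (fun x => f x - g x).
Proof.
by move=> fS gS; have := schwartz_lin (-1) gS fS;
  under eq_fun do rewrite mulN1r addrC.
Qed.

Lemma schwartz_conj f : schwartz f -> schwartz (fun x => conjc (f x)).
Proof.
move=> fS; apply: (@schwartz_coind [set g | exists2 f, schwartz f & g = fun x => conjc (f x)]).
  move=> _ [g gS ->]; split.
    move=> k; have [C HC] := schwartz_rapid gS k; exists C => x.
    by rewrite normc_conj.
  exists (fun i x => conjc (partialC i g x)).
    by apply: cdiff_conj; exact: schwartz_cdiff.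
  move=> i; apply: span_base; exists (partialC i g) => //.
  exact: schwartz_partial.
by apply: span_base; exists f.
Qed.

Definition slow (m : 'rV[R]_n -> R[i]) :=
  exists k (C : R), forall x, normc (m x) <= C * jb x ^+ k.

Lemma rapidM m f : slow m -> rapid f -> rapid (fun x => m x * f x).
Proof.
move=> [k0 [C HC]] rf k; have [C' HC'] := rf (k + k0)%N; exists (`|C| * C') => x.
rewrite normcM; apply: (@le_trans _ _ (`|C| * (jb x ^+ (k + k0) * normc (f x)))).
  rewrite exprD [leRHS](_ : _ = jb x ^+ k * ((`|C| * jb x ^+ k0) * normc (f x))); last by ring.
  rewrite ler_wpM2l ?jbX_ge0// ler_wpM2r ?normc_ge0// (le_trans (HC x))//.
  by rewrite ler_wpM2r ?jbX_ge0 ?ler_norm.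
by rewrite ler_wpM2l.
Qed.

(** A multiplier is allowed to grow, provided that all its derivatives are
multipliers of the same kind. *)
Lemma schwartz_mult (Q : set ('rV[R]_n -> R[i])) m f :
  (forall m, Q m -> slow m /\ exists2 D, cdiff m D & forall i, Q (D i)) ->
  Q m -> schwartz f -> schwartz (fun x => m x * f x).
Proof.
move=> HQ Qm fS.
pose P := [set h | exists m f, [/\ Q m, schwartz f & h = fun x => m x * f x]].
apply: (@schwartz_coind P); last by apply: span_base; exists m, f.
move=> _ [p [g [Qp gS ->]]]; have [sp [D pD QD]] := HQ _ Qp; split.
  by apply: rapidM => //; exact: schwartz_rapid.
exists (fun i x => D i x * g x + p x * partialC i g x).
  by apply: cdiffM => //; exact: schwartz_cdiff.
move=> i; have -> : (fun x => D i x * g x + p x * partialC i g x) =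
    (fun x => 1 * (D i x * g x) + p x * partialC i g x).
  by apply/funext => x; rewrite mul1r.
apply: span_lin; apply: span_base; first by exists (D i), g.
by exists p, (partialC i g); split => //; exact: schwartz_partial.
Qed.

Lemma schwartz_slow f : schwartz f -> slow f.
Proof.
move=> /schwartz_rapid/(_ 0%N)[C HC]; exists 0%N, C => x.
by have := HC x; rewrite expr0 mul1r mulr1.
Qed.

Lemma schwartzM f g : schwartz f -> schwartz g -> schwartz (fun x => f x * g x).
Proof.
move=> fS gS; apply: (@schwartz_mult (@schwartz R n)) => // m mS.
split; first exact: schwartz_slow.
exists (fun i => partialC i m); first exact: schwartz_cdiff.
by move=> i; exact: schwartz_partial.
Qed.

(** Presented inductively, so that the stability by derivation is an induction. *)
Inductive poly_fun : set ('rV[R]_n -> R[i]) :=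
| poly_cst a : poly_fun (fun _ => a)
| poly_coord i : poly_fun (fun x => (x ord0 i)%:C)
| polyD f g : poly_fun f -> poly_fun g -> poly_fun (fun x => f x + g x)
| polyM f g : poly_fun f -> poly_fun g -> poly_fun (fun x => f x * g x).

Lemma poly_funP f : poly_fun f ->
  slow f /\ exists2 D, cdiff f D & forall i, poly_fun (D i).
Proof.
elim=> {f} [a|i|f g pf [sf [D fD PD]] pg [sg [E gE PE]]|
    f g pf [sf [D fD PD]] pg [sg [E gE PE]]].
- split; first by exists 0%N, (normc a) => x; rewrite mulr1.
  by exists (fun _ _ => 0); [exact: cdiff_cst|move=> _; exact: poly_cst].
- split; first by exists 1%N, 1 => x; rewrite mul1r normc_real coord_jb.
  by eexists; [exact: cdiff_coord|move=> j; exact: poly_cst].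
- split.
    have [k [C HC]] := sf; have [k' [C' HC']] := sg.
    exists (maxn k k'), (`|C| + `|C'|) => x; apply: (le_trans (normcD _ _)).
    have H (b c : R) k1 k2 : b <= c * jb x ^+ k1 -> (k1 <= k2)%N -> b <= `|c| * jb x ^+ k2.
      move=> bc k12; apply: (le_trans bc); apply: (@le_trans _ _ (`|c| * jb x ^+ k1)).
        by rewrite ler_wpM2r ?jbX_ge0 ?ler_norm.
      by rewrite ler_wpM2l ?jbX_le.
    by rewrite mulrDl lerD//; [apply: H (HC x) _; exact: leq_maxl|
      apply: H (HC' x) _; exact: leq_maxr].
  exists (fun i x => 1 * D i x + E i x); last first.
    by move=> i; apply: polyD => //; apply: polyM => //; exact: poly_cst.
  by have := cdiff_lin 1 fD gE; under eq_fun do rewrite mul1r.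
- split.
    have [k [C HC]] := sf; have [k' [C' HC']] := sg.
    exists (k + k')%N, (C * C') => x; rewrite normcM exprD mulrACA.
    by apply: ler_pM; rewrite ?normc_ge0.
  exists (fun i x => D i x * g x + f x * E i x); first exact: cdiffM.
  by move=> i; apply: polyD; apply: polyM.
Qed.

Lemma schwartz_poly m f : poly_fun m -> schwartz f -> schwartz (fun x => m x * f x).
Proof. exact: schwartz_mult poly_funP. Qed.

Lemma cdiff_cis (w : 'rV[R]_n) : cdiff (fun x => cis (dotv x w))
  (fun i x => ('i%C * (w ord0 i)%:C) * cis (dotv x w)).
Proof.
apply: (@quad_cdiff _ _ _ _ (2 * l1 w ^+ 2)) => x h _.
have -> : rem (fun x => cis (dotv x w))
    (fun i x => ('i%C * (w ord0 i)%:C) * cis (dotv x w)) x h =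
    cis (dotv x w) * (cis (dotv h w) - 1 - 'i%C * (dotv h w)%:C).
  rewrite /rem dotvDl cisD.
  have -> : \sum_i (h ord0 i)%:C * ('i%C * (w ord0 i)%:C * cis (dotv x w)) =
      cis (dotv x w) * ('i%C * (dotv h w)%:C).
    rewrite /dotv rmorph_sum/= !mulr_sumr; apply: eq_bigr => i _.
    by rewrite rmorphM; ring.
  by ring.
rewrite normcM normc_cis mul1r (le_trans (normc_cisB2 _))// -mulrA ler_wpM2l//.
rewrite -exprMn -(real_normK (num_real (dotv h w))) lerXn2r ?nnegrE ?mulr_ge0 ?l1_ge0//.
by rewrite mulrC normr_dotv.
Qed.

Lemma schwartz_cis (w : 'rV[R]_n) f : schwartz f ->
  schwartz (fun x => cis (dotv x w) * f x).
Proof.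
move=> fS.
pose Q := [set m | exists a : R[i], m = fun x => a * cis (dotv x w)].
have := @schwartz_mult Q (fun x => 1 * cis (dotv x w)) f.
under [X in _ -> _ -> _ -> schwartz X]eq_fun do rewrite mul1r.
apply => //; last by exists 1.
move=> _ [a ->]; split.
  by exists 0%N, (normc a) => x; rewrite normcM normc_cis.
have := cdiff_lin a (cdiff_cis w) (cdiff_cst 0).
move=> /cdiff_ext H; eexists.
- by apply: H => [x|i x]; [rewrite addr0|reflexivity].
- move=> i; exists (a * ('i%C * (w ord0 i)%:C)); apply/funext => x.
  by rewrite addr0; ring.
Qed.

(** From [exp (u / k) >= 1 + u / k], raised to the power [k]; the factor [pi >
1] in the exponent absorbs the resulting [exp |x|^2]. *)
Lemma jbX_expR k : exists C, forall x : 'rV[R]_n, jb x ^+ k * normc (gaussian x) <= C.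
Proof.
have E (u : R) : 0 <= u -> (1 + u) ^+ k <= (k.+1%:R) ^+ k * expR u.
  move=> u0; apply: (@le_trans _ _ ((k.+1%:R * expR (u / k.+1%:R)) ^+ k)).
    rewrite lerXn2r ?nnegrE ?addr_ge0// ?mulr_ge0 ?expR_ge0//.
    apply: (@le_trans _ _ (k.+1%:R * (1 + u / k.+1%:R))).
      rewrite mulrDr mulr1 mulrCA mulfV ?pnatr_eq0// mulr1 lerD2r.
      by rewrite ler1n.
    by rewrite ler_wpM2l// expR_ge1Dx.
  rewrite exprMn ler_wpM2l ?exprn_ge0// -expRM_natl ler_expR.
  rewrite mulrCA ler_piMr// ler_pdivrMr ?ltr0n// mul1r ler_nat.
  exact: leqnSn.
exists ((2 * n.+1%:R ^+ 2) ^+ k * k.+1%:R ^+ k) => x.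
rewrite normc_gaussian /=.
have d0 := dotvv_ge0 x.
apply: (@le_trans _ _ (((2 * n.+1%:R ^+ 2) ^+ k * k.+1%:R ^+ k) * (expR (dotv x x) * expR (- (pi * dotv x x))))).
  rewrite mulrA ler_wpM2r ?expR_ge0// -mulrA.
  apply: (@le_trans _ _ ((jb x ^+ 2) ^+ k)).
    by rewrite -exprM jbX_le// leq_pmull.
  apply: (@le_trans _ _ ((2 * n.+1%:R ^+ 2 * (1 + dotv x x)) ^+ k)).
    by rewrite lerXn2r ?nnegrE ?jbX_ge0 ?jb_dotv// !mulr_ge0 ?addr_ge0 ?sqr_ge0.
  by rewrite exprMn ler_wpM2l ?E// exprn_ge0// mulr_ge0// sqr_ge0.
rewrite ler_piMr ?mulr_ge0 ?exprn_ge0 ?mulr_ge0 ?sqr_ge0//.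
rewrite -expRD expR_le1 -{1}(mul1r (dotv x x)) -mulNr -mulrDl.
by rewrite mulr_le0_ge0// subr_le0 (le_trans _ (pi_ge2 R))// ler1n.
Qed.

Lemma cdiff_gaussian :
  cdiff (@gaussian R n) (fun i x => (- (2 * pi))%:C * (x ord0 i)%:C * gaussian x).
Proof.
have dsq x : differentiable (fun y : 'rV[R]_n => dotv y y) x /\
    forall i, 'D_(delta_mx ord0 i) (fun y => dotv y y) x = 2 * x ord0 i.
  apply: (@quad_differentiable _ _ _ _ _ 1) => h h1.
  have -> : dotv (x + h) (x + h) - dotv x x - \sum_i h ord0 i * (2 * x ord0 i) = dotv h h.
    have -> : \sum_i h ord0 i * (2 * x ord0 i) = 2 * dotv x h.
      by rewrite mulr_sumr; apply: eq_bigr => i _; ring.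
    by rewrite !dotvDl !dotvDr (dotvC h x); ring.
  by rewrite mul1r normr_dotv.
pose F (s : R) := expR (- (pi * s)).
have dF s : differentiable F s /\ 'D_1 F s = - pi * F s.
  have H : is_derive s 1 F (- pi * F s).
    have h1 : is_derive s (1 : R) (fun s : R => - (pi * s)) (- pi).
      have -> : (fun s : R => - (pi * s)) = (- pi) *: id.
        by apply/funext => t; rewrite !fctE/= /GRing.scale/= mulNr.
      by apply: is_derive_eq; rewrite /GRing.scale/= mulr1.
    have := @is_derive1_comp R expR (fun s : R => - (pi * s)) s _ _
      (is_derive_expR _) h1.
    by rewrite mulrC.
  by split; [apply/derivable1_diffP; exact: ex_derive|exact: derive_val].
move=> x; have [d1 e1] := dsq x; have [d2 e2] := dF (dotv x x).
have dE : (fun y : 'rV[R]_n => Re (gaussian y)) = F \o (fun y => dotv y y) by [].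
rewrite /partialC dE; split.
- exact: differentiable_comp.
- exact: differentiable_cst.
- move=> i; apply: complex_ext; rewrite !ReImE/=.
    rewrite deriveE; last exact: differentiable_comp.
    rewrite diff_comp//= -[X in 'd F _ X]mulr1 -/(_ *: 1) linearZ/=.
    rewrite -!deriveE// e1 e2 /GRing.scale/= -/(F _) /F; ring.
  by rewrite derive_cst; ring.
Qed.

(** The derivatives of the Gaussian are polynomial multiples of it. *)
Lemma schwartz_gaussian : schwartz (@gaussian R n).
Proof.
pose P := [set h | exists2 p, poly_fun p & h = fun x => p x * gaussian x].
have := @schwartz_coind P _ (fun x => 1 * gaussian x).
under [X in _ -> _ -> schwartz X]eq_fun do rewrite mul1r.
apply; last first.
  by apply: span_base; exists (fun _ => 1) => //; exact: poly_cst.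
move=> _ [p pp ->]; have [sp [D pD PD]] := poly_funP pp; split.
  apply: rapidM => // k; exact: jbX_expR.
exists (fun i x => D i x * gaussian x +
    p x * ((- (2 * pi))%:C * (x ord0 i)%:C * gaussian x)).
  by apply: cdiffM => //; exact: cdiff_gaussian.
move=> i; apply: span_base.
exists (fun x => D i x + p x * ((- (2 * pi))%:C * (x ord0 i)%:C)).
  by apply: polyD => //; do 2 apply: polyM => //; [exact: poly_cst|exact: poly_coord].
by apply/funext => x; ring.
Qed.

(** The weight changes by at most a factor 2 over the unit ball, which lets
pointwise Taylor bounds be weighted. *)
Lemma shift_jb (x h : 'rV[R]_n) (s : R) k : 0 <= s <= 1 -> l1 h <= 1 ->
  jb x ^+ k <= 2 ^+ k * jb (s *: h + x) ^+ k.
Proof.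
move=> /andP[s0 s1] h1; rewrite -exprMn lerXn2r ?nnegrE ?mulr_ge0 ?jb_ge0//.
rewrite -{1}(addrK (s *: h) x) (addrC x) (le_trans (jbB _ _))// mulrC.
rewrite ler_wpM2r ?jb_ge0// /jb l1Z ger0_norm//.
by have := l1_ge0 h; nra.
Qed.

Lemma schwartz_taylor k B f x h : schwartz f -> bnd 2 k B f -> l1 h <= 1 ->
  jb x ^+ k * normc (rem f (fun i => partialC i f) x h) <= 4 * 2 ^+ k * B * l1 h ^+ 2.
Proof.
move=> fS fB h1.
have j0 : 0 < jb x ^+ k by exact: lt_le_trans (jbX_ge1 x k).
have := @cdiff_taylor R n f _ _ x h (2 ^+ k * B / jb x ^+ k) (schwartz_cdiff fS)
  (fun i => schwartz_cdiff (schwartz_partial i fS)) _.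
move=> H; rewrite mulrC -ler_pdivlMr//.
apply: le_trans (H _) _; last by rewrite le_eqVlt; apply/orP; left; apply/eqP; ring.
move=> s s01 i j; rewrite ler_pdivlMr//.
apply: (@le_trans _ _ (2 ^+ k *
    (jb (s *: h + x) ^+ k * normc (partialC j (partialC i f) (s *: h + x))))).
  by rewrite mulrC mulrA ler_wpM2r ?normc_ge0 ?shift_jb.
by rewrite ler_wpM2l ?exprn_ge0// (bnd0 (bndS j (bndS i fB))).
Qed.

End fixed_dimension.

(** The hypothesis says that the affine map does not contract at infinity: it
holds for all injective linear parts. *)
Lemma schwartz_aff m n (A : 'M[R]_(n, m)) (b : 'rV[R]_m) f : schwartz f ->
  (exists C, forall x : 'rV[R]_n, jb x <= C * jb (x *m A + b)) ->
  schwartz (fun x => f (x *m A + b)).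
Proof.
move=> fS [C HC].
pose P := [set g : 'rV[R]_n -> R[i] |
  exists2 f, schwartz f & g = fun x => f (x *m A + b)].
have H : span P `<=` @schwartz R n; last by apply: H; apply: span_base; exists f.
apply: schwartz_coind.
move=> _ [g gS ->]; split.
  move=> k; have [C' HC'] := schwartz_rapid gS k; exists (`|C| ^+ k * C') => x.
  apply: (@le_trans _ _ (`|C| ^+ k * (jb (x *m A + b) ^+ k * normc (g (x *m A + b))))).
    rewrite mulrA ler_wpM2r ?normc_ge0// -exprMn.
    rewrite lerXn2r ?nnegrE ?mulr_ge0 ?jb_ge0// (le_trans (HC x))//.
    by rewrite ler_wpM2r ?jb_ge0 ?ler_norm.
  by rewrite ler_wpM2l// exprn_ge0.
exists (fun i x => \sum_j (A i j)%:C * partialC j g (x *m A + b)).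
  exact: (cdiff_aff A b (schwartz_cdiff gS)).
move=> i; apply: span_sum => j; apply: span_base.
by exists (partialC j g) => //; exact: schwartz_partial.
Qed.

Lemma schwartz_shift n (z : 'rV[R]_n) f : schwartz f -> schwartz (fun x => f (x + z)).
Proof.
move=> fS.
have -> : (fun x => f (x + z)) = (fun x => f (x *m 1%:M + z)).
  by apply/funext => x; rewrite mulmx1.
apply: schwartz_aff => //; exists (jb z) => x; rewrite mulmx1 -{1}(addrK z x) mulrC.
exact: jbB.
Qed.

Lemma partialC_shift n (z : 'rV[R]_n) f i x : schwartz f ->
  partialC i (fun x => f (x + z)) x = partialC i f (x + z).
Proof.
move=> fS; have := @cdiff_aff R n n 1%:M z f _ (schwartz_cdiff fS) x.
have -> : (fun x => f (x + z)) = (fun x => f (x *m 1%:M + z)).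
  by apply/funext => y; rewrite mulmx1.
move=> [_ _ ->]; rewrite mulmx1 (bigD1 i)//= mxE eqxx mul1r big1 ?addr0//.
by move=> j ji; rewrite mxE eq_sym (negbTE ji) mul0r.
Qed.

Lemma l1_delta n (i : 'I_n) : l1 (delta_mx ord0 i : 'rV[R]_n) = 1.
Proof.
rewrite /l1 (bigD1 i)//= mxE !eqxx normr1 big1 ?addr0// => j ji.
by rewrite mxE eqxx/= (negbTE ji) normr0.
Qed.

Lemma rem_delta n (f : 'rV[R]_n -> R[i]) D x s i :
  rem f D x (s *: delta_mx ord0 i) = f (x + s *: delta_mx ord0 i) - f x - s%:C * D i x.
Proof.
rewrite /rem; congr (_ - _); rewrite (bigD1 i)//= !mxE !eqxx mulr1 big1 ?addr0//.
by move=> j ji; rewrite !mxE eqxx/= (negbTE ji) mulr0 mul0r.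
Qed.

(** Both second derivatives are limits of the same symmetric second difference. *)
Lemma schwartz_partialC n (f : 'rV[R]_n -> R[i]) i j x : schwartz f ->
  partialC i (partialC j f) x = partialC j (partialC i f) x.
Proof.
move=> fS.
(* Symmetric in [i] and [j], and equal to [s^2] times either second
derivative up to [O(s^3)]. *)
pose Delta (s : R) i j := f (x + s *: delta_mx ord0 i + s *: delta_mx ord0 j)
  - f (x + s *: delta_mx ord0 i) - f (x + s *: delta_mx ord0 j) + f x.
have [B fB] := schwartz_bnd 3 0 fS.
have B0 := bnd_ge0 fB.
have key a b (s : R) : 0 < s <= 1 ->
    normc (Delta s a b - s%:C * s%:C * partialC b (partialC a f) x) <= (12 * B) * s ^+ 3.
  move=> /andP[s0 s1].
  have sl c : l1 (s *: delta_mx ord0 c : 'rV[R]_n) = s.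
    by rewrite l1Z l1_delta mulr1 gtr0_norm.
  pose psi y := f (y + s *: delta_mx ord0 b) - f y.
  have psiS : schwartz psi by apply: schwartzB => //; exact: schwartz_shift.
  have dpsi c : partialC c psi = fun y =>
      partialC c f (y + s *: delta_mx ord0 b) - partialC c f y.
    apply/funext => y.
    have := cdiff_lin (-1) (schwartz_cdiff fS)
      (schwartz_cdiff (schwartz_shift (s *: delta_mx ord0 b) fS)).
    have -> : (fun y => -1 * f y + f (y + s *: delta_mx ord0 b)) = psi.
      by apply/funext => u; rewrite mulN1r addrC.
    by move=> /(_ y)[_ _ ->]; rewrite partialC_shift// mulN1r addrC.
  have t1 : normc (rem psi (fun c => partialC c psi) x (s *: delta_mx ord0 a)) <=
      4 * (2 * (B * s) * s ^+ 2).
    suff : normc (rem psi (fun c => partialC c psi) x (s *: delta_mx ord0 a)) <=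
        4 * (2 * (B * s) * l1 (s *: delta_mx ord0 a) ^+ 2) by rewrite sl.
    apply: (cdiff_taylor (schwartz_cdiff psiS)
      (fun c => schwartz_cdiff (schwartz_partial c psiS))) => t _ c e.
    rewrite dpsi.
    have pS := schwartz_partial c fS.
    have := cdiff_lin (-1) (schwartz_cdiff pS)
      (schwartz_cdiff (schwartz_shift (s *: delta_mx ord0 b) pS)).
    have -> : (fun y => -1 * partialC c f y + partialC c f (y + s *: delta_mx ord0 b)) =
        (fun y => partialC c f (y + s *: delta_mx ord0 b) - partialC c f y).
      by apply/funext => u; rewrite mulN1r addrC.
    move=> /(_ (t *: (s *: delta_mx ord0 a) + x))[_ _ ->].
    rewrite partialC_shift// mulN1r addrC.
    suff : normc (partialC e (partialC c f) (t *: (s *: delta_mx ord0 a) + x +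
        s *: delta_mx ord0 b) - partialC e (partialC c f)
        (t *: (s *: delta_mx ord0 a) + x)) <= 2 * (B * l1 (s *: delta_mx ord0 b)).
      by rewrite sl.
    apply: (cdiff_lip (schwartz_cdiff (schwartz_partial e pS))) => t' _ k.
    by apply: bnd_normc; exact: (bndS k (bndS e (bndS c fB))).
  have t2 : normc (rem (partialC a f) (fun c => partialC c (partialC a f)) x
      (s *: delta_mx ord0 b)) <= 4 * (B * s ^+ 2).
    suff : normc (rem (partialC a f) (fun c => partialC c (partialC a f)) x
        (s *: delta_mx ord0 b)) <= 4 * (B * l1 (s *: delta_mx ord0 b) ^+ 2) by rewrite sl.
    apply: (cdiff_taylor (schwartz_cdiff (schwartz_partial a fS))
      (fun c => schwartz_cdiff (schwartz_partial c (schwartz_partial a fS)))) => t _ c e.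
    by apply: bnd_normc; exact: (bndS e (bndS c (bndS a fB))).
  rewrite rem_delta dpsi in t1; rewrite rem_delta in t2.
  have -> : Delta s a b - s%:C * s%:C * partialC b (partialC a f) x =
    (psi (x + s *: delta_mx ord0 a) - psi x - s%:C *
      (partialC a f (x + s *: delta_mx ord0 b) - partialC a f x)) +
    s%:C * (partialC a f (x + s *: delta_mx ord0 b) - partialC a f x -
      s%:C * partialC b (partialC a f) x).
    by rewrite /Delta /psi; ring.
  apply: (le_trans (normcD _ _)).
  have -> : 12 * B * s ^+ 3 = 4 * (2 * (B * s) * s ^+ 2) + s * (4 * (B * s ^+ 2)) by ring.
  by rewrite lerD// normcM normc_real gtr0_norm// ler_wpM2l// ltW.
have DC s : Delta s i j = Delta s j i.
  by rewrite /Delta (addrAC x (s *: delta_mx ord0 i)); ring.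
apply/eqP; rewrite -subr_eq0; apply/eqP/eq0_normc/eqP.
rewrite eq_le normc_ge0 andbT; apply: (@le0_small _ (24 * B)) => s s01.
have /andP[s0 s1] := s01.
have k1 := key i j s s01; have k2 := key j i s s01.
have : normc (s%:C * s%:C * (partialC i (partialC j f) x - partialC j (partialC i f) x))
    <= (24 * B) * s ^+ 3.
  have -> : s%:C * s%:C * (partialC i (partialC j f) x - partialC j (partialC i f) x) =
    (Delta s i j - s%:C * s%:C * partialC j (partialC i f) x) -
    (Delta s j i - s%:C * s%:C * partialC i (partialC j f) x).
    rewrite DC; move: (Delta _ _ _) (partialC i _ x) (partialC j _ x) => a b c.
    by ring.
  apply: (le_trans (normcB _ _)).
  have -> : 24 * B * s ^+ 3 = 12 * B * s ^+ 3 + 12 * B * s ^+ 3 by ring.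
  exact: (lerD k1 k2).
rewrite !normcM normc_real gtr0_norm//.
have -> : 24 * B * s ^+ 3 = s * s * (24 * B * s) by ring.
by rewrite ler_pM2l ?mulr_gt0.
Qed.

End schwartz_functions.

Arguments bnd {R n} (m k)%_nat_scope B f.
Arguments schwartz_bnd {R n f} (m k)%_nat_scope.

(** * The short-time Fourier transform of Schwartz functions *)

Section schwartz_stft.
Context {R : realType}.
Notation lam := (@lebesgue_rV R).
Notation phase n := (@phase_measure R n).

Definition Iijb n : R := (\int[lam n]_x ijb x).

Lemma Iijb_ge0 n : 0 <= Iijb n.
Proof. by apply: Rintegral_ge0 => x _; exact: ijb_ge0. Qed.

Lemma integrable_ijbZ n (C : R) : (lam n).-integrable setT (EFin \o (fun x => C * ijb x)).
Proof. exact: (integrableZl measurableT C (@integrable_ijb R n)). Qed.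

Lemma Rintegral_ijbZ n (C : R) : \int[lam n]_x (C * ijb x) = C * Iijb n.
Proof. by rewrite RintegralZl//; exact: integrable_ijb. Qed.

Lemma normc_Cintegral_ijb n (f : 'rV[R]_n -> R[i]) C : cmeas f ->
  (forall x, normc (f x) <= C * ijb x) -> normc (Cintegral (lam n) f) <= 2 * C * Iijb n.
Proof.
move=> mf fC; rewrite -mulrA -Rintegral_ijbZ.
exact: (normc_Cintegral mf (integrable_ijbZ n C)).
Qed.

Lemma schwartz_cmeas n (f : 'rV[R]_n -> R[i]) : schwartz f -> cmeas f.
Proof. by move=> /schwartz_cdiff/cdiff_cmeas. Qed.

Lemma schwartz_cint n (f : 'rV[R]_n -> R[i]) : schwartz f -> cint (lam n) f.
Proof.
move=> fS; have [B fB] := schwartz_bnd 0 (2 * n) fS.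
apply: (cint_dom (schwartz_cmeas fS) (integrable_ijbZ n B)) => x.
exact: bnd_ijb fB.
Qed.

Lemma schwartz_square_integrable n (f : 'rV[R]_n -> R[i]) : schwartz f ->
  square_integrable f.
Proof.
move=> fS; have [m1 m2] := schwartz_cmeas fS; split => //.
have := cint_normc (schwartz_cint (schwartzM fS fS)).
by under eq_fun do rewrite normcM -expr2.
Qed.

(** The integral of a derivative vanishes, because the integral of a difference
quotient does. *)
Lemma Cintegral_partialC n i (f : 'rV[R]_n -> R[i]) : schwartz f ->
  Cintegral (lam n) (partialC i f) = 0.
Proof.
move=> fS; have [B fB] := schwartz_bnd 2 (2 * n) fS.
have pS := schwartz_partial i fS.
apply/eq0_normc/eqP; rewrite eq_le normc_ge0 andbT.
(* The integral of the remainder of order one is [- s] times the integral of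
the derivative, and it is [O(s^2)]. *)
apply: (@le0_small R _ (2 * (4 * 2 ^+ (2 * n) * B) * Iijb n)) => s /andP[s0 s1].
pose e : 'rV[R]_n := s *: delta_mx ord0 i.
have l1e : l1 e = s by rewrite l1Z l1_delta mulr1 gtr0_norm.
have sS := schwartz_shift e fS.
pose r x := f (x + e) - f x - s%:C * partialC i f x.
have rS : schwartz r by apply: schwartzB; [exact: schwartzB|exact: schwartzZ].
have rI : Cintegral (lam n) r = - (s%:C * Cintegral (lam n) (partialC i f)).
  rewrite CintegralB; last 2 first.
  - by apply: schwartz_cint; exact: schwartzB.
  - by apply: schwartz_cint; exact: schwartzZ.
  rewrite CintegralB ?CintegralZ; try exact: schwartz_cint.
  by rewrite Cintegral_shift ?subrr ?sub0r//; exact: schwartz_cmeas.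
have : normc (Cintegral (lam n) r) <= 2 * (4 * 2 ^+ (2 * n) * B * s ^+ 2) * Iijb n.
  apply: normc_Cintegral_ijb => [|x]; first exact: schwartz_cmeas.
  apply: le_ijb; first exact: normc_ge0.
  have := @schwartz_taylor _ _ (2 * n)%N B f x e fS fB.
  by rewrite rem_delta l1e; apply.
rewrite rI normcN normcM normc_real gtr0_norm//.
have -> : 2 * (4 * 2 ^+ (2 * n) * B * s ^+ 2) * Iijb n =
  s * (2 * (4 * 2 ^+ (2 * n) * B) * Iijb n * s) by ring.
by rewrite ler_pM2l.
Qed.

Section stft_schwartz.
Context {n : nat}.
Implicit Types (f h : 'rV[R]_n -> R[i]) (z : 'rV[R]_n * 'rV[R]_n).

Lemma cis_dotvE (t w : 'rV[R]_n) :
  cis (- (2 * pi * dotv t w)) = cis (dotv t (- (2 * pi) *: w)).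
Proof. by rewrite dotvZr mulNr. Qed.

Lemma cmeas_stft_integrand f h : cmeas f -> cmeas h ->
  cmeas (fun p : ('rV[R]_n * 'rV[R]_n) * 'rV[R]_n =>
    f p.2 * conjc (h (p.2 - p.1.1)) * cis (- (2 * pi * dotv p.2 p.1.2))).
Proof.
move=> mf mh; apply: cmeasM; first apply: cmeasM.
- exact: (cmeas_comp mf measurable_snd).
- apply: cmeas_conj; apply: (cmeas_comp mh).
  apply: measurable_rVB; first exact: measurable_snd.
  exact: measurableT_comp measurable_fst measurable_fst.
- apply: cmeas_cis; apply: measurableT_comp => //.
  apply: measurable_funM => //; apply: measurable_dotv; first exact: measurable_snd.
  exact: measurableT_comp measurable_snd measurable_fst.
Qed.

Lemma cmeas_stft f h : cmeas f -> cmeas h -> cmeas (stft h f).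
Proof.
by move=> mf mh; exact: (cmeas_Cintegral_param (lam n) (cmeas_stft_integrand mf mh)).
Qed.

Lemma cmeas_stft_slice f h z : cmeas f -> cmeas h ->
  cmeas (fun t => f t * conjc (h (t - z.1)) * cis (- (2 * pi * dotv t z.2))).
Proof.
move=> mf mh.
exact: (@cmeas_comp R _ _ _ _ (pair z) _ (cmeas_stft_integrand mf mh) (pair1_measurable z)).
Qed.

Lemma schwartz_stft_slice f h z : schwartz f -> schwartz h ->
  schwartz (fun t => f t * conjc (h (t - z.1)) * cis (- (2 * pi * dotv t z.2))).
Proof.
move=> fS hS.
have := schwartz_cis (- (2 * pi) *: z.2)
  (schwartzM fS (schwartz_conj (schwartz_shift (- z.1) hS))).
by under eq_fun do rewrite -cis_dotvE mulrC.
Qed.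

(** Integration by parts: multiplying the short-time Fourier transform by a
frequency costs one derivative of the function or of the window. *)
Lemma stft_ibp i f h z : schwartz f -> schwartz h ->
  'i%C * (2 * pi * z.2 ord0 i)%:C * stft h f z =
  stft h (partialC i f) z + stft (partialC i h) f z.
Proof.
move=> fS hS.
pose E t := cis (- (2 * pi * dotv t z.2)).
have := Cintegral_partialC i (schwartz_stft_slice z fS hS).
have -> : partialC i (fun t => f t * conjc (h (t - z.1)) * E t) = fun t =>
    (partialC i f t * conjc (h (t - z.1)) * E t +
     f t * conjc (partialC i h (t - z.1)) * E t) +
    (- ('i%C * (2 * pi * z.2 ord0 i)%:C)) * (f t * conjc (h (t - z.1)) * E t).
  apply/funext => t.
  have hz := schwartz_cdiff (schwartz_shift (- z.1) hS).
  have := cdiffM (cdiffM (schwartz_cdiff fS) (cdiff_conj hz))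
    (cdiff_cis (- (2 * pi) *: z.2)).
  have -> : (fun x => f x * conjc (h (x - z.1)) * cis (dotv x (- (2 * pi) *: z.2))) =
      (fun t => f t * conjc (h (t - z.1)) * E t).
    by apply/funext => x; rewrite -cis_dotvE.
  move=> /(_ t)[_ _ ->]; rewrite partialC_shift// -cis_dotvE -/(E t) mxE.
  rewrite mulNr rmorphN; ring.
have c1 := schwartz_cint (schwartz_stft_slice z (schwartz_partial i fS) hS).
have c2 := schwartz_cint (schwartz_stft_slice z fS (schwartz_partial i hS)).
have c3 := schwartz_cint (schwartz_stft_slice z fS hS).
rewrite CintegralD; [|exact: cintD|exact: cintZ].
rewrite CintegralD// CintegralZ// mulNr => /eqP.
by rewrite subr_eq0 => /eqP <-.
Qed.

(** Decay in time: the weight at [z.1] is at most the product of the weights at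
[t] and at [t - z.1], one absorbed by the function and the other by the
window. *)
Lemma stft_decay0 (N : nat) h : schwartz h -> exists2 C : R, 0 <= C &
  forall f B, schwartz f -> bnd 0 (N + 2 * n) B f -> forall z,
    jb z.1 ^+ N * normc (stft h f z) <= C * B.
Proof.
move=> hS; have [C hC] := schwartz_bnd 0 N hS; have C0 := bnd_ge0 hC.
exists (2 * C * Iijb n); first by rewrite !mulr_ge0// Iijb_ge0.
move=> f B fS fB z; have B0 := bnd_ge0 fB.
have J0 : 0 < jb z.1 ^+ N by exact: lt_le_trans (jbX_ge1 _ _).
rewrite mulrC -ler_pdivlMr//.
have -> : 2 * C * Iijb n * B / jb z.1 ^+ N = 2 * (C * B / jb z.1 ^+ N) * Iijb n by ring.
apply: normc_Cintegral_ijb.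
  exact: cmeas_stft_slice (schwartz_cmeas fS) (schwartz_cmeas hS).
move=> t; rewrite !normcM normc_conj normc_cis mulr1.
rewrite mulrAC ler_pdivlMr//.
have h1 : jb t ^+ N * normc (f t) <= B * ijb t.
  apply: le_ijb; first by rewrite mulr_ge0 ?jbX_ge0 ?normc_ge0.
  by rewrite mulrA -exprD addnC; exact: (bnd0 fB).
apply: (@le_trans _ _ ((jb t ^+ N * normc (f t)) * (jb (t - z.1) ^+ N * normc (h (t - z.1))))).
  rewrite [leRHS](_ : _ = (normc (f t) * normc (h (t - z.1))) * (jb t * jb (t - z.1)) ^+ N).
    rewrite ler_wpM2l ?mulr_ge0 ?normc_ge0// lerXn2r ?nnegrE ?mulr_ge0 ?jb_ge0//.
    by rewrite -{1}(subKr t z.1) (le_trans (jbB _ _)).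
  by rewrite exprMn; ring.
apply: (@le_trans _ _ ((B * ijb t) * C)).
  by apply: ler_pM => //; rewrite ?mulr_ge0 ?jbX_ge0 ?normc_ge0//; exact: (bnd0 hC).
by rewrite le_eqVlt; apply/orP; left; apply/eqP; ring.
Qed.

(** Rapid decay in time and frequency, with bounds linear in one seminorm of the
function; each power of the frequency is paid by an integration by parts. *)
Lemma stft_decay (M N : nat) h : schwartz h -> exists2 C : R, 0 <= C &
  forall f B, schwartz f -> bnd M (N + 2 * n) B f -> forall z,
    jb z.2 ^+ M * (jb z.1 ^+ N * normc (stft h f z)) <= C * B.
Proof.
elim: M h => [|M IH] h hS.
  have [C C0 HC] := stft_decay0 N hS; exists C => // f B fS fB z.
  by rewrite expr0 mul1r; exact: HC.
have [C C0 HC] := IH h hS.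
have /choice[D HD] i : exists D : R, 0 <= D /\
    forall f B, schwartz f -> bnd M (N + 2 * n) B f -> forall z,
    jb z.2 ^+ M * (jb z.1 ^+ N * normc (stft (partialC i h) f z)) <= D * B.
  by have [D D0 DH] := IH _ (schwartz_partial i hS); exists D.
exists (C + \sum_i (C + D i)).
  by rewrite addr_ge0// sumr_ge0// => i _; rewrite addr_ge0//; case: (HD i).
move=> f B fS fB z; have fB' := bndW (leqnSn M) fB.
rewrite exprS -mulrA; set X := jb z.2 ^+ M * _.
rewrite {1}/jb mulrDl mul1r mulrDl lerD//; first exact: HC.
rewrite /l1 !mulr_suml; apply: ler_sum => i _; rewrite mulrDl.
have P0 : 0 <= jb z.2 ^+ M * jb z.1 ^+ N by rewrite mulr_ge0 ?jbX_ge0.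
apply: (@le_trans _ _ ((jb z.2 ^+ M * jb z.1 ^+ N) *
    (normc (stft h (partialC i f) z) + normc (stft (partialC i h) f z)))).
  rewrite /X [leLHS](_ : _ = (jb z.2 ^+ M * jb z.1 ^+ N) *
    (`|z.2 ord0 i| * normc (stft h f z))); last by ring.
  rewrite ler_wpM2l//; apply: le_trans (normcD _ _).
  rewrite -stft_ibp// !normcM normc_i mul1r normc_real ler_wpM2r ?normc_ge0//.
  rewrite normrM ler_peMl// normrM (ger0_norm (pi_ge0 R)) ger0_norm//.
  by have := pi_ge2 R; lra.
rewrite mulrDr -!mulrA lerD//.
  by apply: HC => //; [exact: schwartz_partial|exact: bndS].
by case: (HD i) => _; apply.
Qed.

Lemma integrable_ijb2 (C : R) :
  (phase n).-integrable setT (EFin \o (fun z => C * (ijb z.1 * ijb z.2))).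
Proof.
have := integrable_prod (@integrable_ijb R n) (@integrable_ijb R n).
by move=> /(integrableZl measurableT C).
Qed.

Definition Iijb2 : R := \int[phase n]_z (ijb z.1 * ijb z.2).

Lemma Iijb2_ge0 : 0 <= Iijb2.
Proof. by apply: Rintegral_ge0 => x _; rewrite mulr_ge0 ?ijb_ge0. Qed.

Lemma stft_le_ijb h : schwartz h -> exists2 C : R, 0 <= C &
  forall f B, schwartz f -> bnd (2 * n) (2 * n + 2 * n) B f -> forall z,
    normc (stft h f z) <= C * B * (ijb z.1 * ijb z.2).
Proof.
move=> hS; have [C C0 HC] := stft_decay (2 * n)%N (2 * n)%N hS; exists C => //.
move=> f B fS fB z; rewrite (mulrC (ijb z.1)) mulrA.
apply: le_ijb; first exact: normc_ge0.
apply: le_ijb; first by rewrite mulr_ge0 ?jbX_ge0 ?normc_ge0.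
exact: (HC f B fS fB z).
Qed.

Lemma schwartz_S0 f : schwartz f -> S0 f.
Proof.
move=> fS; split; first exact: schwartz_square_integrable.
have [B fB] := schwartz_bnd (2 * n) (2 * n + 2 * n) fS.
have [C C0 HC] := stft_le_ijb (@schwartz_gaussian R n).
have mV := cmeas_stft (schwartz_cmeas fS) (schwartz_cmeas (@schwartz_gaussian R n)).
exact: (cint_normc (cint_dom mV (integrable_ijb2 (C * B)) (HC f B fS fB))).
Qed.

(** The Schwartz space embeds continuously in [S0]; this bound makes all the
later arguments on functionals quantitative. *)
Lemma S0norm_le : exists2 C : R, 0 <= C &
  forall f B, schwartz f -> bnd (2 * n) (2 * n + 2 * n) B f ->
    (S0norm f <= (C * B)%:E)%E.
Proof.
have [C C0 HC] := stft_le_ijb (@schwartz_gaussian R n).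
exists (C * Iijb2); first by rewrite mulr_ge0 ?Iijb2_ge0.
move=> f B fS fB.
have mV := cmeas_stft (schwartz_cmeas fS) (schwartz_cmeas (@schwartz_gaussian R n)).
have i1 := integrable_ijb2 (C * B).
have -> : (C * Iijb2 * B)%:E = (\int[phase n]_z (C * B * (ijb z.1 * ijb z.2))%:E)%E.
  have -> : C * Iijb2 * B = (C * B) * Iijb2 by ring.
  rewrite /Iijb2 -RintegralZl//.
    by rewrite /Rintegral fineK//; exact: integrable_fin_num.
  exact: (integrable_prod (@integrable_ijb R n) (@integrable_ijb R n)).
apply: ge0_le_integral => //.
- by move=> z _; rewrite lee_fin normc_ge0.
- by apply/measurable_EFinP; exact: measurable_normc.
- by apply: measurable_int i1.
- by move=> z _; rewrite lee_fin; exact: HC.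
Qed.

End stft_schwartz.

(** The weight of the class pairs the coordinates [(x, w)] and [(u, v)], while
decay is known in [(x, u)] and [(w, v)]; both are dominated by the product
of the weights in all variables. *)
Lemma vweight_le (s : R) d (x u w v : 'rV[R]_d) (N : nat) : 0 <= s -> s <= N%:R ->
  vweight s (x, w) * vweight s (u, v) <= (jb (row_mx x u) * jb (row_mx w v)) ^+ (2 * N).
Proof.
move=> s0 sN.
have H (a b : 'rV[R]_d) c e : jb a <= jb c -> jb b <= jb e ->
    vweight s (a, b) <= (jb c * jb e :> R) ^+ N.
  move=> ac be.
  have b1 : 1 <= 1 + dotv a a + dotv b b.
    by have := dotvv_ge0 a; have := dotvv_ge0 b; lra.
  have ce0 : 0 <= (jb c * jb e) ^+ 2 by rewrite sqr_ge0.
  apply: (@le_trans _ _ (((jb c * jb e) ^+ 2) `^ (s / 2))).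
    rewrite ge0_ler_powR ?nnegrE ?divr_ge0//; first by lra.
    apply: (@le_trans _ _ ((1 + dotv a a) * (1 + dotv b b))).
      by have := dotvv_ge0 a; have := dotvv_ge0 b; nra.
    rewrite exprMn; apply: ler_pM; rewrite ?addr_ge0 ?dotvv_ge0//.
      by rewrite (le_trans (dotv_jb a))// lerXn2r ?nnegrE ?jb_ge0.
    by rewrite (le_trans (dotv_jb b))// lerXn2r ?nnegrE ?jb_ge0.
  have j1 : 1 <= jb c * jb e by rewrite mulr_ege1 ?jb_ge1.
  rewrite -powR_mulrn ?(le_trans ler01)// -powRrM mulrCA mulfV// mulr1.
  rewrite -[leRHS]powR_mulrn ?(le_trans ler01)//.
  by rewrite ler_powR.
rewrite mul2n -addnn exprD; apply: ler_pM; rewrite ?powR_ge0//; apply: H.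
- exact: jb_row_mxl.
- exact: jb_row_mxl.
- exact: jb_row_mxr.
- exact: jb_row_mxr.
Qed.

End schwartz_stft.

(** * Superpositions of time-frequency shifts *)

Section parametric_integrals.
Context {R : realType}.
Notation lam := (@lebesgue_rV R).
Notation phase n := (@phase_measure R n).

(** Differentiation under the integral sign; dominating the Taylor remainders
instead of the derivatives avoids any limit. *)
Lemma param_cdiff d (T : measurableType d) (mu : {measure set T -> \bar R}) n
    (F : T -> 'rV[R]_n -> R[i]) (D : 'I_n -> T -> 'rV[R]_n -> R[i]) (G : T -> R) :
  (forall x, cint mu (F ^~ x)) -> (forall i x, cint mu (D i ^~ x)) ->
  mu.-integrable setT (EFin \o G) ->
  (forall t x h, l1 h <= 1 -> normc (rem (F t) (D ^~ t) x h) <= G t * l1 h ^+ 2) ->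
  cdiff (fun x => Cintegral mu (F ^~ x)) (fun i x => Cintegral mu (D i ^~ x)).
Proof.
move=> iF iD iG FG.
apply: (@quad_cdiff _ _ _ _ (2 * \int[mu]_t G t)) => x h h1.
have iS i : cint mu (fun t => (h ord0 i)%:C * D i t x) by exact: cintZ.
have -> : rem (fun x => Cintegral mu (F ^~ x)) (fun i x => Cintegral mu (D i ^~ x)) x h =
    Cintegral mu (fun t => rem (F t) (D ^~ t) x h).
  rewrite /rem CintegralB; last 2 first.
  - by apply: cintD => //; exact: cintN.
  - exact: cint_sum.
  rewrite CintegralB// Cintegral_sum//; congr (_ - _).
  by apply: eq_bigr => i _; rewrite CintegralZ.
have mr : cmeas (fun t => rem (F t) (D ^~ t) x h).
  apply: (@cint_cmeas _ _ _ mu); apply: cintD; first by apply: cintD => //; exact: cintN.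
  by apply: cintN; exact: cint_sum.
have iG2 := integrableZl measurableT (l1 h ^+ 2) iG.
have E : (fun t => l1 h ^+ 2 * G t) = (fun t => G t * l1 h ^+ 2).
  by apply/funext => t; rewrite mulrC.
rewrite -mulrA -[X in 2 * X]RintegralZr//.
apply: normc_Cintegral => //; last by move=> t; exact: FG.
by rewrite -E.
Qed.

(** The Taylor remainder of a product of a phase and a function, given the
remainder of the function. *)
Lemma normc_cisM_rem (E v' v dv : R[i]) (s : R) : normc E = 1 ->
  normc (E * cis s * v' - E * v - (E * dv + 'i%C * s%:C * E * v)) <=
  normc (v' - v - dv) + 2 * `|s| * normc dv + 2 * s ^+ 2 * normc v.
Proof.
move=> E1.
have -> : E * cis s * v' - E * v - (E * dv + 'i%C * s%:C * E * v) =
  E * ((cis s * (v' - v - dv) + (cis s - 1) * dv) + (cis s - 1 - 'i%C * s%:C) * v).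
  by ring.
rewrite normcM E1 mul1r (le_trans (normcD _ _))// lerD//.
  rewrite (le_trans (normcD _ _))// normcM normc_cis mul1r lerD// normcM.
  by rewrite ler_wpM2r ?normc_ge0// normc_cisB1.
by rewrite normcM ler_wpM2r ?normc_ge0// normc_cisB2.
Qed.

Lemma normc_dsum n (h : 'rV[R]_n) (D : 'I_n -> R[i]) B : (forall i, normc (D i) <= B) ->
  normc (\sum_i (h ord0 i)%:C * D i) <= B * l1 h.
Proof.
move=> DB; apply: (le_trans (normc_sum _ _ _)); rewrite mulr_sumr; apply: ler_sum => i _.
by rewrite normcM normc_real mulrC ler_wpM2r.
Qed.

Section synthesis.
Context {n : nat}.
Implicit Types (V : 'rV[R]_n * 'rV[R]_n -> R[i]) (f : 'rV[R]_n -> R[i]).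

(** What membership in all the classes [M1 s] says of a short-time Fourier
transform. *)
Definition all_weights V := cmeas V /\ forall N : nat, (phase n).-integrable setT
  (EFin \o (fun z => (jb z.1 * jb z.2) ^+ N * normc (V z))).

(** The superposition of the time-frequency shifts of [f] with coefficients [V];
up to a factor, it inverts the short-time Fourier transform. *)
Definition synth V f (t : 'rV[R]_n) : R[i] := Cintegral (phase n)
  (fun z => V z * cis (2 * pi * dotv t z.2) * f (t - z.1)).

Lemma cmeas_synth_slice V f t : cmeas V -> cmeas f ->
  cmeas (fun z => V z * cis (2 * pi * dotv t z.2) * f (t - z.1)).
Proof.
move=> mV mf; apply: cmeasM; first apply: cmeasM => //.
  apply: cmeas_cis; apply: measurable_funM => //.
  by apply: measurable_dotv => //; exact: measurable_snd.
apply: (@cmeas_comp R _ _ _ _ (fun z : 'rV[R]_n * 'rV[R]_n => t - z.1) _ mf).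
by apply: measurable_rVB => //; exact: measurable_fst.
Qed.

Lemma all_weights_freq V i : all_weights V ->
  all_weights (fun z => 'i%C * (2 * pi * z.2 ord0 i)%:C * V z).
Proof.
move=> [mV wV]; split.
  apply: cmeasM => //; apply: cmeasM; first exact: cmeas_cst.
  apply: cmeas_real; apply: measurable_funM => //.
  by apply: measurable_rV_comp; exact: measurable_snd.
move=> N; have := integrableZl measurableT (2 * pi) (wV N.+1).
apply: le_integrable => //.
  apply/measurable_EFinP; apply: measurable_funM.
    apply: measurable_funX; apply: measurable_funM; apply: measurable_jb.
      exact: measurable_fst.
    exact: measurable_snd.
  apply: measurable_normc; apply: cmeasM => //; apply: cmeasM; first exact: cmeas_cst.
  apply: cmeas_real; apply: measurable_funM => //.
  by apply: measurable_rV_comp; exact: measurable_snd.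
move=> z _; rewrite /= lee_fin ger0_norm; last first.
  by rewrite mulr_ge0 ?exprn_ge0 ?mulr_ge0 ?jb_ge0 ?normc_ge0.
rewrite ger0_norm; last first.
  by rewrite !mulr_ge0 ?pi_ge0 ?exprn_ge0 ?mulr_ge0 ?jb_ge0 ?normc_ge0.
rewrite !normcM normc_i mul1r normc_real !normrM (ger0_norm (pi_ge0 R)) ger0_norm//.
rewrite exprS [leRHS](_ : _ = (jb z.1 * jb z.2) ^+ N *
  (2 * pi * (jb z.1 * jb z.2) * normc (V z))); last by ring.
rewrite ler_wpM2l ?exprn_ge0 ?mulr_ge0 ?jb_ge0// ler_wpM2r ?normc_ge0//.
rewrite ler_wpM2l ?mulr_ge0 ?pi_ge0// (le_trans (coord_jb _ _))//.
by rewrite ler_peMl ?jb_ge0 ?jb_ge1.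
Qed.

Lemma all_weights_int V : all_weights V ->
  (phase n).-integrable setT (EFin \o (fun z => normc (V z))).
Proof. by move=> [_ /(_ 0%N)]; under eq_fun do rewrite expr0 mul1r. Qed.

Lemma cint_synth_slice V f t C : cmeas V -> cmeas f ->
  (phase n).-integrable setT (EFin \o (fun z => normc (V z))) ->
  (forall x, normc (f x) <= C) ->
  cint (phase n) (fun z => V z * cis (2 * pi * dotv t z.2) * f (t - z.1)).
Proof.
move=> mV mf iV fC.
apply: (cint_dom (cmeas_synth_slice t mV mf) (integrableZl measurableT C iV)) => z.
by rewrite !normcM normc_cis mulr1 mulrC ler_wpM2r ?normc_ge0.
Qed.

(** A derivative falls on the phase, where it multiplies [V] by a frequency, or
on the window. *)
Lemma cdiff_synth V f : all_weights V -> schwartz f ->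
  cdiff (synth V f) (fun i t =>
    1 * synth (fun z => 'i%C * (2 * pi * z.2 ord0 i)%:C * V z) f t +
    synth V (partialC i f) t).
Proof.
move=> wV fS; have [B fB] := schwartz_bnd 2 0 fS; have B0 := bnd_ge0 fB.
have mf := schwartz_cmeas fS; have iV := all_weights_int wV.
have mp i := schwartz_cmeas (schwartz_partial i fS).
have c1 t : cint (phase n) (fun z => V z * cis (2 * pi * dotv t z.2) * f (t - z.1)).
  by apply: (@cint_synth_slice V _ t B) => //; [case: wV|move=> x; exact: bnd_normc fB].
have c2 i t : cint (phase n) (fun z => ('i%C * (2 * pi * z.2 ord0 i)%:C * V z) *
    cis (2 * pi * dotv t z.2) * f (t - z.1)).
  have wV' := all_weights_freq i wV.
  apply: (@cint_synth_slice _ f t B) => //; first by case: wV'.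
    exact: all_weights_int.
  by move=> x; exact: bnd_normc fB.
have c3 i t : cint (phase n) (fun z => V z * cis (2 * pi * dotv t z.2) *
    partialC i f (t - z.1)).
  apply: (@cint_synth_slice V _ t B) => //; first by case: wV.
  by move=> x; exact: bnd_normc (bndS i fB).
pose F z t := V z * cis (2 * pi * dotv t z.2) * f (t - z.1).
pose D (i : 'I_n) (z : 'rV[R]_n * 'rV[R]_n) (t : 'rV[R]_n) := ('i%C * (2 * pi * z.2 ord0 i)%:C * V z) *
    cis (2 * pi * dotv t z.2) * f (t - z.1) +
    V z * cis (2 * pi * dotv t z.2) * partialC i f (t - z.1).
(* The three terms of the bound for a product of a phase and a function. *)
pose K := 16 * B + 4 * pi * B + 8 * pi ^+ 2 * B.
have iG : (phase n).-integrable setT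
    (EFin \o (fun z => K * ((jb z.1 * jb z.2) ^+ 2 * normc (V z)))).
  exact: (integrableZl measurableT K (wV.2 2)).
have := @param_cdiff _ _ (phase n) n F D
  (fun z => K * ((jb z.1 * jb z.2) ^+ 2 * normc (V z))) c1 _ iG _.
move=> H; have {}H : cdiff (synth V f) (fun i x => Cintegral (phase n) ((D i)^~ x)).
  apply: H; first by move=> i x; apply: cintD.
  move=> z x h h1.
  pose E := cis (2 * pi * dotv x z.2).
  pose s := 2 * pi * dotv h z.2.
  pose dv := \sum_i (h ord0 i)%:C * partialC i f (x - z.1).
  have -> : rem (F z) (D^~ z) x h = V z * (E * cis s * f (x + h - z.1) -
      E * f (x - z.1) - (E * dv + 'i%C * s%:C * E * f (x - z.1))).
    rewrite /rem /F /D.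
    have -> : cis (2 * pi * dotv (x + h) z.2) = E * cis s.
      by rewrite -cisD dotvDl mulrDr.
    rewrite -/E.
    have -> : \sum_i (h ord0 i)%:C * ('i%C * (2 * pi * z.2 ord0 i)%:C * V z * E *
        f (x - z.1) + V z * E * partialC i f (x - z.1)) =
        V z * (E * dv + 'i%C * s%:C * E * f (x - z.1)).
      rewrite [s%:C](_ : _ = \sum_i (h ord0 i)%:C * (2 * pi * z.2 ord0 i)%:C); last first.
        rewrite /s /dotv mulr_sumr rmorph_sum/=; apply: eq_bigr => i _.
        by rewrite -rmorphM/=; congr (_%:C); ring.
      rewrite /dv !(mulr_sumr, mulr_suml) -big_split/= mulr_sumr.
      by apply: eq_bigr => i _; ring.
    by ring.
  rewrite normcM.
  have E1 : normc E = 1 by exact: normc_cis.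
  apply: (@le_trans _ _ (normc (V z) * (K * jb z.2 ^+ 2 * l1 h ^+ 2))).
    rewrite ler_wpM2l ?normc_ge0// (le_trans (normc_cisM_rem _ _ _ _ E1))//.
    have j1 := jb_ge1 z.2; have l0 := l1_ge0 h.
    have r1 : normc (f (x + h - z.1) - f (x - z.1) - dv) <= 16 * B * l1 h ^+ 2.
      have := schwartz_taylor (x - z.1) fS fB h1.
      rewrite expr0 mul1r mulr1 /rem => H; rewrite (addrAC x h).
      apply: le_trans H _.
      have := mulr_ge0 B0 (sqr_ge0 (l1 h)); lra.
    have r2 : normc dv <= B * l1 h.
      by apply: normc_dsum => i; exact: bnd_normc (bndS i fB).
    have r3 : normc (f (x - z.1)) <= B by exact: bnd_normc fB.
    have r4 : `|s| <= 2 * pi * (l1 h * jb z.2).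
      rewrite normrM ger0_norm ?mulr_ge0 ?pi_ge0// ler_wpM2l ?mulr_ge0 ?pi_ge0//.
      by rewrite (le_trans (normr_dotv _ _))// ler_wpM2l// l1_jb.
    have p0 := pi_ge0 R.
    have r5 : s ^+ 2 <= (2 * pi * (l1 h * jb z.2)) ^+ 2.
      by rewrite -(real_normK (num_real s)) lerXn2r ?nnegrE ?mulr_ge0 ?jb_ge0.
    have jb2 : jb z.2 <= jb z.2 ^+ 2 by rewrite expr2 ler_peMl ?jb_ge0.
    have jb1 : 1 <= jb z.2 ^+ 2 by exact: jbX_ge1.
    have e1 : normc (f (x + h - z.1) - f (x - z.1) - dv) <=
        (16 * B) * jb z.2 ^+ 2 * l1 h ^+ 2.
      apply: (le_trans r1); rewrite ler_wpM2r ?sqr_ge0// ler_peMr ?mulr_ge0//.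
    have e2 : 2 * `|s| * normc dv <= (4 * pi * B) * jb z.2 ^+ 2 * l1 h ^+ 2.
      apply: (@le_trans _ _ (2 * (2 * pi * (l1 h * jb z.2)) * (B * l1 h))).
        by apply: ler_pM; rewrite ?mulr_ge0 ?normc_ge0// ler_wpM2l.
      have -> : 2 * (2 * pi * (l1 h * jb z.2)) * (B * l1 h) =
        (4 * pi * B) * jb z.2 * l1 h ^+ 2 by ring.
      by rewrite ler_wpM2r ?sqr_ge0// ler_wpM2l// !mulr_ge0.
    have e3 : 2 * s ^+ 2 * normc (f (x - z.1)) <= (8 * pi ^+ 2 * B) * jb z.2 ^+ 2 * l1 h ^+ 2.
      apply: (@le_trans _ _ (2 * (2 * pi * (l1 h * jb z.2)) ^+ 2 * B)).
        apply: ler_pM; [by rewrite mulr_ge0 ?sqr_ge0|exact: normc_ge0| |exact: r3].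
        by rewrite ler_wpM2l.
      by rewrite le_eqVlt; apply/orP; left; apply/eqP; ring.
    by rewrite /K; lra.
  rewrite [leRHS](_ : _ = normc (V z) * (K * ((jb z.1 * jb z.2) ^+ 2) * l1 h ^+ 2)); last by ring.
  have K0 : 0 <= K by rewrite !addr_ge0// !mulr_ge0 ?sqr_ge0 ?pi_ge0.
  rewrite ler_wpM2l ?normc_ge0// ler_wpM2r ?sqr_ge0// ler_wpM2l// exprMn.
  by rewrite ler_peMl ?jbX_ge0 ?jbX_ge1.
apply: (cdiff_ext H) => // i x.
by rewrite mul1r /D CintegralD.
Qed.

Lemma rapid_synth V f : all_weights V -> schwartz f -> rapid (synth V f).
Proof.
move=> wV fS k; have [B fB] := schwartz_bnd 0 k fS; have B0 := bnd_ge0 fB.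
have mf := schwartz_cmeas fS; have [mV iV] := wV.
exists (2 * \int[phase n]_z (B * ((jb z.1 * jb z.2) ^+ k * normc (V z)))) => t.
have j0 : 0 < jb t ^+ k by exact: lt_le_trans (jbX_ge1 t k).
have -> : jb t ^+ k * normc (synth V f t) = normc ((jb t ^+ k)%:C * synth V f t).
  by rewrite normcM normc_real ger0_norm// ltW.
have [B' fB'] := schwartz_bnd 0 0 fS.
rewrite -CintegralZ; last first.
  apply: (@cint_synth_slice V f t B') => //; first exact: all_weights_int.
  by move=> x; exact: bnd_normc fB'.
apply: normc_Cintegral.
- by apply: cmeasM; [exact: cmeas_cst|exact: cmeas_synth_slice].
- exact: (integrableZl measurableT B (iV k)).
- move=> z; rewrite !normcM normc_cis mulr1 normc_real (ger0_norm (ltW j0)).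
  apply: (@le_trans _ _ ((jb z.1 ^+ k * normc (V z)) * (jb (t - z.1) ^+ k * normc (f (t - z.1))))).
    rewrite [leRHS](_ : _ = (jb z.1 * jb (t - z.1)) ^+ k * (normc (V z) * normc (f (t - z.1)))).
      rewrite ler_wpM2r ?mulr_ge0 ?normc_ge0// lerXn2r ?nnegrE ?mulr_ge0 ?jb_ge0//.
      by rewrite -{1}(subrK z.1 t) mulrC jbD.
    by rewrite exprMn; ring.
  rewrite mulrC; apply: ler_pM; rewrite ?mulr_ge0 ?jbX_ge0 ?normc_ge0//.
    exact: (bnd0 fB).
  rewrite ler_wpM2r ?normc_ge0// exprMn ler_peMr ?jbX_ge0 ?jbX_ge1//.
Qed.

(** Coefficients with all weights give superpositions with all derivatives, each
of which is again of this form. *)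
Lemma schwartz_synth V f : all_weights V -> schwartz f -> schwartz (synth V f).
Proof.
move=> wV fS.
pose P := [set g | exists V f, [/\ all_weights V, schwartz f & g = synth V f]].
have H : span P `<=` @schwartz R n; last by apply: H; apply: span_base; exists V, f.
apply: schwartz_coind => _ [U [h [wU hS ->]]]; split; first exact: rapid_synth.
eexists; first exact: cdiff_synth.
move=> i; apply: span_lin; apply: span_base.
  exists (fun z : 'rV[R]_n * 'rV[R]_n => 'i%C * (2 * pi * z.2 ord0 i)%:C * U z), h; split => //.
  exact: all_weights_freq.
by exists U, (partialC i h); split => //; exact: schwartz_partial.
Qed.

End synthesis.
End parametric_integrals.

(** * Partial Fourier transforms *)

Section partial_fourier.
Context {R : realType}.
Notation lam := (@lebesgue_rV R).
Notation phase n := (@phase_measure R n).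

Section sections.
Context {m n : nat}.
Implicit Type f : 'rV[R]_(m + n) -> R[i].

Lemma row_mx_section (x : 'rV[R]_m) (p : 'rV[R]_n) :
  row_mx x p = p *m row_mx 0 1%:M + row_mx x 0.
Proof. by rewrite mul_mx_row mulmx0 mulmx1 add_row_mx add0r addr0. Qed.

Lemma schwartz_section f x : schwartz f -> schwartz (fun p => f (row_mx x p)).
Proof.
move=> fS.
have -> : (fun p : 'rV[R]_n => f (row_mx x p)) =
    (fun p => f (p *m row_mx 0 1%:M + row_mx x 0)).
  by apply/funext => p; rewrite row_mx_section.
apply: schwartz_aff => //; exists 1 => p.
by rewrite -row_mx_section mul1r jb_row_mxr.
Qed.

Lemma cdiff_section f D x : cdiff f D ->
  cdiff (fun p => f (row_mx x p)) (fun j p => D (rshift m j) (row_mx x p)).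
Proof.
move=> /(cdiff_aff (row_mx 0 1%:M) (row_mx x 0))/cdiff_ext; apply => [p|j p].
  by rewrite -row_mx_section.
rewrite -row_mx_section big_split_ord/= big1 ?add0r; last first.
  by move=> k _; rewrite row_mxEl mxE mul0r.
rewrite (bigD1 j)//= row_mxEr mxE eqxx mul1r big1 ?addr0// => k kj.
by rewrite row_mxEr mxE eq_sym (negbTE kj) mul0r.
Qed.

(** The Fourier transform in the last [n] variables, with the sign that occurs
in Weyl quantisation. *)
Definition pft f (u : 'rV[R]_(m + n)) : R[i] := Cintegral (lam n)
  (fun p => cis (2 * pi * dotv p (rsubmx u)) * f (row_mx (lsubmx u) p)).

Lemma cis2pi (p w : 'rV[R]_n) : cis (2 * pi * dotv p w) = cis (dotv p ((2 * pi) *: w)).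
Proof. by rewrite dotvZr. Qed.

Lemma schwartz_pft_slice f u : schwartz f ->
  schwartz (fun p => cis (2 * pi * dotv p (rsubmx u)) * f (row_mx (lsubmx u) p)).
Proof.
move=> fS; have := schwartz_cis ((2 * pi) *: rsubmx u) (schwartz_section (lsubmx u) fS).
by under eq_fun do rewrite -cis2pi.
Qed.

Lemma schwartz_coordM f k : schwartz f -> schwartz (fun v => (v ord0 k)%:C * f v).
Proof. by move=> fS; exact: schwartz_poly (poly_coord k) fS. Qed.

Lemma schwartz_ipiM f k : schwartz f ->
  schwartz (fun v => 'i%C * (2 * pi * v ord0 k)%:C * f v).
Proof.
move=> fS; have := schwartzZ ('i%C * (2 * pi)%:C) (schwartz_coordM k fS).
by under eq_fun do rewrite mulrA -(mulrA 'i%C) -rmorphM.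
Qed.

Lemma pftZ a f u : schwartz f -> pft (fun v => a * f v) u = a * pft f u.
Proof.
move=> fS; rewrite /pft -CintegralZ; last exact/schwartz_cint/schwartz_pft_slice.
by congr Cintegral; apply/funext => p; ring.
Qed.

Lemma pft_ibp f j u : schwartz f ->
  pft (partialC (rshift m j) f) u = - ('i%C * (2 * pi * rsubmx u ord0 j)%:C * pft f u).
Proof.
move=> fS; have pS := schwartz_partial (rshift m j) fS.
have := Cintegral_partialC j (schwartz_pft_slice u fS).
have -> : partialC j (fun p => cis (2 * pi * dotv p (rsubmx u)) * f (row_mx (lsubmx u) p)) =
    fun p => 'i%C * (2 * pi * rsubmx u ord0 j)%:C *
      (cis (2 * pi * dotv p (rsubmx u)) * f (row_mx (lsubmx u) p)) +
      cis (2 * pi * dotv p (rsubmx u)) * partialC (rshift m j) f (row_mx (lsubmx u) p).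
  apply/funext => p.
  have := cdiffM (cdiff_cis ((2 * pi) *: rsubmx u))
    (cdiff_section (lsubmx u) (schwartz_cdiff fS)).
  have -> : (fun p => cis (dotv p ((2 * pi) *: rsubmx u)) * f (row_mx (lsubmx u) p)) =
      (fun p => cis (2 * pi * dotv p (rsubmx u)) * f (row_mx (lsubmx u) p)).
    by apply/funext => q; rewrite cis2pi.
  by move=> /(_ p)[_ _ ->]; rewrite -cis2pi mxE mulrA.
have c1 := schwartz_cint (schwartz_pft_slice u fS).
rewrite CintegralD; [|exact: cintZ|exact/schwartz_cint/schwartz_pft_slice].
by rewrite CintegralZ// addrC => /eqP; rewrite addr_eq0 => /eqP.
Qed.

Lemma pft_bound f : schwartz f -> exists C, forall u, normc (pft f u) <= C.
Proof.
move=> fS; have [B fB] := schwartz_bnd 0 (2 * n) fS.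
exists (2 * B * Iijb n) => u; apply: normc_Cintegral_ijb.
  exact/schwartz_cmeas/schwartz_pft_slice.
move=> p; rewrite normcM normc_cis mul1r; apply: le_ijb; first exact: normc_ge0.
apply: le_trans (bnd0 fB (row_mx (lsubmx u) p)).
by rewrite ler_wpM2r ?normc_ge0// lerXn2r ?nnegrE ?jb_ge0 ?jb_row_mxr.
Qed.

(** Weights in the first variables commute with the transform; those in the last
ones become derivatives. *)
Lemma rapid_pft f : schwartz f -> rapid (pft f).
Proof.
move=> fS k; elim: k f fS => [|k IH] f fS.
  by have [C HC] := pft_bound fS; exists C => u; rewrite expr0 mul1r.
have [C HC] := IH f fS.
have /choice[A HA] i : exists A, forall u,
    jb u ^+ k * normc (pft (fun v => (v ord0 (lshift n i))%:C * f v) u) <= A.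
  exact/IH/schwartz_coordM.
have /choice[B HB] j : exists B, forall u,
    jb u ^+ k * normc (pft (partialC (rshift m j) f) u) <= B.
  exact/IH/schwartz_partial.
exists (C + (\sum_i A i + \sum_j B j)) => u.
pose X := normc (pft f u); rewrite -/X.
rewrite exprSr -mulrA {2}/jb mulrDl mul1r mulrDr lerD//.
rewrite /l1 big_split_ord/= mulrDl mulrDr !mulr_suml !mulr_sumr.
apply: lerD; apply: ler_sum => i _.
  apply: le_trans (HA i u); rewrite ler_wpM2l ?jbX_ge0//.
  rewrite /X -(normc_real (u ord0 _)) -normcM /pft -CintegralZ; last first.
    exact/schwartz_cint/schwartz_pft_slice.
  rewrite le_eqVlt; apply/orP; left; apply/eqP; congr (normc (Cintegral _ _)).
  by apply/funext => p; rewrite row_mxEl mxE; ring.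
apply: le_trans (HB i u); rewrite ler_wpM2l ?jbX_ge0// /X pft_ibp// normcN !normcM.
rewrite normc_i mul1r normc_real mxE ler_wpM2r ?normc_ge0//.
rewrite normrM ler_peMl// ger0_norm ?mulr_ge0 ?pi_ge0//.
by have := pi_ge2 R; lra.
Qed.

Lemma cdiff_pft f : schwartz f -> cdiff (pft f) (fun i => match fintype.split i with
  | inl a => pft (partialC (lshift n a) f)
  | inr b => pft (fun v => 'i%C * (2 * pi * v ord0 (rshift m b))%:C * f v) end).
Proof.
move=> fS; have [B fB] := schwartz_bnd 2 (2 * n + 2) fS; have B0 := bnd_ge0 fB.
pose F (p : 'rV[R]_n) (u : 'rV[R]_(m + n)) :=
  cis (2 * pi * dotv p (rsubmx u)) * f (row_mx (lsubmx u) p).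
pose D (i : 'I_(m + n)) (p : 'rV[R]_n) (u : 'rV[R]_(m + n)) :=
  cis (2 * pi * dotv p (rsubmx u)) *
  match fintype.split i with
  | inl a => partialC (lshift n a) f (row_mx (lsubmx u) p)
  | inr b => 'i%C * (2 * pi * p ord0 b)%:C * f (row_mx (lsubmx u) p) end.
(* Two more powers of decay than integrability needs: the phase contributes
up to [jb p ^+ 2]. *)
pose k := (2 * n + 2)%N.
pose K := 4 * 2 ^+ k * B + 4 * pi * B + 8 * pi ^+ 2 * B.
have cD i u : cint (lam n) (D i ^~ u).
  rewrite /D; case: fintype.split => a.
    exact/schwartz_cint/schwartz_pft_slice/schwartz_partial.
  have := schwartz_cint (schwartz_pft_slice u (schwartz_ipiM (rshift m a) fS)).
  by under eq_fun do rewrite row_mxEr.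
have := @param_cdiff R _ _ (lam n) (m + n) F D (fun p => K * ijb p) _ cD
  (integrable_ijbZ n K) _.
move=> H; have {H} : cdiff (pft f) (fun i x => Cintegral (lam n) (D i ^~ x)).
  apply: H; first by move=> u; exact/schwartz_cint/schwartz_pft_slice.
  move=> p u h h1.
  pose a := lsubmx h; pose b := rsubmx h.
  have hE : l1 h = l1 a + l1 b by rewrite -l1_row_mx hsubmxK.
  have la : l1 a <= l1 h by rewrite hE lerDl l1_ge0.
  have lb : l1 b <= l1 h by rewrite hE lerDr l1_ge0.
  pose E := cis (2 * pi * dotv p (rsubmx u)).
  pose s := 2 * pi * dotv p b.
  pose y := row_mx (lsubmx u) p.
  pose dv := \sum_i (a ord0 i)%:C * partialC (lshift n i) f y.
  have -> : rem (F p) (D^~ p) u h = E * cis s * f (row_mx (lsubmx (u + h)) p) -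
      E * f y - (E * dv + 'i%C * s%:C * E * f y).
    rewrite /rem /F -/y -/E.
    have -> : cis (2 * pi * dotv p (rsubmx (u + h))) = E * cis s.
      by rewrite linearD/= dotvDr mulrDr cisD.
    congr (_ - _); rewrite big_split_ord/=; congr (_ + _).
      rewrite /dv mulr_sumr; apply: eq_bigr => i _.
      rewrite /D -/E -/y (_ : fintype.split (lshift n i) = inl i); last by rewrite (unsplitK (inl i)).
      by rewrite mxE; ring.
    rewrite /s /dotv mulr_sumr rmorph_sum/= !(mulr_sumr, mulr_suml).
    apply: eq_bigr => i _.
    rewrite /D -/E -/y (_ : fintype.split (rshift m i) = inr i); last by rewrite (unsplitK (inr i)).
    rewrite /b mxE (_ : (2 * pi * (p ord0 i * h ord0 (rshift m i)))%:C =
        (h ord0 (rshift m i))%:C * (2 * pi * p ord0 i)%:C); last first.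
      by rewrite -rmorphM/=; congr (_%:C); ring.
    by ring.
  have E1 : normc E = 1 by exact: normc_cis.
  have jpy : jb p <= jb y by exact: jb_row_mxr.
  have y1 := jb_ge1 y.
  have W (X C : R) : 0 <= X -> jb y ^+ k * X <= C -> jb p ^+ 2 * X <= C * ijb p.
    move=> X0 XC; apply: le_ijb; first by rewrite mulr_ge0 ?jbX_ge0.
    rewrite mulrA -exprD; apply: le_trans XC; rewrite ler_wpM2r//.
    by rewrite lerXn2r ?nnegrE ?jb_ge0.
  have W0 (X C : R) : 0 <= X -> jb y ^+ k * X <= C -> X <= C * ijb p.
    by move=> X0 /(W _ _ X0); apply: le_trans; rewrite ler_peMl ?jbX_ge1.
  have lrow : l1 (row_mx a 0 : 'rV[R]_(m + n)) = l1 a.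
    by rewrite l1_row_mx [X in _ + X](_ : _ = 0) ?addr0// /l1 big1// => i _; rewrite mxE normr0.
  have a1 : l1 (row_mx a 0 : 'rV[R]_(m + n)) <= 1 by rewrite lrow (le_trans la).
  have r1 : normc (f (row_mx (lsubmx (u + h)) p) - f y - dv) <=
      4 * 2 ^+ k * B * ijb p * l1 h ^+ 2.
    have := schwartz_taylor y fS fB a1.
    have -> : rem f (fun i => partialC i f) y (row_mx a 0) =
        f (row_mx (lsubmx (u + h)) p) - f y - dv.
      rewrite /rem /y add_row_mx addr0 linearD/=; congr (_ - _).
      rewrite big_split_ord/= [X in _ + X]big1 ?addr0; last first.
        by move=> i _; rewrite row_mxEr mxE mul0r.
      by apply: eq_bigr => i _; rewrite row_mxEl.
    move=> /(W0 _ _ (normc_ge0 _)) /le_trans; apply.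
    rewrite lrow [leRHS]mulrAC ler_wpM2r ?ijb_ge0// ler_wpM2l ?mulr_ge0 ?exprn_ge0//.
    by rewrite lerXn2r ?nnegrE ?l1_ge0.
  have s4 : `|s| <= 2 * pi * (jb p * l1 h).
    rewrite normrM ger0_norm ?mulr_ge0 ?pi_ge0// ler_wpM2l ?mulr_ge0 ?pi_ge0//.
    by rewrite (le_trans (normr_dotv _ _))// ler_pM ?l1_ge0 ?l1_jb.
  have s5 : s ^+ 2 <= (2 * pi * (jb p * l1 h)) ^+ 2.
    by rewrite -(real_normK (num_real s)) lerXn2r ?nnegrE ?mulr_ge0 ?jb_ge0 ?pi_ge0 ?l1_ge0.
  have j1 := jb_ge1 p; have l0 := l1_ge0 h; have p0 := pi_ge0 R.
  have jpd : jb p * normc dv <= B * ijb p * l1 h.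
    apply: (@le_trans _ _ (jb p ^+ 2 * normc dv)).
      by rewrite ler_wpM2r ?normc_ge0// expr2 ler_peMl ?jb_ge0.
    rewrite [leRHS]mulrAC; apply: W; first exact: normc_ge0.
    have -> : jb y ^+ k * normc dv = normc (\sum_i (a ord0 i)%:C * ((jb y ^+ k)%:C * partialC (lshift n i) f y)).
      rewrite -[in LHS](ger0_norm (jbX_ge0 y k)) -normc_real -normcM /dv mulr_sumr.
      by congr normc; apply: eq_bigr => i _; ring.
    apply: (@le_trans _ _ (B * l1 a)); last by rewrite ler_wpM2l.
    apply: normc_dsum => i; rewrite normcM normc_real ger0_norm ?jbX_ge0//.
    exact: bnd0 (bndS (lshift n i) fB) y.
  have jpf : jb p ^+ 2 * normc (f y) <= B * ijb p.
    by apply: W; [exact: normc_ge0|exact: bnd0 fB y].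
  rewrite (le_trans (normc_cisM_rem _ _ _ _ E1))//.
  have e2 : 2 * `|s| * normc dv <= 4 * pi * B * ijb p * l1 h ^+ 2.
    apply: (@le_trans _ _ (4 * pi * l1 h * (jb p * normc dv))).
      rewrite [leRHS](_ : _ = 2 * (2 * pi * (jb p * l1 h)) * normc dv); last by ring.
      by rewrite ler_wpM2r ?normc_ge0// ler_wpM2l.
    rewrite [leRHS](_ : _ = 4 * pi * l1 h * (B * ijb p * l1 h)); last by ring.
    by rewrite ler_wpM2l// !mulr_ge0.
  have e3 : 2 * s ^+ 2 * normc (f y) <= 8 * pi ^+ 2 * B * ijb p * l1 h ^+ 2.
    apply: (@le_trans _ _ (8 * pi ^+ 2 * l1 h ^+ 2 * (jb p ^+ 2 * normc (f y)))).
      rewrite [leRHS](_ : _ = 2 * (2 * pi * (jb p * l1 h)) ^+ 2 * normc (f y)); last by ring.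
      by rewrite ler_wpM2r ?normc_ge0// ler_wpM2l.
    rewrite [leRHS](_ : _ = 8 * pi ^+ 2 * l1 h ^+ 2 * (B * ijb p)); last by ring.
    by rewrite ler_wpM2l// !mulr_ge0 ?sqr_ge0.
  by rewrite /K; lra.
move=> /cdiff_ext; apply => // i u.
rewrite /D /pft; case: fintype.split => c //; congr Cintegral; apply/funext => p.
by rewrite row_mxEr.
Qed.

(** The derivatives of a transform are transforms of derivatives in the first
variables and of multiples by coordinates in the last ones. *)
Lemma schwartz_pft f : schwartz f -> schwartz (pft f).
Proof.
move=> fS.
pose P := [set g | exists2 f, schwartz f & g = pft f].
have H : span P `<=` @schwartz R (m + n); last by apply: H; apply: span_base; exists f.
apply: schwartz_coind => _ [h hS ->]; split; first exact: rapid_pft.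
eexists; first exact: cdiff_pft.
move=> i; apply: span_base; case: fintype.split => a.
  by exists (partialC (lshift n a) h) => //; exact: schwartz_partial.
exists (fun v : 'rV[R]_(m + n) => 'i%C * (2 * pi * v ord0 (rshift m a))%:C * h v) => //.
exact: schwartz_ipiM.
Qed.

End sections.
End partial_fourier.

(** * The Fourier transform of the Gaussian *)

Section fourier_inversion.
Context {R : realType}.
Notation lam := (@lebesgue_rV R).

Lemma partialC_gaussian n i (x : 'rV[R]_n) :
  partialC i (@gaussian R n) x = (- (2 * pi))%:C * (x ord0 i)%:C * gaussian x.
Proof. by case: (@cdiff_gaussian R n x) => _ _ ->. Qed.

(** Along each ray the equation is solved by the integrating factor [exp (pi
|x|^2)]. *)
Lemma gaussian_ode n (u : 'rV[R]_n -> R[i]) :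
  cdiff u (fun i v => (- (2 * pi))%:C * (v ord0 i)%:C * u v) ->
  forall w, u w = u 0 * gaussian w.
Proof.
move=> du w.
have key (pr : R[i] -> R) : (forall r z, pr (r%:C * z) = r * pr z) ->
    (forall v, differentiable (fun y => pr (u y)) v) ->
    (forall v i, 'D_(delta_mx ord0 i) (fun y => pr (u y)) v =
       pr ((- (2 * pi))%:C * (v ord0 i)%:C * u v)) ->
    pr (u w) * expR (pi * dotv w w) = pr (u 0).
  move=> prZ dpr Dpr.
  pose a (s : R) := pr (u (s *: w + 0)).
  pose b (s : R) := expR (pi * dotv w w * s ^+ 2).
  have da (s : R) : is_derive s (1 : R) a (- (2 * pi) * s * dotv w w * a s).
    have := is_derive_line (dpr (s *: w + 0)).
    move=> /is_derive_eq; apply.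
    rewrite /dotv !(mulr_sumr, mulr_suml); apply: eq_bigr => i _.
    rewrite Dpr -rmorphM prZ !mxE addr0 /a; ring.
  have db (s : R) : is_derive s (1 : R) b (2 * s * (pi * dotv w w) * b s).
    have h1 : is_derive s (1 : R) (fun s : R => pi * dotv w w * s ^+ 2) (2 * s * (pi * dotv w w)).
      have -> : (fun s : R => pi * dotv w w * s ^+ 2) = (pi * dotv w w) *: (id * id : R -> R).
        by apply/funext => t; rewrite !fctE/= /GRing.scale/= expr2.
      apply: is_derive_eq; rewrite /GRing.scale/=; ring.
    have := @is_derive1_comp R expR _ s _ _ (is_derive_expR _) h1.
    by rewrite [X in is_derive _ _ _ X -> _]mulrC.
  have dab (s : R) : is_derive s (1 : R) (fun s => a s * b s) 0.
    have := @is_deriveM _ _ a b s 1 _ _ (da s) (db s).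
    move=> /is_derive_eq; apply; rewrite /GRing.scale/=; ring.
  have [c _] := mvt0 ler01 dab.
  rewrite mul0r => /eqP; rewrite subr_eq0 => /eqP.
  have a1 : a 1 = pr (u w) by rewrite /a scale1r addr0.
  have a0 : a 0 = pr (u 0).
    have e0 : 0 *: w + 0 = 0 by rewrite addr0 scale0r.
    exact: (congr1 (fun v => pr (u v)) e0).
  have b1 : b 1 = expR (pi * dotv w w) by rewrite /b expr1n mulr1.
  have b0 : b 0 = 1 by rewrite /b expr0n mulr0 expR0.
  by rewrite a1 b1 a0 b0 mulr1.
have fin (x y : R) : x * expR (pi * dotv w w) = y -> x = y * expR (- (pi * dotv w w)).
  by move=> <-; rewrite -mulrA -expRD subrr expR0 mulr1.
apply: complex_ext; rewrite ?ReM ?ImM/= !mulr0 ?subr0 ?add0r; apply: fin; apply: key.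
- by move=> r z; rewrite ReM/= mul0r subr0.
- by move=> v; case: (du v).
- by move=> v i; case: (du v) => _ _ <-.
- by move=> r z; rewrite ImM/= mul0r addr0.
- by move=> v; case: (du v).
- by move=> v i; case: (du v) => _ _ <-.
Qed.

(** The Gaussian is its own Fourier transform: both solve the same first order
equation, with the same value at the origin. *)
Lemma fourier_gaussian n (w : 'rV[R]_n) :
  Cintegral (lam n) (fun p => cis (2 * pi * dotv p w) * gaussian p) = gaussian w.
Proof.
have GS := @schwartz_gaussian R (n + n).
have Erow (p : 'rV[R]_n) : gaussian (row_mx (0 : 'rV[R]_n) p) = gaussian p.
  by rewrite /gaussian dotv_row_mx dotv0 add0r.
pose u (w : 'rV[R]_n) := pft (@gaussian R (n + n)) (row_mx 0 w).
have uE v : u v = Cintegral (lam n) (fun p => cis (2 * pi * dotv p v) * gaussian p).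
  by rewrite /u /pft row_mxKl row_mxKr; under eq_fun do rewrite Erow.
have du : cdiff u (fun i v => (- (2 * pi))%:C * (v ord0 i)%:C * u v).
  have := cdiff_section (0 : 'rV[R]_n) (cdiff_pft GS).
  move=> H; apply: (cdiff_ext H) => [v|i v]; first by [].
  rewrite (_ : fintype.split (rshift n i) = inr i); last exact: (unsplitK (inr i)).
  have -> : (fun v : 'rV[R]_(n + n) => 'i%C * (2 * pi * v ord0 (rshift n i))%:C * gaussian v) =
      (fun v => (- 'i%C) * partialC (rshift n i) (@gaussian R (n + n)) v).
    apply/funext => x; rewrite partialC_gaussian rmorphN !rmorphM; ring.
  rewrite pftZ; last exact: schwartz_partial.
  rewrite pft_ibp// row_mxKr -/(u v) rmorphN !rmorphM/= mulNr mulrN opprK !mulrA.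
  by rewrite -expr2 sqr_i; ring.
have u0 : u 0 = 1.
  rewrite uE -[RHS](@Cintegral_gaussian R n); congr Cintegral; apply/funext => p.
  by rewrite dotv0 mulr0 cis0 mul1r.
by rewrite -uE (gaussian_ode du) u0 mul1r.
Qed.

Section fixed_dimension.
Context {n : nat}.
Implicit Types (h f : 'rV[R]_n -> R[i]) (t s w : 'rV[R]_n).

(** Dilated Gaussians, an approximate identity. *)
Definition moll (e : R) (x : 'rV[R]_n) : R[i] := (e ^+ n)^-1%:C * gaussian (e^-1 *: x).

Lemma cmeas_moll e d (T : measurableType d) (x : T -> 'rV[R]_n) :
  measurable_fun setT x -> cmeas (fun y : T => moll e (x y)).
Proof.
move=> mx; apply: cmeasM; first exact: cmeas_cst.
by apply: cmeas_gaussian; exact: measurable_rVZ.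
Qed.

Lemma mollN e x : moll e (- x) = moll e x.
Proof. by rewrite /moll scalerN gaussianN. Qed.

Lemma normc_moll e x : 0 < e -> normc (moll e x) <= (e ^+ n)^-1.
Proof.
move=> e0; rewrite normcM normc_real ger0_norm ?invr_ge0 ?exprn_ge0 ?(ltW e0)//.
by rewrite ler_piMr ?invr_ge0 ?exprn_ge0 ?(ltW e0) ?normc_gaussian_le1.
Qed.

Lemma cint_bndM d (T : measurableType d) (mu : {measure set T -> \bar R})
    (u v : T -> R[i]) B : cint mu u -> cmeas v -> (forall x, normc (v x) <= B) ->
  cint mu (fun x => u x * v x).
Proof.
move=> cu mv vB.
apply: (cint_dom _ (integrableZl measurableT B (cint_normc cu))).
  by apply: cmeasM => //; exact: cint_cmeas cu.
by move=> x; rewrite normcM mulrC ler_wpM2r ?normc_ge0.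
Qed.

Lemma cmeas_cis_dotv d (T : measurableType d) (x y : T -> 'rV[R]_n) :
  measurable_fun setT x -> measurable_fun setT y ->
  cmeas (fun p : T => cis (2 * pi * dotv (x p) (y p))).
Proof.
by move=> mx my; apply: cmeas_cis; apply: measurable_funM => //; exact: measurable_dotv.
Qed.

Lemma cmeas_cisN_dotv d (T : measurableType d) (x y : T -> 'rV[R]_n) :
  measurable_fun setT x -> measurable_fun setT y ->
  cmeas (fun p : T => cis (- (2 * pi * dotv (x p) (y p)))).
Proof.
move=> mx my; apply: cmeas_cis; apply: measurableT_comp => //.
by apply: measurable_funM => //; exact: measurable_dotv.
Qed.

Lemma cmeas_gaussian_dil (e : R) : cmeas (fun w : 'rV[R]_n => gaussian (e *: w)).
Proof. by apply: cmeas_gaussian; exact: measurable_rVZ. Qed.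

Lemma cint_gaussian_dil (e : R) : 0 < e -> cint (lam n) (fun w => gaussian (e *: w)).
Proof.
move=> e0.
have H : schwartz (fun w : 'rV[R]_n => gaussian (w *m e%:M + 0)).
  apply: schwartz_aff; first exact: schwartz_gaussian.
  exists (1 + e^-1) => x; rewrite addr0 mul_mx_scalar /jb l1Z gtr0_norm//.
  rewrite mulrDl !mulrDr !mulr1 !mul1r mulKf ?gt_eqF//.
  have := l1_ge0 x; have e1 : 0 < e^-1 by rewrite invr_gt0.
  by move=> l0; have := mulr_ge0 (ltW e0) l0; lra.
have -> : (fun w : 'rV[R]_n => gaussian (e *: w)) = fun w => gaussian (w *m e%:M + 0).
  by apply/funext => w; rewrite addr0 mul_mx_scalar.
exact: schwartz_cint.
Qed.

Lemma fourier_gaussian_dil (e : R) (x : 'rV[R]_n) : 0 < e ->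
  Cintegral (lam n) (fun w => cis (2 * pi * dotv x w) * gaussian (e *: w)) = moll e x.
Proof.
move=> e0; have en : e ^+ n != 0 by rewrite expf_neq0// gt_eqF.
pose F (w : 'rV[R]_n) := cis (2 * pi * dotv w (e^-1 *: x)) * gaussian w.
have mF : cmeas F.
  apply: cmeasM; last exact: (@cmeas_gaussian _ _ _ _ id).
  by apply: cmeas_cis; apply: measurable_funM => //; exact: measurable_dotv.
have := Cintegral_aff 0 e0 mF; rewrite fourier_gaussian => H.
have cF : cint (lam n) (fun w => cis (2 * pi * dotv x w) * gaussian (e *: w)).
  under eq_fun do rewrite mulrC.
  apply: (@cint_bndM _ _ _ _ _ 1) => [||w]; first exact: cint_gaussian_dil.
    by apply: cmeas_cis_dotv => //; exact: measurable_cst.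
  by rewrite normc_cis.
rewrite /moll -H.
have -> : (fun y => (e ^+ n)%:C * F (e *: y + 0)) =
    fun w => (e ^+ n)%:C * (cis (2 * pi * dotv x w) * gaussian (e *: w)).
  apply/funext => w; rewrite /F addr0 dotvZl dotvZr dotvC.
  by rewrite (_ : e * _ = dotv x w) // mulrA mulfV ?mul1r// gt_eqF.
by rewrite CintegralZ// mulrA -rmorphM mulVf// mul1r.
Qed.

Lemma Cintegral_moll (e : R) f t : 0 < e -> cmeas f ->
  Cintegral (lam n) (fun s => f s * moll e (s - t)) =
  Cintegral (lam n) (fun y => f (e *: y + t) * gaussian y).
Proof.
move=> e0 mf; have en : e ^+ n != 0 by rewrite expf_neq0// gt_eqF.
rewrite -(Cintegral_aff t e0); last first.
  by apply: cmeasM => //; apply: cmeas_moll; exact: measurable_rVB.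
congr Cintegral; apply/funext => y.
rewrite /moll addrK scalerA mulVf ?gt_eqF// scale1r mulrCA [X in _ * X]mulrA -[X in _ * (X * _)]rmorphM.
by rewrite mulfV// mul1r.
Qed.

Definition ccont f := continuous (fun x => Re (f x)) /\ continuous (fun x => Im (f x)).

Lemma ccvg_shift f (t y : 'rV[R]_n) : ccont f ->
  ccvg (fun k => f (k.+1%:R^-1 *: y + t)) (f t).
Proof.
move=> [f1 f2].
have H : (fun k => k.+1%:R^-1 *: y + t) @ \oo --> t.
  rewrite -[X in _ --> X]add0r -(scale0r y).
  apply: cvgD; last exact: cvg_cst.
  by apply: cvgZr_tmp; exact: cvg_harmonic.
by split; [exact: (continuous_cvg _ (f1 t) H)|exact: (continuous_cvg _ (f2 t) H)].
Qed.

Lemma ccvgM u l (a : R[i]) : ccvg u l -> ccvg (fun k => u k * a) (l * a).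
Proof.
move=> [u1 u2]; split.
  under eq_fun do rewrite ReM.
  by rewrite ReM; apply: cvgB; apply: cvgMr_tmp.
under eq_fun do rewrite ImM.
by rewrite ImM; apply: cvgD; apply: cvgMr_tmp.
Qed.

(** After rescaling, the average is that of [f (t + e y)] against a fixed
Gaussian, and dominated convergence applies. *)
Lemma moll_cvg f t B : cmeas f -> ccont f -> (forall x, normc (f x) <= B) ->
  ccvg (fun k => Cintegral (lam n) (fun s => f s * moll k.+1%:R^-1 (s - t))) (f t).
Proof.
move=> mf cf fB.
have e0 k : 0 < k.+1%:R^-1 :> R by rewrite invr_gt0.
have -> : (fun k => Cintegral (lam n) (fun s => f s * moll k.+1%:R^-1 (s - t))) =
    (fun k => Cintegral (lam n) (fun y => f (k.+1%:R^-1 *: y + t) * gaussian y)).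
  by apply/funext => k; rewrite Cintegral_moll.
have cg := @cint_gaussian R n.
rewrite -[X in ccvg _ X]mulr1 -(@Cintegral_gaussian R n) -CintegralZ; last exact: cg.
have mg := cint_cmeas cg.
apply: (Cintegral_dominated_cvg (G := fun y => B * normc (gaussian y))).
- move=> k; apply: cmeasM => //; apply: (cmeas_comp mf).
  by apply: measurable_rVD => //; exact: measurable_rVZ.
- by apply: cmeasM => //; exact: cmeas_cst.
- exact: (integrableZl measurableT B (cint_normc cg)).
- by move=> k x; rewrite normcM ler_wpM2r ?normc_ge0.
- by move=> y; apply: ccvgM; exact: ccvg_shift.
Qed.

Definition fourier h w : R[i] :=
  Cintegral (lam n) (fun s => h s * cis (- (2 * pi * dotv s w))).

Definition ifourier h t : R[i] :=
  Cintegral (lam n) (fun w => h w * cis (2 * pi * dotv t w)).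

End fixed_dimension.
End fourier_inversion.

(** * Functions determined by continuous test functions *)

Section pi_lambda.
Context {R : realType} {n : nat}.
Notation lam := (@lebesgue_rV R).

(** The pi-system on which integrals can be computed by dominated convergence
from those against continuous functions. *)
Definition approximable : set (set 'rV[R]_n) :=
  [set E | measurable E /\ exists2 psi : nat -> 'rV[R]_n -> R,
    (forall k, continuous (psi k) /\ forall x, 0 <= psi k x <= 1) &
    forall x, psi ^~ x @ \oo --> (\1_E x : R)].

Lemma approximable_setI : setI_closed approximable.
Proof.
move=> A B [mA [p p01 pA]] [mB [q q01 qB]]; split; first exact: measurableI.
exists (fun k x => p k x * q k x) => [k|x].
  have [cp p1] := p01 k; have [cq q1] := q01 k; split.
    by move=> x; exact: (continuousM (cp x) (cq x)).
  move=> x; have /andP[p0 p1'] := p1 x; have /andP[q0 q1'] := q1 x.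
  by rewrite mulr_ge0//= mulr_ile1.
have -> : \1_(A `&` B) x = \1_A x * \1_B x :> R by rewrite indicI.
by apply: cvgM; [exact: pA|exact: qB].
Qed.

(** The indicator of a ray is the limit of steeper and steeper ramps. *)
Lemma approximable_ray (i : 'I_n) (c : R) :
  approximable [set x : 'rV[R]_n | c < x ord0 i].
Proof.
split.
  have := @measurable_rV_coord R n i measurableT `]c, +oo[%classic.
  rewrite setTI => /(_ (measurable_itv _)).
  rewrite (_ : _ @^-1` _ = [set x : 'rV[R]_n | c < x ord0 i])//.
  by apply/seteqP; split => x; rewrite /rV_coord /= in_itv/= andbT.
exists (fun k x => Num.min 1 (Num.max 0 (k%:R * (x ord0 i - c)))) => [k|x].
  split; last by move=> x; rewrite le_min ler01 le_max lexx/= ge_min lexx.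
  move=> x.
  have c1 : {for x, continuous (fun x : 'rV[R]_n => k%:R * (x ord0 i - c))}.
    apply: continuousM; first exact: cst_continuous.
    apply: continuousB; last exact: cst_continuous.
    exact: coord_continuous.
  have cc (a : R) : {for x, continuous (fun _ : 'rV[R]_n => a)} by exact: cst_continuous.
  exact: (@continuous_min R _ _ _ x (cc 1) (@continuous_max R _ _ _ x (cc 0) c1)).
rewrite indicE; have [xc|xc] := ltP c (x ord0 i).
  rewrite mem_set//; apply: cvg_near_cst.
  have d0 : 0 < x ord0 i - c by rewrite subr_gt0.
  exists (Num.bound (x ord0 i - c)^-1) => // k /= Hk.
  have H : 1 <= k%:R * (x ord0 i - c).
    rewrite -ler_pdivrMr// mul1r.
    apply: (le_trans (ltW (archi_boundP _))); first by rewrite invr_ge0 ltW.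
    by rewrite ler_nat.
  by rewrite max_r ?(le_trans ler01 H)// min_l.
rewrite memNset/=; last by rewrite ltNge xc.
apply: cvg_near_cst; apply: nearW => k.
rewrite max_l ?min_r ?ler01//.
by rewrite mulr_ge0_le0// subr_le0.
Qed.

Lemma measurable_approximable :
  @measurable _ 'rV[R]_n = <<s approximable >>.
Proof.
apply/seteqP; split.
  apply: smallest_sub; first exact: smallest_sigma_algebra.
  move=> A; rewrite -bigcup_seq => -[i _ [B mB <-]].
  have : @measurable_fun _ _ (g_sigma_algebraType approximable) (measurableTypeR R)
      setT (rV_coord i).
    apply: (measurability (@RGenOInfty.G R) (RGenOInfty.measurableE R)).
    move=> _ [_ [c ->] <-]; rewrite setTI; apply: sub_sigma_algebra.
    rewrite (_ : _ @^-1` _ = [set x : 'rV[R]_n | c < x ord0 i]).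
      exact: approximable_ray.
    by apply/seteqP; split => x; rewrite /rV_coord /= in_itv/= andbT.
  by move=> /(_ measurableT B mB).
apply: smallest_sub; first exact: sigma_algebra_measurable.
by move=> A [].
Qed.

(** The sets on which [u] integrates to zero form a Dynkin class, which contains
the approximable sets by dominated convergence; these form a pi-system that
generates the Borel sets, so [u] integrates to zero everywhere. *)
Lemma ae0_of_continuous (u : 'rV[R]_n -> R) :
  (lam n).-integrable setT (EFin \o u) ->
  (forall psi : 'rV[R]_n -> R, continuous psi -> (forall x, 0 <= psi x <= 1) ->
    \int[lam n]_x (psi x * u x) = 0) ->
  {ae lam n, forall x, u x = 0}.
Proof.
move=> iu u0.
have mu : measurable_fun setT u by apply/measurable_EFinP; exact: measurable_int iu.
pose P (E : set 'rV[R]_n) := (\int[lam n]_(x in E) (u x)%:E = 0)%E.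
have PT : P setT.
  have := u0 (cst 1) (@cst_continuous _ _ (1 : R)).
  rewrite /cst lexx ler01 => /(_ (fun x => isT)).
  under eq_Rintegral do rewrite mul1r.
  rewrite /Rintegral /P => h; rewrite -[LHS]fineK ?h//.
  exact: integrable_fin_num.
have H E : measurable E -> P E.
  rewrite measurable_approximable; apply: (dynkin_induction measurable_approximable) => //.
  - exact: approximable_setI.
  - move=> A [mA [p p01 pA]]; rewrite /P.
    have iA : (lam n).-integrable A (EFin \o u) by exact: integrableS iu.
    rewrite -[LHS]fineK; last exact: integrable_fin_num.
    congr EFin; rewrite -/(Rintegral _ _ _) Rintegral_mkcond.
    have pm k : measurable_fun setT (p k).
      by apply: continuous_measurable_rV; case: (p01 k).
    have cv : (fun k => \int[lam n]_x (p k x * u x)) @ \oo --> \int[lam n]_x (u \_ A) x.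
      apply: (Rintegral_dominated_cvg (G := fun x => `|u x|)).
      - by move=> k; apply: measurable_funM.
      - by apply/(measurable_restrictT u mA); exact: measurable_funS mu.
      - exact: integrable_norm iu.
      - move=> k x; case: (p01 k) => _ /(_ x) /andP[a b].
        by rewrite normrM ger0_norm// ler_piMl.
      - move=> x; rewrite patchE; have -> : (if x \in A then u x else 0) = \1_A x * u x.
          by rewrite indicE; case: ifP => _; rewrite ?mul1r ?mul0r.
        by apply: cvgMr_tmp; exact: pA.
    have E0 : (fun k => \int[lam n]_x (p k x * u x)) = fun=> 0.
      by apply/funext => k; case: (p01 k) => c b; rewrite u0.
    by move: cv; rewrite E0 => cv; exact: (cvg_unique _ cv (cvg_cst _)).
  - move=> S mS PS; rewrite /P in PS PT *.
    have iS A : measurable A -> (lam n).-integrable A (EFin \o u) by move=> mA; exact: integrableS iu.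
    have := PT; rewrite -(setUv S) integral_setU//=.
    + by rewrite PS add0e.
    + exact: measurableC.
    + by apply/measurable_EFinP; apply: measurable_funS mu.
    + by apply/disj_setPS; rewrite setICr.
  - move=> F mF tF PF; rewrite /P integral_bigcup//; last first.
      by apply: integrableS iu => //; exact: bigcup_measurable.
    by apply: eseries0 => k _ _; exact: PF.
have mc : measurable_fun setT (cst 0%E : 'rV[R]_n -> \bar R) by exact: measurable_cst.
have := integral_ae_eq measurableT iu mc.
move=> /(_ _)[E _ mE|]; first by rewrite integral_cst// mul0e; exact: H.
by move=> A [mA A0 As]; exists A; split => // x /= ux; apply: As => /(_ I) [].
Qed.

End pi_lambda.

(** * Fourier inversion *)

Section fourier_inversion_theorem.
Context {R : realType} {n : nat}.
Notation lam := (@lebesgue_rV R).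
Implicit Types (h f : 'rV[R]_n -> R[i]) (t s w : 'rV[R]_n).

Lemma cint_prod_dom d1 d2 (T1 : measurableType d1) (T2 : measurableType d2)
    (m1 : {sigma_finite_measure set T1 -> \bar R})
    (m2 : {sigma_finite_measure set T2 -> \bar R}) (F : T1 * T2 -> R[i]) u v (C : R) :
  cmeas F -> cint m1 u -> cint m2 v ->
  (forall z, normc (F z) <= C * (normc (u z.1) * normc (v z.2))) ->
  cint (m1 \x m2)%E F.
Proof.
move=> mF cu cv Fle.
have iG := integrable_prod (cint_normc cu) (cint_normc cv).
exact: (cint_dom mF (integrableZl measurableT C iG)).
Qed.

Lemma cmeas_ifourier h : cmeas h -> cmeas (ifourier h).
Proof.
move=> mh; apply: (cmeas_Cintegral_param (lam n)
  (F := fun p => h p.2 * cis (2 * pi * dotv p.1 p.2))).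
apply: cmeasM; first exact: (cmeas_comp mh measurable_snd).
by apply: cmeas_cis_dotv; [exact: measurable_fst|exact: measurable_snd].
Qed.

(** Damping the inverse Fourier integral by a wide Gaussian amounts to averaging
[h] against a narrow one. *)
Lemma ifourier_damped (e : R) h t : 0 < e -> cint (lam n) h ->
  Cintegral (lam n) (fun w => fourier h w * (cis (2 * pi * dotv t w) * gaussian (e *: w))) =
  Cintegral (lam n) (fun s => h s * moll e (s - t)).
Proof.
move=> e0 ch; have mh := cint_cmeas ch.
pose F (z : 'rV[R]_n * 'rV[R]_n) := h z.1 * cis (- (2 * pi * dotv z.1 z.2)) *
  (cis (2 * pi * dotv t z.2) * gaussian (e *: z.2)).
have m1 : measurable_fun setT (fst : 'rV[R]_n * 'rV[R]_n -> _) := measurable_fst.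
have m2 : measurable_fun setT (snd : 'rV[R]_n * 'rV[R]_n -> _) := measurable_snd.
have mF : cmeas F.
  apply: cmeasM.
    by apply: cmeasM; [exact: (cmeas_comp mh)|exact: cmeas_cisN_dotv].
  apply: cmeasM; first by apply: cmeas_cis_dotv => //; exact: measurable_cst.
  exact: (cmeas_comp (cmeas_gaussian_dil e)).
have cF : cint (lam n \x lam n)%E F.
  apply: (cint_prod_dom (C := 1) mF ch (cint_gaussian_dil e0)) => z.
  by rewrite /F !normcM !normc_cis mulr1 !mul1r.
transitivity (Cintegral (lam n \x lam n)%E F).
  rewrite (Cintegral_fubini2 cF); congr Cintegral; apply/funext => w.
  rewrite /F /= -[RHS]/(Cintegral (lam n) (fun x => _)).
  have cs : cint (lam n) (fun s => h s * cis (- (2 * pi * dotv s w))).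
    apply: (@cint_bndM _ _ _ _ _ _ 1) => // [|s]; last by rewrite normc_cis.
    by apply: cmeas_cisN_dotv => //; exact: measurable_cst.
  under [in RHS]eq_fun do rewrite mulrC.
  by rewrite (CintegralZ _ cs); exact: mulrC.
rewrite (Cintegral_fubini1 cF); congr Cintegral; apply/funext => s.
rewrite -mollN opprB -fourier_gaussian_dil// -CintegralZ.
  congr Cintegral; apply/funext => w; rewrite /F /= -!mulrA; congr (_ * _).
  rewrite mulrA -cisD; congr (cis _ * _).
  by rewrite dotvDl dotvNl; ring.
under eq_fun do rewrite mulrC.
apply: (@cint_bndM _ _ _ _ _ _ 1) => [||w]; first exact: cint_gaussian_dil.
  by apply: cmeas_cis_dotv => //; exact: measurable_cst.
by rewrite normc_cis.
Qed.

Lemma gaussian_dil_cvg (a : R[i]) w :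
  ccvg (fun k => a * gaussian (k.+1%:R^-1 *: w)) a.
Proof.
have H : ccvg (fun k => gaussian (k.+1%:R^-1 *: w + 0)) (gaussian (0 : 'rV[R]_n)).
  have [c1 c2] := cdiff_continuous (@cdiff_gaussian R n).
  by apply: (@ccvg_shift R n (@gaussian R n) 0 w); split.
have E : gaussian (0 : 'rV[R]_n) = 1 by rewrite /gaussian dotv0 mulr0 oppr0 expR0.
have := ccvgM a H; rewrite E mul1r; congr ccvg; apply/funext => k.
by rewrite addr0 mulrC.
Qed.

Lemma cmeas_ifourier_slice h t : cmeas h -> cmeas (fun w => h w * cis (2 * pi * dotv t w)).
Proof.
by move=> mh; apply: cmeasM => //; apply: cmeas_cis_dotv => //; exact: measurable_cst.
Qed.

Lemma ifourier_damped_cvg h t : cint (lam n) h ->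
  ccvg (fun k => Cintegral (lam n)
    (fun w => h w * (cis (2 * pi * dotv t w) * gaussian (k.+1%:R^-1 *: w))))
  (ifourier h t).
Proof.
move=> ch; have mh := cint_cmeas ch.
apply: (Cintegral_dominated_cvg (G := fun w => normc (h w))).
- move=> k; apply: cmeasM => //; apply: cmeasM; last exact: cmeas_gaussian_dil.
  by apply: cmeas_cis_dotv => //; exact: measurable_cst.
- exact: cmeas_ifourier_slice.
- exact: cint_normc.
- move=> k w; rewrite !normcM normc_cis mul1r ler_piMr ?normc_ge0//.
  exact: normc_gaussian_le1.
- move=> w; under eq_fun do rewrite mulrA; exact: gaussian_dil_cvg.
Qed.

(** The two sides of the damped identity converge as the damping is removed. *)
Theorem fourier_inversion h B t : cint (lam n) h -> ccont h ->
  (forall x, normc (h x) <= B) -> cint (lam n) (fourier h) ->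
  h t = ifourier (fourier h) t.
Proof.
move=> ch hc hB cF.
apply: (ccvg_unique (moll_cvg t (cint_cmeas ch) hc hB)).
have -> : (fun k => Cintegral (lam n) (fun s => h s * moll k.+1%:R^-1 (s - t))) =
    (fun k => Cintegral (lam n)
      (fun w => fourier h w * (cis (2 * pi * dotv t w) * gaussian (k.+1%:R^-1 *: w)))).
  by apply/funext => k; rewrite ifourier_damped.
exact: ifourier_damped_cvg.
Qed.

(** For discontinuous [h] the damped identity need not converge pointwise;
integrated against a continuous function it does, the mollifier being moved
onto that function. *)
Lemma ifourier_weak h (psi : 'rV[R]_n -> R[i]) B :
  cint (lam n) h -> cint (lam n) (fourier h) ->
  cint (lam n) psi -> ccont psi -> (forall x, normc (psi x) <= B) ->
  Cintegral (lam n) (fun t => psi t * h t) =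
  Cintegral (lam n) (fun t => psi t * ifourier (fourier h) t).
Proof.
move=> ch cF cp pc pB; have mh := cint_cmeas ch; have mp := cint_cmeas cp.
have mF := cint_cmeas cF.
pose e k : R := k.+1%:R^-1.
have e0 k : 0 < e k by rewrite invr_gt0.
have m1 : measurable_fun setT (fst : 'rV[R]_n * 'rV[R]_n -> _) := measurable_fst.
have m2 : measurable_fun setT (snd : 'rV[R]_n * 'rV[R]_n -> _) := measurable_snd.
pose I k := Cintegral (lam n) (fun t => psi t * Cintegral (lam n) (fun s => h s * moll (e k) (s - t))).
pose J k s := Cintegral (lam n) (fun t => psi t * moll (e k) (t - s)).
have cm k (x : 'rV[R]_n) f B' : cint (lam n) f -> (forall y : 'rV[R]_n, normc (moll (e k) y) <= B') ->
    cint (lam n) (fun s => f s * moll (e k) (s - x)).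
  move=> cf hB; apply: (@cint_bndM _ _ _ _ _ _ B') => //.
  by apply: cmeas_moll; exact: measurable_rVB.
have IJ k : I k = Cintegral (lam n) (fun s => h s * J k s).
  pose F (z : 'rV[R]_n * 'rV[R]_n) := psi z.1 * (h z.2 * moll (e k) (z.2 - z.1)).
  have cFF : cint (lam n \x lam n)%E F.
    apply: (cint_prod_dom (C := (e k ^+ n)^-1) _ cp ch) => [|z].
      apply: cmeasM; first exact: (cmeas_comp mp).
      apply: cmeasM; first exact: (cmeas_comp mh).
      by apply: cmeas_moll; exact: measurable_rVB.
    rewrite /F 2!normcM mulrA [leRHS]mulrC ler_wpM2l ?mulr_ge0 ?normc_ge0//.
    exact: normc_moll.
  transitivity (Cintegral (lam n \x lam n)%E F).
    rewrite (Cintegral_fubini1 cFF); congr Cintegral; apply/funext => t.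
    by rewrite /F /= CintegralZ//; apply: (cm _ _ _ _ ch) => x; exact: normc_moll.
  rewrite (Cintegral_fubini2 cFF); congr Cintegral; apply/funext => s.
  have E t : F (t, s) = h s * (psi t * moll (e k) (t - s)).
    by rewrite /F /= mulrCA -mollN opprB.
  rewrite /J -CintegralZ; last by apply: (cm _ _ _ _ cp) => x; exact: normc_moll.
  exact: (congr1 (Cintegral (lam n)) (funext E)).
have Jm k : cmeas (J k).
  apply: (cmeas_Cintegral_param (lam n) 
    (F := fun z : 'rV[R]_n * 'rV[R]_n => psi z.2 * moll (e k) (z.2 - z.1))).
  apply: cmeasM; first exact: (cmeas_comp mp).
  by apply: cmeas_moll; exact: measurable_rVB.
have cg := @cint_gaussian R n; have mg := cint_cmeas cg.
pose N := \int[lam n]_y (B * normc (gaussian y)).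
have cv1 : ccvg I (Cintegral (lam n) (fun s => h s * psi s)).
  rewrite (_ : I = fun k => Cintegral (lam n) (fun s => h s * J k s)); last exact/funext.
  apply: (Cintegral_dominated_cvg (G := fun s => 2 * N * normc (h s))).
  - by move=> k; exact: cmeasM.
  - exact: cmeasM.
  - exact: (integrableZl measurableT _ (cint_normc ch)).
  - move=> k s; rewrite normcM mulrC ler_wpM2r ?normc_ge0// /J Cintegral_moll//.
    apply: normc_Cintegral.
    + apply: cmeasM => //; apply: (cmeas_comp mp).
      by apply: measurable_rVD => //; exact: measurable_rVZ.
    + exact: (integrableZl measurableT B (cint_normc cg)).
    + by move=> y; rewrite normcM ler_wpM2r ?normc_ge0.
  - move=> s; under eq_fun do rewrite mulrC.
    rewrite [X in ccvg _ X]mulrC; apply: ccvgM; exact: (moll_cvg s mp pc pB).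
have cv2 : ccvg I (Cintegral (lam n) (fun t => psi t * ifourier (fourier h) t)).
  rewrite (_ : I = fun k => Cintegral (lam n) (fun t => psi t * Cintegral (lam n)
      (fun w => fourier h w * (cis (2 * pi * dotv t w) * gaussian (e k *: w))))); last first.
    apply/funext => k.
    have E t := congr1 (fun z => psi t * z) (ifourier_damped t (e0 k) ch).
    exact: (esym (congr1 (Cintegral (lam n)) (funext E))).
  apply: (Cintegral_dominated_cvg
    (G := fun t => 2 * (\int[lam n]_w normc (fourier h w)) * normc (psi t))).
  - move=> k; apply: cmeasM => //.
    apply: (cmeas_Cintegral_param (lam n) (F := fun z => fourier h z.2 *
      (cis (2 * pi * dotv z.1 z.2) * gaussian (e k *: z.2)))).
    apply: cmeasM; first exact: (cmeas_comp mF).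
    apply: cmeasM; first exact: cmeas_cis_dotv.
    exact: (cmeas_comp (cmeas_gaussian_dil (e k))).
  - by apply: cmeasM => //; exact: cmeas_ifourier.
  - exact: (integrableZl measurableT _ (cint_normc cp)).
  - move=> k t; rewrite normcM mulrC ler_wpM2r ?normc_ge0//.
    apply: normc_Cintegral.
    + apply: cmeasM => //; apply: cmeasM; last exact: cmeas_gaussian_dil.
      by apply: cmeas_cis_dotv => //; exact: measurable_cst.
    + exact: cint_normc.
    + move=> w; rewrite !normcM normc_cis mul1r ler_piMr ?normc_ge0//.
      exact: normc_gaussian_le1.
  - move=> t; under eq_fun do rewrite mulrC.
    rewrite [X in ccvg _ X]mulrC; apply: ccvgM; exact: ifourier_damped_cvg.
rewrite -(ccvg_unique cv1 cv2); congr Cintegral; apply/funext => t; exact: mulrC.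
Qed.

(** The difference of the two sides need not be integrable, as the right-hand
side is merely bounded; its product with a Gaussian is, and vanishes at the
same points. *)
Theorem fourier_inversion_ae h : cint (lam n) h -> cint (lam n) (fourier h) ->
  {ae lam n, forall t, h t = ifourier (fourier h) t}.
Proof.
move=> ch cF; have mh := cint_cmeas ch.
set H := ifourier (fourier h).
have mH : cmeas H by exact: (cmeas_ifourier (cint_cmeas cF)).
have HB t : normc (H t) <= 2 * (\int[lam n]_w normc (fourier h w)).
  apply: normc_Cintegral; last by move=> w; rewrite normcM normc_cis mulr1.
    exact: (cmeas_ifourier_slice t (cint_cmeas cF)).
  exact: cint_normc.
have cg := @cint_gaussian R n; have mg := cint_cmeas cg.
have [g1 g2] := cdiff_continuous (@cdiff_gaussian R n).
pose u t := (h t - H t) * gaussian t.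
have c1 (p : 'rV[R]_n -> R[i]) : cmeas p -> (forall x, normc (p x) <= 1) ->
    cint (lam n) (fun t => p t * gaussian t * h t) /\
    cint (lam n) (fun t => p t * gaussian t * H t).
  move=> mp p1.
  have pg x : normc (p x * gaussian x) <= 1.
    by rewrite normcM mulr_ile1 ?normc_ge0 ?normc_gaussian_le1.
  split; first by under eq_fun do rewrite mulrC;
    apply: (@cint_bndM _ _ _ _ _ _ 1) => //; exact: cmeasM.
  under eq_fun do rewrite mulrC mulrA.
  under eq_fun do rewrite mulrC.
  apply: (@cint_bndM _ _ _ _ _ _ (2 * (\int[lam n]_w normc (fourier h w)))) => //.
    exact: cmeasM.
  move=> x; rewrite normcM -[leRHS]mulr1 ler_pM ?normc_ge0//.
have cu : cint (lam n) u.
  have [] := c1 (fun=> 1) (cmeas_cst _ _); first by move=> x; rewrite normc1.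
  move=> a b; have := cintD a (cintN b); congr cint; apply/funext => x.
  by rewrite /u mul1r -mulrBr mulrC.
have u0 (psi : 'rV[R]_n -> R) : continuous psi -> (forall x, 0 <= psi x <= 1) ->
    Cintegral (lam n) (fun t => (psi t)%:C * u t) = 0.
  move=> cpsi psi01.
  have mpsi : cmeas (fun t => (psi t)%:C) by apply: cmeas_real; exact: continuous_measurable_rV.
  have psi1 x : normc (psi x)%:C <= 1.
    by have /andP[a b] := psi01 x; rewrite normc_real ger0_norm.
  have [a b] := c1 _ mpsi psi1.
  have -> : (fun t => (psi t)%:C * u t) =
      fun t => (psi t)%:C * gaussian t * h t - (psi t)%:C * gaussian t * H t.
    by apply/funext => t; rewrite /u; ring.
  rewrite CintegralB// (@ifourier_weak h _ 1) ?subrr//.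
  - under eq_fun do rewrite mulrC.
    exact: (@cint_bndM _ _ _ _ _ _ 1).
  - split => x /=.
      under eq_fun do rewrite mul0r subr0.
      exact: (continuousM (cpsi x) (g1 x)).
    under eq_fun do rewrite mulr0 mul0r addr0.
    exact: cst_continuous.
  - by move=> x; rewrite normcM mulr_ile1 ?normc_ge0 ?normc_gaussian_le1.
have [iR iI] := cu.
have aR : {ae lam n, forall t, Re (u t) = 0}.
  apply: ae0_of_continuous => // psi cpsi p01.
  have := u0 psi cpsi p01 => /(congr1 (@complex.Re R)) /= E0; rewrite -[RHS]E0.
  by apply: eq_Rintegral => x _; rewrite [RHS]ReM/= mul0r subr0.
have aI : {ae lam n, forall t, Im (u t) = 0}.
  apply: ae0_of_continuous => // psi cpsi p01.
  have := u0 psi cpsi p01 => /(congr1 (@complex.Im R)) /= E0; rewrite -[RHS]E0.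
  by apply: eq_Rintegral => x _; rewrite [RHS]ImM/= mul0r addr0.
apply: filterS2 aR aI => t r i.
have : u t = 0 by apply: complex_ext.
move=> /eqP; rewrite mulf_eq0 subr_eq0 => /orP[/eqP//|].
by rewrite /gaussian => /eqP[] /eqP; rewrite gt_eqF// expR_gt0.
Qed.

End fourier_inversion_theorem.

(** * Inversion of the short-time Fourier transform *)

Section stft_inversion.
Context {R : realType}.
Notation lam := (@lebesgue_rV R).
Notation phase n := (@phase_measure R n).

(** The iterated integral of the modulus of [G] vanishes in one order of
integration, hence in the other. *)
Lemma ae_section_swap d1 d2 (T1 : measurableType d1) (T2 : measurableType d2)
    (m1 : {sigma_finite_measure set T1 -> \bar R})
    (m2 : {sigma_finite_measure set T2 -> \bar R}) (G : T1 * T2 -> R[i]) : cmeas G ->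
  {ae m1, forall x, {ae m2, forall y, G (x, y) = 0}} ->
  {ae m2, forall y, {ae m1, forall x, G (x, y) = 0}}.
Proof.
move=> mG H.
pose g z := (normc (G z))%:E.
have mg : measurable_fun setT g by apply/measurable_EFinP; exact: measurable_normc.
have g0 z : (0 <= g z)%E by rewrite lee_fin normc_ge0.
have mg1 x : measurable_fun setT (fun y => g (x, y)).
  exact: (measurableT_comp mg (pair1_measurable x)).
have mg2 y : measurable_fun setT (fun x => g (x, y)).
  exact: (measurableT_comp mg (pair2_measurable y)).
have I1 : (\int[m1]_x \int[m2]_y g (x, y) = 0)%E.
  have mF : measurable_fun setT (fun x => \int[m2]_y g (x, y))%E.
    exact: (@measurable_fun_fubini_tonelli_F _ _ _ _ _ m2 g mg g0).
  have F0 x : (0 <= \int[m2]_y g (x, y))%E by exact: integral_ge0.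
  have : (\int[m1]_x `|\int[m2]_y g (x, y)| = 0)%E.
    apply/(ae_eq_integral_abs m1 measurableT mF).
    apply: filterS H => x Hx _ /=.
    have : (\int[m2]_y `|g (x, y)| = 0)%E.
      apply/(ae_eq_integral_abs m2 measurableT (mg1 x)).
      by apply: filterS Hx => y Gy _; rewrite /g Gy normc0.
    by under eq_integral do rewrite gee0_abs//.
  by under eq_integral do rewrite gee0_abs//.
have mF2 : measurable_fun setT (fun y => \int[m1]_x g (x, y))%E.
  exact: (@measurable_fun_fubini_tonelli_G _ _ _ _ _ m1 g mg g0).
have I2 : (\int[m2]_y `|\int[m1]_x g (x, y)| = 0)%E.
  under eq_integral do rewrite gee0_abs ?integral_ge0//.
  by rewrite -fubini_tonelli.
move/(ae_eq_integral_abs m2 measurableT mF2) : I2; apply: filterS => y /(_ I)/= Iy.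
have : (\int[m1]_x `|g (x, y)| = 0)%E by under eq_integral do rewrite gee0_abs//.
move/(ae_eq_integral_abs m1 measurableT (mg2 y)); apply: filterS => x /(_ I)/=.
by rewrite /g => -[]; exact: eq0_normc.
Qed.

Context {n : nat}.
Implicit Types (f h : 'rV[R]_n -> R[i]) (t s w : 'rV[R]_n).

Lemma S0_cmeas f : S0 f -> cmeas f.
Proof. by move=> [[m1 m2 _] _]. Qed.

Lemma stft_fourier f z :
  stft (@gaussian R n) f z = fourier (fun t => f t * gaussian (t - z.1)) z.2.
Proof. by rewrite /stft /fourier; under eq_fun do rewrite conj_gaussian. Qed.

Lemma integrable_normcM f h : square_integrable f -> square_integrable h ->
  (lam n).-integrable setT (EFin \o (fun t => normc (f t * h t))).
Proof.
move=> [f1 f2 f3] [h1 h2 h3].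
have iG := integrableD measurableT f3 h3.
apply: (integrable_dom (G := fun t => normc (f t) ^+ 2 + normc (h t) ^+ 2)).
- by apply: measurable_normc; exact: cmeasM.
- exact: iG.
- move=> t; rewrite ger0_norm ?normc_ge0// normcM.
  have := sqr_ge0 (normc (f t) - normc (h t)).
  have := sqr_ge0 (normc (f t) + normc (h t)); nra.
Qed.

(** Functions of [S0] are only known to be square integrable; all integrals
against Schwartz functions converge for this reason. *)
Lemma cint_sqM f h : square_integrable f -> square_integrable h ->
  cint (lam n) (fun t => f t * h t).
Proof.
move=> sf sh; apply: cintP; last exact: integrable_normcM.
by case: sf => f1 f2 _; case: sh => h1 h2 _; exact: cmeasM.
Qed.

Lemma square_integrable_gaussian_shift t : square_integrable (fun x => gaussian (x - t)).
Proof.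
by apply: schwartz_square_integrable; apply: schwartz_shift; exact: schwartz_gaussian.
Qed.

(** The squared norm of the window, the constant of the inversion formula. *)
Definition gaussian_mass : R[i] := Cintegral (lam n) (fun x => gaussian x * gaussian x).

(** The square of the Gaussian is a dilated Gaussian. *)
Lemma gaussian_mass_neq0 : gaussian_mass != 0.
Proof.
have s0 : 0 < Num.sqrt 2 :> R by rewrite sqrtr_gt0.
have := Cintegral_aff 0 s0 (cint_cmeas (@cint_gaussian R n)).
have E : (fun x : 'rV[R]_n => gaussian (Num.sqrt 2 *: x + 0)) =
    (fun x => gaussian x * gaussian x).
  apply/funext => x; rewrite addr0 /gaussian -rmorphM -expRD dotvZl dotvZr.
  have q : Num.sqrt 2 * Num.sqrt 2 = 2 :> R by rewrite -expr2 sqr_sqrtr.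
  by rewrite (mulrA (Num.sqrt 2)) q; congr (expR _)%:C; ring.
rewrite CintegralZ.
  have -> : Cintegral (lam n) (fun x => gaussian (Num.sqrt 2 *: x + 0)) = gaussian_mass.
    by rewrite E.
  rewrite Cintegral_gaussian => /eqP H; apply: contraTneq H => ->.
  by rewrite mulr0 eq_sym oner_eq0.
rewrite E; have := schwartz_square_integrable (@schwartz_gaussian R n).
by move=> sg; exact: cint_sqM.
Qed.

(** For almost every time [z] the slice [f g(. - z)] is integrable with
integrable Fourier transform [V(z, .)], so Fourier inversion recovers it;
averaging against [g(. - z)] removes the window. *)
Theorem stft_inversion f : S0 f ->
  {ae lam n, forall t, gaussian_mass * f t =
     synth (stft (@gaussian R n) f) (@gaussian R n) t}.
Proof.
move=> [sf iV]; have mf : cmeas f by case: sf.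
have mg : cmeas (@gaussian R n) := cint_cmeas (@cint_gaussian R n).
set V := stft _ f.
have mV : cmeas V by exact: cmeas_stft.
have cV : cint (lam n \x lam n)%E V by exact: cintP.
pose G (p : 'rV[R]_n * 'rV[R]_n) := f p.2 * gaussian (p.2 - p.1) -
  Cintegral (lam n) (fun w => V (p.1, w) * cis (2 * pi * dotv p.2 w)).
have m1 : measurable_fun setT (fst : 'rV[R]_n * 'rV[R]_n -> _) := measurable_fst.
have m2 : measurable_fun setT (snd : 'rV[R]_n * 'rV[R]_n -> _) := measurable_snd.
have mF : cmeas (fun q : ('rV[R]_n * 'rV[R]_n) * 'rV[R]_n =>
    V (q.1.1, q.2) * cis (2 * pi * dotv q.1.2 q.2)).
  apply: cmeasM; last first.
    by apply: cmeas_cis_dotv; [exact: measurableT_comp m2 measurable_fst|exact: measurable_snd].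
  apply: (cmeas_comp mV); apply: measurable_fun_pair; last exact: measurable_snd.
  exact: measurableT_comp m1 measurable_fst.
have mG : cmeas G.
  apply: cmeasD; first apply: cmeasM.
  - exact: (cmeas_comp mf).
  - by apply: cmeas_gaussian; exact: measurable_rVB.
  - have := cmeasM (cmeas_cst _ (-1)) (cmeas_Cintegral_param (lam n) mF).
    by under eq_fun do rewrite mulN1r.
have aV : {ae lam n, forall z, cint (lam n) (fun w => V (z, w))} := ae_cint_fubini cV.
have aG : {ae lam n, forall z, {ae lam n, forall t, G (z, t) = 0}}.
  apply: filterS aV => z cz.
  have cfg : cint (lam n) (fun t => f t * gaussian (t - z)).
    by apply: cint_sqM => //; exact: square_integrable_gaussian_shift.
  have E : fourier (fun t => f t * gaussian (t - z)) = fun w => V (z, w).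
    by apply/funext => w; rewrite /V stft_fourier.
  have := fourier_inversion_ae cfg; rewrite E => /(_ cz).
  by apply: filterS => t Ht; rewrite /G /= Ht subrr.
have := ae_section_swap mG aG; apply: filterS => t aGt.
have cs := cint_synth_slice t mV mg iV (@normc_gaussian_le1 R n).
rewrite /synth (Cintegral_fubini1 cs).
transitivity (Cintegral (lam n) (fun z => f t * (gaussian (t - z) * gaussian (t - z)))).
  have sg := schwartz_square_integrable (@schwartz_gaussian R n).
  have cgg := cint_sqM sg sg.
  have E : (fun z => gaussian (t - z) * gaussian (t - z)) =
      (fun z => gaussian (z - t) * gaussian (z - t)).
    by apply/funext => z; rewrite -(gaussianN (t - z)) opprB.
  rewrite CintegralZ ?E; last exact: (cint_shift (- t) cgg).
  by rewrite mulrC (Cintegral_shift (- t) (cint_cmeas cgg)).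
apply: ae_eq_Cintegral.
- apply: cmeasM; first exact: cmeas_cst.
  by apply: cmeasM; apply: cmeas_gaussian; apply: measurable_rVB => //; exact: measurable_cst.
- exact: (cmeas_Cintegral_param (lam n) (cmeas_synth_slice t mV mg)).
- apply: filterS2 aV aGt => z cz /eqP; rewrite /G subr_eq0 => /eqP /= Gz /=.
  have -> : (fun y => V (z, y) * cis (2 * pi * dotv t y) * gaussian (t - z)) =
      fun y => gaussian (t - z) * (V (z, y) * cis (2 * pi * dotv t y)).
    by apply/funext => y; exact: mulrC.
  rewrite CintegralZ -?Gz; first by rewrite mulrA mulrC.
  apply: (@cint_bndM _ _ _ _ _ _ 1) => // [|w]; last by rewrite normc_cis.
  by apply: cmeas_cis_dotv => //; exact: measurable_cst.
Qed.

(** The functional on [S0] represented by [f]; it is conjugate-linear in [h]. *)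
Definition pairing f h : R[i] := Cintegral (lam n) (fun t => conjc (h t) * f t).

Lemma square_integrable_conj f : square_integrable f ->
  square_integrable (fun t => conjc (f t)).
Proof.
move=> [f1 f2 f3]; have [c1 c2] := cmeas_conj (conj f1 f2); split => //.
by under eq_fun do rewrite normc_conj.
Qed.

(** By the inequality [2 a b <= a^2 + b^2] and the translation invariance of the
second integral. *)
Lemma integral_window_le f : square_integrable f -> exists2 M : R, 0 <= M &
  forall z : 'rV[R]_n,
    (\int[lam n]_t (normc (f t) * normc (gaussian (t - z)))%:E <= M%:E)%E.
Proof.
move=> [f1 f2 f3].
have [g1 g2 g3] := schwartz_square_integrable (@schwartz_gaussian R n).
exists (\int[lam n]_t (normc (f t) ^+ 2) + \int[lam n]_t (normc (gaussian t) ^+ 2)).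
  by rewrite addr_ge0// Rintegral_ge0// => x _; rewrite sqr_ge0.
move=> z; rewrite EFinD /Rintegral !fineK; try exact: integrable_fin_num.
rewrite -(integral_shift (- z) (f := fun t => (normc (gaussian t) ^+ 2)%:E)); last first.
  exact: measurable_int g3.
have mgz : measurable_fun setT (fun t : 'rV[R]_n => normc (gaussian (t - z))).
  by apply: measurable_normc; apply: cmeas_gaussian; exact: measurable_rVB.
have mf : measurable_fun setT (fun t => normc (f t)) by exact: measurable_normc.
rewrite -ge0_integralD//; last 4 first.
- by move=> x _; rewrite lee_fin sqr_ge0.
- by apply/measurable_EFinP; exact: measurable_funX.
- by move=> x _; rewrite lee_fin sqr_ge0.
- by apply/measurable_EFinP; exact: measurable_funX.
apply: ge0_le_integral => //.
- by move=> t _; rewrite lee_fin mulr_ge0 ?normc_ge0.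
- by apply/measurable_EFinP; exact: measurable_funM.
- by apply/measurable_EFinP; apply: measurable_funD; exact: measurable_funX.
- move=> t _; rewrite -EFinD lee_fin.
  have := sqr_ge0 (normc (f t) - normc (gaussian (t - z))).
  have := sqr_ge0 (normc (f t) + normc (gaussian (t - z))); nra.
Qed.

(** Inversion bounds [h] by the superposition of the windows [g(. - z)] with
weights [|V|], whose integral against [f] is at most a multiple of the [L^1]
norm of [V]. *)
Lemma pairing_le f : S0 f -> exists2 C : R, 0 <= C & forall h, S0 h ->
  ((normc (pairing f h))%:E <= C%:E * S0norm h)%E.
Proof.
move=> [sf _]; have [M M0 HM] := integral_window_le sf.
have mf : cmeas f by case: sf.
have c0 : 0 < normc gaussian_mass.
  rewrite lt_neqAle normc_ge0 andbT eq_sym.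
  by apply: contra_neq gaussian_mass_neq0 => /eq0_normc.
have [K KE] : exists K : R, K = 2 / normc gaussian_mass by eexists.
have K0 : 0 <= K by rewrite KE divr_ge0// ltW.
exists (2 * (K * M)) => [|h Sh]; first exact: mulr_ge0 (ler0n _ 2) (mulr_ge0 K0 M0).
have [sh iV] := Sh; have mh := S0_cmeas Sh.
set V := stft _ h in iV.
have mg : cmeas (@gaussian R n) := cint_cmeas (@cint_gaussian R n).
have mV : cmeas V by exact: cmeas_stft.
have mVn := measurable_normc mV.
have chf := cint_sqM (square_integrable_conj sh) sf.
have cN := cint_normc chf.
apply: (@le_trans _ _ (2 * \int[lam n]_t (normc (conjc (h t) * f t)))%:E).
  by rewrite lee_fin; apply: normc_Cintegral cN _ => //; exact: (cint_cmeas chf).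
rewrite EFinM /Rintegral fineK; last exact: integrable_fin_num.
rewrite EFinM -muleA; apply: lee_wpmul2l; first by rewrite lee_fin.
have mVE : measurable_fun setT (fun z => (normc (V z))%:E) by exact/measurable_EFinP.
have VE0 z : (0 <= (normc (V z))%:E)%E by rewrite lee_fin normc_ge0.
pose v z : \bar R := (\int[lam n]_w (normc (V (z, w)))%:E)%E.
have v0 z : (0 <= v z)%E by exact: integral_ge0.
have mv : measurable_fun setT v.
  exact: (@measurable_fun_fubini_tonelli_F _ _ _ _ _ (lam n) _ mVE VE0).
have mV1 z : measurable_fun setT (fun w => (normc (V (z, w)))%:E).
  exact: (measurableT_comp mVE (pair1_measurable z)).
have Sv : S0norm h = (\int[lam n]_z v z)%E by exact: fubini_tonelli1.
have a0 z t : 0 <= normc (f t) * normc (gaussian (t - z)) by rewrite mulr_ge0 ?normc_ge0.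
have ma : measurable_fun setT (fun q : 'rV[R]_n * 'rV[R]_n =>
    normc (f q.2) * normc (gaussian (q.2 - q.1))).
  apply: measurable_funM; apply: measurable_normc.
    exact: (cmeas_comp mf measurable_snd).
  apply: cmeas_gaussian; apply: measurable_rVB; first exact: measurable_snd.
  exact: measurable_fst.
pose F (q : 'rV[R]_n * 'rV[R]_n) : \bar R :=
  (v q.1 * (K * (normc (f q.2) * normc (gaussian (q.2 - q.1))))%:E)%E.
have F0 q : (0 <= F q)%E by rewrite mule_ge0// lee_fin mulr_ge0.
have mF : measurable_fun setT F.
  apply: emeasurable_funM; first exact: (measurableT_comp mv measurable_fst).
  by apply/measurable_EFinP; apply: measurable_funM.
apply: (@le_trans _ _ (\int[lam n]_t \int[lam n]_z F (z, t))%E).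
  apply: ae_ge0_le_integral => //.
  - by move=> t _; rewrite lee_fin normc_ge0.
  - by apply: measurable_int cN.
  - by move=> t _; apply: integral_ge0.
  - exact: (@measurable_fun_fubini_tonelli_G _ _ _ _ _ (lam n) F mF F0).
  apply: filterS (stft_inversion Sh) => t Ht _.
  have cs := cint_synth_slice t mV mg iV (@normc_gaussian_le1 R n).
  have iN := cint_normc cs.
  have b1 : normc gaussian_mass * normc (h t) <= 2 * \int[phase n]_z
      normc (V z * cis (2 * pi * dotv t z.2) * gaussian (t - z.1)).
    by rewrite -normcM Ht; apply: normc_Cintegral iN _ => //; exact: (cint_cmeas cs).
  have -> : (\int[lam n]_z F (z, t) = (K * normc (f t) *
      \int[phase n]_z normc (V z * cis (2 * pi * dotv t z.2) * gaussian (t - z.1)))%:E)%E.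
    rewrite EFinM /Rintegral fineK; last exact: integrable_fin_num.
    rewrite -ge0_integralZl//; last 3 first.
    - exact: measurable_int iN.
    - by move=> z _; rewrite lee_fin normc_ge0.
    - by rewrite lee_fin mulr_ge0 ?normc_ge0.
    rewrite [RHS]fubini_tonelli1//; last 2 first.
    - by apply: measurable_funeM; exact: measurable_int iN.
    - by move=> z; rewrite -EFinM lee_fin !mulr_ge0 ?normc_ge0.
    apply: eq_integral => z _.
    have k0 : (0 <= (K * (normc (f t) * normc (gaussian (t - z))))%:E)%E.
      by rewrite lee_fin mulr_ge0.
    rewrite /F [LHS]muleC -[LHS](ge0_integralZl _ measurableT (mV1 z) (fun w _ => VE0 (z, w)) k0).
    apply: eq_integral => w _; rewrite -!EFinM !normcM normc_cis.
    by congr EFin; rewrite [fst _]/=; ring.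
  rewrite lee_fin normcM normc_conj (mulrC (normc (h t))) (mulrC K) -mulrA.
  by rewrite ler_wpM2l ?normc_ge0// KE mulrAC -[leRHS]mulrC ler_pdivlMl.
rewrite -(fubini_tonelli F mF F0) Sv -ge0_integralZl//; last first.
  by rewrite lee_fin mulr_ge0.
apply: ge0_le_integral => //.
- by move=> p _; apply: integral_ge0.
- exact: (@measurable_fun_fubini_tonelli_F _ _ _ _ _ (lam n) F mF F0).
- exact: measurable_funeM.
move=> z _.
rewrite -[X in (X <= _)%E]/(\int[lam n]_t
  (v z * (K * (normc (f t) * normc (gaussian (t - z))))%:E))%E.
have maz : measurable_fun setT (fun t => (K * (normc (f t) * normc (gaussian (t - z))))%:E).
  apply/measurable_EFinP; apply: measurable_funM => //.
  exact: (measurableT_comp ma (pair1_measurable z)).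
rewrite ge0_integralZl//; last by move=> t _; rewrite lee_fin mulr_ge0.
rewrite muleC; apply: lee_wpmul2r => //.
under eq_integral do rewrite EFinM.
rewrite ge0_integralZl//; last 2 first.
- by apply/measurable_EFinP; exact: (measurableT_comp ma (pair1_measurable z)).
- by move=> t _; rewrite lee_fin.
by rewrite EFinM; apply: lee_wpmul2l.
Qed.

(** This is how an operator defined on the dual is tested on functions. *)
Lemma pairing_S0dual f : S0 f -> S0dual (pairing f).
Proof.
move=> Sf; have [sf _] := Sf; split.
  move=> a h k [sh _] [sk _].
  have ch := cint_sqM (square_integrable_conj sh) sf.
  have ck := cint_sqM (square_integrable_conj sk) sf.
  rewrite /pairing -(CintegralZ _ ch) -CintegralD//; last exact: cintZ.
  by congr Cintegral; apply/funext => t; rewrite conjcD conjcM mulrDl mulrA.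
have [C C0 HC] := pairing_le Sf.
apply: (@le_lt_trans _ _ C%:E); last exact: ltry.
apply: ge_ereal_sup => _ [h [Sh h1] <-]; apply: (le_trans (HC h Sh)).
by rewrite -[leRHS]mule1; apply: lee_wpmul2l.
Qed.

End stft_inversion.

(** * Functionals applied to the sections of a Schwartz kernel *)

Section dual.
Context {R : realType} {n : nat}.
Notation lam := (@lebesgue_rV R).
Implicit Types (f h : 'rV[R]_n -> R[i]) (tau : ('rV[R]_n -> R[i]) -> R[i]).

Lemma square_integrableZ (c : R[i]) f : square_integrable f ->
  square_integrable (fun x => c * f x).
Proof.
move=> [f1 f2 f3]; have [m1 m2] := cmeasM (cmeas_cst _ c) (conj f1 f2).
split => //; have := integrableZl measurableT (normc c ^+ 2) f3.
by apply: eq_integrable => // x _; rewrite normcM exprMn EFinM.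
Qed.

Lemma stftZ (c : R[i]) f z : square_integrable f ->
  stft (@gaussian R n) (fun x => c * f x) z = c * stft (@gaussian R n) f z.
Proof.
move=> sf; rewrite /stft -CintegralZ.
  by congr Cintegral; apply/funext => t; rewrite !mulrA.
under eq_fun do rewrite conj_gaussian.
apply: (@cint_bndM _ _ _ _ _ _ 1) => [||t]; last by rewrite normc_cis.
  exact: (cint_sqM sf (square_integrable_gaussian_shift z.1)).
by apply: cmeas_cisN_dotv => //; exact: measurable_cst.
Qed.

Lemma S0normZ (c : R[i]) f : S0 f ->
  S0norm (fun x => c * f x) = ((normc c)%:E * S0norm f)%E.
Proof.
move=> [sf iV]; rewrite /S0norm -ge0_integralZl//.
- by apply: eq_integral => z _; rewrite stftZ// normcM.
- exact: measurable_int iV.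
- by move=> z _; rewrite lee_fin normc_ge0.
- by rewrite lee_fin normc_ge0.
Qed.

Lemma S0Z (c : R[i]) f : S0 f -> S0 (fun x => c * f x).
Proof.
move=> [sf iV]; split; first exact: square_integrableZ.
have := integrableZl measurableT (normc c) iV.
by apply: eq_integrable => // z _; rewrite stftZ// normcM EFinM.
Qed.

Lemma S0_zero : S0 (fun _ : 'rV[R]_n => 0).
Proof. exact/schwartz_S0/schwartz0. Qed.

Lemma dual0 tau : S0dual tau -> tau (fun _ => 0) = 0.
Proof.
move=> [lin _]; have := lin 1 _ _ S0_zero S0_zero.
under eq_fun do rewrite mulr0 addr0.
by rewrite conjc1 mul1r => /eqP; rewrite addrC -subr_eq subrr eq_sym => /eqP.
Qed.

Lemma dualZ tau (c : R[i]) f : S0dual tau -> S0 f ->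
  tau (fun x => c * f x) = conjc c * tau f.
Proof.
move=> dt Sf; have [lin _] := dt; have := lin c _ _ Sf S0_zero.
by under eq_fun do rewrite addr0; rewrite dual0// addr0.
Qed.

Lemma dual_sum tau (I : Type) (s : seq I) (a : I -> R[i]) (F : I -> 'rV[R]_n -> R[i]) :
  S0dual tau -> (forall i, schwartz (F i)) ->
  tau (fun x => \sum_(i <- s) a i * F i x) = \sum_(i <- s) conjc (a i) * tau (F i).
Proof.
move=> dt SF; have [lin _] := dt; elim: s => [|i s IH].
  by under eq_fun do rewrite big_nil; rewrite big_nil dual0.
under eq_fun do rewrite big_cons; rewrite big_cons -IH lin//; first exact: schwartz_S0.
exact/schwartz_S0/schwartz_sum.
Qed.

Lemma S0dual_norm_ge0 tau : S0dual tau -> (0 <= S0dual_norm tau)%E.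
Proof.
move=> dt; apply: ereal_sup_ubound; exists (fun=> 0); last by rewrite dual0// normc0.
split; first exact: S0_zero.
have := S0normZ 0 S0_zero; under eq_fun do rewrite mulr0.
by rewrite normc0 mul0e => ->.
Qed.

Lemma S0dual_norm_fin tau : S0dual tau -> S0dual_norm tau \is a fin_num.
Proof. by move=> dt; rewrite ge0_fin_numE ?S0dual_norm_ge0//; case: dt. Qed.

(** By homogeneity; the norm of [f] is replaced by a larger number, as it may
vanish. *)
Lemma dual_bound tau f B : S0dual tau -> S0 f -> (S0norm f <= B%:E)%E ->
  normc (tau f) <= fine (S0dual_norm tau) * B.
Proof.
move=> dt Sf fB.
have N0 : 0 <= fine (S0dual_norm tau) by exact/fine_ge0/S0dual_norm_ge0.
have B0 : 0 <= B.
  rewrite -lee_fin (le_trans _ fB)//; apply: integral_ge0 => z _.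
  by rewrite lee_fin normc_ge0.
(* Scaling by [b] puts [f] in the unit ball, for every [b > B]. *)
have key b : B < b -> normc (tau f) <= fine (S0dual_norm tau) * b.
  move=> Bb; have b0 : 0 < b by exact: le_lt_trans Bb.
  have nb : normc (b^-1)%:C = b^-1 by rewrite normc_real gtr0_norm// invr_gt0.
  have : ((normc (tau (fun x => (b^-1)%:C * f x)))%:E <= S0dual_norm tau)%E.
    apply: ereal_sup_ubound; exists (fun x => (b^-1)%:C * f x) => //.
    split; first exact: S0Z.
    rewrite S0normZ// nb; apply: (@le_trans _ _ (b^-1%:E * B%:E)%E).
      by apply: lee_wpmul2l => //; rewrite lee_fin invr_ge0 ltW.
    by rewrite -EFinM lee_fin mulrC ler_pdivrMr// mul1r ltW.
  rewrite dualZ// normcM normc_conj nb -[X in (_ <= X)%E -> _]fineK ?S0dual_norm_fin// lee_fin.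
  by rewrite mulrC ler_pdivrMr.
apply/ler_addgt0Pr => e e0.
have N1 : 0 < fine (S0dual_norm tau) + 1 by rewrite ltr_wpDl.
apply: (le_trans (key (B + e / (fine (S0dual_norm tau) + 1)) _)).
  by rewrite ltrDl divr_gt0.
rewrite mulrDr lerD2l mulrA ler_pdivrMr// mulrC ler_wpM2l ?(ltW e0)//.
by rewrite lerDl.
Qed.

End dual.

Section dual_of_sections.
Context {R : realType} {d : nat}.
Implicit Types (f : 'rV[R]_(d + d) -> R[i]) (tau : ('rV[R]_d -> R[i]) -> R[i]).

Lemma schwartz_conj_section f x : schwartz f -> schwartz (conj_section f x).
Proof. by move=> fS; apply: schwartz_conj; exact: schwartz_section. Qed.

Lemma cdiff_conj_section f x : schwartz f ->
  cdiff (conj_section f x) (fun j => conj_section (partialC (rshift d j) f) x).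
Proof. by move=> fS; exact: cdiff_conj (cdiff_section x (schwartz_cdiff fS)). Qed.

Lemma partialC_conj_section f x j : schwartz f ->
  partialC j (conj_section f x) = conj_section (partialC (rshift d j) f) x.
Proof. by move=> fS; exact: (congr1 (@^~ j) (cdiff_partial (cdiff_conj_section x fS))). Qed.

(** The weight of the pair [(x, y)] dominates those of [x] and [y], so part of
it can be spent on decay in [x]. *)
Lemma bnd_conj_section m k j B f x : schwartz f -> bnd m (k + j) B f ->
  bnd m k (B / jb x ^+ j) (conj_section f x).
Proof.
have j0 : 0 < jb x ^+ j by exact: lt_le_trans (jbX_ge1 x j).
elim: m f => [|m IH] f fS fB.
  split => // y; rewrite ler_pdivlMr// normc_conj.
  apply: le_trans (bnd0 fB (row_mx x y)).
  rewrite mulrAC ler_wpM2r ?normc_ge0// exprD ler_pM ?jbX_ge0//.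
    by rewrite lerXn2r ?nnegrE ?jb_ge0// jb_row_mxr.
  by rewrite lerXn2r ?nnegrE ?jb_ge0// jb_row_mxl.
split=> [y|i].
  exact: (bnd0 (IH f fS (bndW (leqnSn m) fB)) y).
rewrite partialC_conj_section//; apply: IH; first exact: schwartz_partial.
exact: bndS.
Qed.

Lemma cdiff_sum n (I : Type) (s : seq I) (a : I -> R[i]) (F : I -> 'rV[R]_n -> R[i]) D :
  (forall i, cdiff (F i) (D i)) ->
  cdiff (fun x => \sum_(i <- s) a i * F i x) (fun j x => \sum_(i <- s) a i * D i j x).
Proof.
move=> FD; elim: s => [|i s IH].
  by apply: (cdiff_ext (cdiff_cst 0)) => [x|j x]; rewrite big_nil.
by apply: (cdiff_ext (cdiff_lin (a i) (FD i) IH)) => [x|j x]; rewrite big_cons.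
Qed.

(** The remainder of the first order expansion of [x |-> conj f(x, .)], as a
function of the other variable. The scalars are written on the left so that
functionals can be applied term by term. *)
Definition section_rem f (x h : 'rV[R]_d) (y : 'rV[R]_d) : R[i] :=
  (- 1) * (\sum_(i < d) (h ord0 i)%:C * conj_section (partialC (lshift d i) f) x y) +
  ((- 1) * conj_section f x y + conj_section f (x + h) y).

(** The increment [(h, 0)] has no component along the second variable, whence
the sum over the first block of derivatives only. *)
Lemma section_remE f x h y :
  section_rem f x h y =
  conjc (rem f (fun i => partialC i f) (row_mx x y) (row_mx h 0)).
Proof.
rewrite /rem add_row_mx addr0 conjcD conjcD !conjcN /section_rem !mulN1r addrC.
congr (_ - _); first by rewrite addrC.
rewrite big_split_ord/= [X in conjc (_ + X)]big1 ?addr0; last first.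
  by move=> i _; rewrite row_mxEr mxE mul0r.
rewrite rmorph_sum; apply: eq_bigr => i _.
by rewrite -[RHS]/(conjc _) conjcM conjc_real row_mxEl.
Qed.

Lemma schwartz_section_rem f x h : schwartz f -> schwartz (section_rem f x h).
Proof.
move=> fS; apply: schwartz_lin; last first.
  by apply: schwartz_lin; exact: schwartz_conj_section.
by apply: schwartz_sum => i; exact/schwartz_conj_section/schwartz_partial.
Qed.

(** Derivatives in [y] commute with the expansion in [x]. *)
Lemma partialC_section_rem f x h j : schwartz f ->
  partialC j (section_rem f x h) = section_rem (partialC (rshift d j) f) x h.
Proof.
move=> fS.
have Hc i : cdiff (conj_section (partialC (lshift d i) f) x)
    (fun j => conj_section (partialC (lshift d i) (partialC (rshift d j) f)) x).
  have H := cdiff_conj_section x (schwartz_partial (lshift d i) fS).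
  apply: (cdiff_ext H) => [y|k y]; first by [].
  by rewrite /conj_section schwartz_partialC.
have H := cdiff_lin (- 1) (cdiff_sum (index_enum 'I_d) (fun i => (h ord0 i)%:C) Hc)
  (cdiff_lin (- 1) (cdiff_conj_section x fS) (cdiff_conj_section (x + h) fS)).
exact: (congr1 (@^~ j) (cdiff_partial H)).
Qed.

Lemma bnd_section_rem m k B f x h : schwartz f -> bnd m.+2 k B f -> l1 h <= 1 ->
  bnd m k (4 * 2 ^+ k * B * l1 h ^+ 2) (section_rem f x h).
Proof.
move=> fS + h1; elim: m f fS => [|m IH] f fS fB.
  split => // y; rewrite section_remE normc_conj.
  have hl : l1 (row_mx h (0 : 'rV[R]_d)) = l1 h.
    rewrite l1_row_mx; suff -> : l1 (0 : 'rV[R]_d) = 0 by rewrite addr0.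
    by rewrite /l1 big1// => i _; rewrite mxE normr0.
  have := schwartz_taylor (row_mx x y) fS fB (h := row_mx h 0); rewrite hl => /(_ h1).
  apply: le_trans; rewrite ler_wpM2r ?normc_ge0//.
  by rewrite lerXn2r ?nnegrE ?jb_ge0// jb_row_mxr.
split=> [y|i].
  exact: (bnd0 (IH f fS (bndW (leqnSn _) fB)) y).
rewrite partialC_section_rem//; apply: IH; first exact: schwartz_partial.
exact: bndS.
Qed.

(** The remainder of the expansion is small in [S0], uniformly in [x], so the
functional may be applied to the expansion. *)
Lemma cdiff_dual_section tau f : S0dual tau -> schwartz f ->
  cdiff (fun x => tau (conj_section f x))
    (fun i x => tau (conj_section (partialC (lshift d i) f) x)).
Proof.
move=> dt fS; have [C C0 HC] := @S0norm_le R d.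
have [B fB] := schwartz_bnd (2 * d).+2 (2 * d + 2 * d) fS.
apply: (@quad_cdiff _ _ _ _ (fine (S0dual_norm tau) * (C * (4 * 2 ^+ (2 * d + 2 * d) * B)))) => x h h1.
have -> : rem (fun x => tau (conj_section f x))
    (fun i x => tau (conj_section (partialC (lshift d i) f) x)) x h =
    tau (section_rem f x h).
  have [lin _] := dt.
  have S1 : schwartz (fun y => - 1 * conj_section f x y + conj_section f (x + h) y).
    by apply: schwartz_lin; exact: schwartz_conj_section.
  have SF i : schwartz (conj_section (partialC (lshift d i) f) x).
    exact/schwartz_conj_section/schwartz_partial.
  have S2 := schwartz_sum (index_enum 'I_d) (fun i => (h ord0 i)%:C) SF.
  rewrite /section_rem lin; try exact: schwartz_S0.
  rewrite lin; try exact/schwartz_S0/schwartz_conj_section.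
  rewrite (dual_sum _ _ dt SF) rmorphN rmorph1 !mulN1r /rem.
  rewrite [RHS]addrC [X in _ = X - _]addrC; congr (_ - _).
  by apply: eq_bigr => i _; rewrite conjc_real.
rewrite -!mulrA; apply: dual_bound => //.
  exact/schwartz_S0/schwartz_section_rem.
apply: HC; first exact: schwartz_section_rem.
by have := bnd_section_rem x fS fB h1; rewrite -!mulrA.
Qed.

Lemma dual_section_le k f : schwartz f -> exists2 C : R, 0 <= C &
  forall tau, S0dual tau -> forall x,
    jb x ^+ k * normc (tau (conj_section f x)) <= C * fine (S0dual_norm tau).
Proof.
move=> fS; have [C C0 HC] := @S0norm_le R d.
have [B fB] := schwartz_bnd (2 * d) (2 * d + 2 * d + k) fS.
exists (C * B) => [|tau dt x]; first by rewrite mulr_ge0 ?(bnd_ge0 fB).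
have j0 : 0 < jb x ^+ k by exact: lt_le_trans (jbX_ge1 x k).
have := dual_bound dt (schwartz_S0 (schwartz_conj_section x fS))
  (HC _ _ (schwartz_conj_section x fS) (bnd_conj_section x fS fB)).
set N := fine _; have -> : N * (C * (B / jb x ^+ k)) = C * B * N / jb x ^+ k by ring.
by rewrite ler_pdivlMr// mulrC.
Qed.

(** The derivatives in [x] are functions of the same form. *)
Lemma schwartz_dual_section tau f : S0dual tau -> schwartz f ->
  schwartz (fun x => tau (conj_section f x)).
Proof.
move=> dt fS.
pose P := [set u | exists2 f, schwartz f & u = fun x => tau (conj_section f x)].
have H : span P `<=` @schwartz R d; last by apply: H; apply: span_base; exists f.
apply: schwartz_coind => _ [{fS}f fS ->]; split.
  move=> k; have [C _ HC] := dual_section_le k fS.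
  by exists (C * fine (S0dual_norm tau)) => x; exact: HC.
exists (fun i x => tau (conj_section (partialC (lshift d i) f) x)).
  exact: cdiff_dual_section.
by move=> i; apply: span_base; exists (partialC (lshift d i) f) => //; exact: schwartz_partial.
Qed.

(** The bounds are linear in the norm of the functional; this is what makes the
operator continuous. *)
Lemma bnd_dual_section m k f : schwartz f -> exists2 C : R, 0 <= C &
  forall tau, S0dual tau ->
    bnd m k (C * fine (S0dual_norm tau)) (fun x => tau (conj_section f x)).
Proof.
elim: m f => [|m IH] f fS; have [C C0 HC] := dual_section_le k fS.
  by exists C => // tau dt; split => // x; exact: HC.
have /choice[c Hc] i : exists c, 0 <= c /\ forall tau, S0dual tau ->
    bnd m k (c * fine (S0dual_norm tau))
      (fun x => tau (conj_section (partialC (lshift d i) f) x)).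
  by have [c c0 H] := IH _ (schwartz_partial (lshift d i) fS); exists c.
have s0 : 0 <= \sum_i c i by apply: sumr_ge0 => i _; case: (Hc i).
exists (C + \sum_i c i) => [|tau dt]; first exact: addr_ge0.
have N0 : 0 <= fine (S0dual_norm tau) by exact/fine_ge0/S0dual_norm_ge0.
split=> [x|i].
  by apply: (le_trans (HC tau dt x)); rewrite ler_wpM2r// lerDl.
have -> : partialC i (fun x => tau (conj_section f x)) =
    fun x => tau (conj_section (partialC (lshift d i) f) x).
  exact: (congr1 (@^~ i) (cdiff_partial (cdiff_dual_section dt fS))).
have [ci Hi] := Hc i; apply: bnd_le (Hi tau dt); rewrite ler_wpM2r//.
rewrite (bigD1 i)//= addrCA lerDl addr_ge0// sumr_ge0// => j _.
by case: (Hc j).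
Qed.

Lemma S0norm_dual_section f : schwartz f -> exists2 C : R, 0 <= C &
  forall tau, S0dual tau ->
    (S0norm (fun x => tau (conj_section f x)) <= (C * fine (S0dual_norm tau))%:E)%E.
Proof.
move=> fS; have [C C0 HC] := @S0norm_le R d.
have [B B0 HB] := bnd_dual_section (2 * d) (2 * d + 2 * d) fS.
exists (C * B) => [|tau dt]; first exact: mulr_ge0.
by rewrite -mulrA; apply: HC; [exact: schwartz_dual_section|exact: HB].
Qed.

End dual_of_sections.

(** * Weyl operators have Schwartz kernels *)

Section weyl_kernels.
Context {R : realType}.
Notation lam := (@lebesgue_rV R).
Notation phase n := (@phase_measure R n).

Lemma l1_mulmx m n (A : 'M[R]_(m, n)) (y : 'rV[R]_m) :
  l1 (y *m A) <= (\sum_i \sum_j `|A i j|) * l1 y.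
Proof.
rewrite /l1; apply: (@le_trans _ _ (\sum_j \sum_i `|y ord0 i| * `|A i j|)).
  apply: ler_sum => j _; rewrite mxE (le_trans (ler_norm_sum _ _ _))//.
  by apply: ler_sum => i _; rewrite normrM.
rewrite exchange_big/= mulr_sumr; apply: ler_sum => i _.
rewrite -mulr_sumr mulrC ler_wpM2r// (bigD1 i)//= lerDl sumr_ge0// => k _.
by apply: sumr_ge0.
Qed.

(** An inverse of the linear part bounds [x] by its image. *)
Lemma schwartz_aff_inv m n (A : 'M[R]_(n, m)) (A' : 'M[R]_(m, n)) (b : 'rV[R]_m)
    (f : 'rV[R]_m -> R[i]) :
  A *m A' = 1%:M -> schwartz f -> schwartz (fun x => f (x *m A + b)).
Proof.
move=> AA fS; apply: schwartz_aff => //.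
set M := \sum_i \sum_j `|A' i j|.
have M0 : 0 <= M by apply: sumr_ge0 => i _; apply: sumr_ge0.
exists (1 + M + M * l1 b) => x; set y := x *m A + b.
have -> : x = (y - b) *m A' by rewrite /y addrK -mulmxA AA mulmx1.
rewrite /jb; have h := l1_mulmx A' (y - b).
have h2 : l1 (y - b) <= l1 y + l1 b by rewrite -(l1N b) l1D.
have h3 := ler_wpM2l M0 h2; have y0 := l1_ge0 y; have b0 := l1_ge0 b.
have := mulr_ge0 M0 (mulr_ge0 b0 y0); rewrite -/M in h *; lra.
Qed.

Context {d : nat}.
Implicit Types (a : 'rV[R]_(d + d) -> R[i]) (f : 'rV[R]_d -> R[i]).

(** The change of variables [(x, y) |-> ((x + y) / 2, x - y)], acting on row
vectors. *)
Definition weyl_mx : 'M[R]_(d + d) :=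
  block_mx (2^-1)%:M 1%:M (2^-1)%:M (- 1%:M).

Definition weyl_inv_mx : 'M[R]_(d + d) :=
  block_mx 1%:M 1%:M (2^-1)%:M (- (2^-1)%:M).

Lemma weyl_mxE (x y : 'rV[R]_d) :
  row_mx x y *m weyl_mx = row_mx (2^-1 *: (x + y)) (x - y).
Proof.
by rewrite /weyl_mx mul_row_block mulmxN !mul_mx_scalar !scale1r scalerDr.
Qed.

Lemma weyl_inv_mxE (u p : 'rV[R]_d) :
  row_mx u p *m weyl_inv_mx = row_mx (u + 2^-1 *: p) (u - 2^-1 *: p).
Proof.
by rewrite /weyl_inv_mx mul_row_block mulmxN !mul_mx_scalar !scale1r.
Qed.

Lemma half_half (x : 'rV[R]_d) : 2^-1 *: x + 2^-1 *: x = x.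
Proof. by rewrite -scalerDl -[RHS]scale1r; congr (_ *: _); field. Qed.

Lemma weyl_mxK : weyl_mx *m weyl_inv_mx = 1%:M.
Proof.
have H (v : 'rV[R]_(d + d)) : v *m weyl_mx *m weyl_inv_mx = v.
  rewrite -(hsubmxK v); move: (lsubmx v) (rsubmx v) => x y.
  rewrite weyl_mxE weyl_inv_mxE -scalerDr -scalerBr; congr row_mx.
    by rewrite addrACA subrr addr0 scalerDr half_half.
  by rewrite opprB (addrC x) addrACA subrr addr0 scalerDr half_half.
by apply/row_matrixP => i; rewrite -[weyl_mx]mul1mx !row_mul H.
Qed.

Lemma weyl_inv_mxK : weyl_inv_mx *m weyl_mx = 1%:M.
Proof. exact: mulmx1C weyl_mxK. Qed.

(** The integral kernel of the Weyl operator with symbol [a]: the Fourier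
transform of the symbol in the frequency, at the difference of the
positions, the other variable being their midpoint. *)
Definition weyl_kernel a (v : 'rV[R]_(d + d)) : R[i] := pft a (v *m weyl_mx).

Lemma weyl_kernelE a x y :
  weyl_kernel a (row_mx x y) = pft a (row_mx (2^-1 *: (x + y)) (x - y)).
Proof. by rewrite /weyl_kernel weyl_mxE. Qed.

Lemma schwartz_weyl_kernel a : schwartz a -> schwartz (weyl_kernel a).
Proof.
move=> aS; have := schwartz_aff_inv 0 weyl_mxK (schwartz_pft aS).
by under eq_fun do rewrite addr0.
Qed.

Lemma square_integrable_ijb : square_integrable (fun y : 'rV[R]_d => (ijb y)%:C).
Proof.
have mi := @measurable_ijb R _ _ d id (@measurable_id _ _ _).
have [m1 m2] := cmeas_real mi.
split=> //; apply: (integrable_dom (G := @ijb R d)).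
- by apply: measurable_funX; exact: measurable_normc.
- exact: integrable_ijb.
- move=> x; rewrite normc_real ger0_norm ?sqr_ge0//.
  rewrite ger0_norm ?ijb_ge0// expr2 ler_piMr ?ijb_ge0//.
  apply: prodr_ile1 => i _; rewrite invr_ge0 addr_ge0 ?sqr_ge0//=.
  by rewrite invf_le1 ?lerDl ?sqr_ge0// ltr_pwDl// sqr_ge0.
Qed.

Lemma schwartz_midpoint a t : schwartz a ->
  schwartz (fun v : 'rV[R]_(d + d) => a (row_mx (2^-1 *: (t + lsubmx v)) (rsubmx v))).
Proof.
move=> aS.
have AA : block_mx (2^-1)%:M 0 0 1%:M *m block_mx 2%:M 0 0 1%:M = 1%:M :> 'M[R]_(d + d).
  rewrite mulmx_block !mulmx0 !mul0mx !addr0 !add0r mulmx1 -scalar_mxM mulVf//.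
  by rewrite -scalar_mx_block.
have := schwartz_aff_inv (row_mx (2^-1 *: t) 0) AA aS; congr schwartz.
apply/funext => v; congr (a _).
rewrite -[v in LHS]hsubmxK mul_row_block mul_mx_scalar !mulmx0 mulmx1 addr0 add0r.
by rewrite add_row_mx addr0 scalerDr addrC.
Qed.

(** Fubini, integrating over the frequency first. The double integral converges
absolutely because [a] decays in both variables and [f] is square
integrable. *)
Lemma weyl_integral a f t : schwartz a -> square_integrable f ->
  weyl a f t = Cintegral (lam d) (fun y => weyl_kernel a (row_mx t y) * f y).
Proof.
move=> aS sf; have mf : cmeas f by case: sf.
pose h v := a (row_mx (2^-1 *: (t + lsubmx v)) (rsubmx v)).
have hS : schwartz h by exact: schwartz_midpoint.
pose F (z : 'rV[R]_d * 'rV[R]_d) :=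
  cis (2 * pi * dotv (t - z.1) z.2) * h (row_mx z.1 z.2) * f z.1.
have m1 : measurable_fun setT (fst : 'rV[R]_d * 'rV[R]_d -> _) := measurable_fst.
have m2 : measurable_fun setT (snd : 'rV[R]_d * 'rV[R]_d -> _) := measurable_snd.
have mF : cmeas F.
  apply: cmeasM; last exact: (cmeas_comp mf).
  apply: cmeasM.
    by apply: cmeas_cis_dotv => //; apply: measurable_rVB => //; exact: measurable_cst.
  exact: (cmeas_comp (schwartz_cmeas hS) (@measurable_row_mx2 R d d)).
have FE z : F z = let: (y, xi) := z in cis (2 * pi * dotv (t - y) xi) *
    a (row_mx (2^-1 *: (t + y)) xi) * f y.
  by case: z => y xi; rewrite /F /h row_mxKl row_mxKr.
have [B hB] := schwartz_bnd 0 (2 * d + 2 * d) hS; have B0 := bnd_ge0 hB.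
have cF : cint (lam d \x lam d)%E F.
  have ci : cint (lam d) (fun x => (ijb x)%:C).
    apply: (cint_dom _ (@integrable_ijb R d)) => [|x].
      by apply: cmeas_real; exact: (@measurable_ijb R _ _ d id).
    by rewrite normc_real ger0_norm ?ijb_ge0.
  apply: (cint_prod_dom (C := B) mF (cint_sqM sf square_integrable_ijb) ci) => z.
  rewrite /F !normcM normc_cis mul1r !normc_real !ger0_norm ?ijb_ge0//.
  rewrite [leRHS](_ : _ = B * ijb z.2 * ijb z.1 * normc (f z.1)); last by ring.
  rewrite ler_wpM2r ?normc_ge0//.
  apply: le_ijb; first exact: normc_ge0.
  rewrite -(mulrC (normc _)); apply: le_ijb; first by rewrite mulr_ge0 ?jbX_ge0 ?normc_ge0.
  apply: le_trans (bnd0 hB (row_mx z.1 z.2)).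
  rewrite (mulrC (normc _)) mulrA ler_wpM2r ?normc_ge0// exprD.
  by rewrite ler_pM ?jbX_ge0// lerXn2r ?nnegrE ?jb_ge0// ?jb_row_mxr ?jb_row_mxl.
transitivity (Cintegral (lam d \x lam d)%E F).
  by rewrite /weyl; congr Cintegral; apply/funext => z; rewrite -FE.
rewrite (Cintegral_fubini1 cF); congr Cintegral; apply/funext => y.
rewrite weyl_kernelE /pft row_mxKl row_mxKr mulrC -CintegralZ.
  congr Cintegral; apply/funext => xi.
  by rewrite FE dotvC; ring.
have := schwartz_pft_slice (row_mx (2^-1 *: (t + y)) (t - y)) aS.
by rewrite row_mxKl row_mxKr; exact: schwartz_cint.
Qed.

Lemma all_weights_stft n (f : 'rV[R]_n -> R[i]) : schwartz f ->
  all_weights (stft (@gaussian R n) f).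
Proof.
move=> fS; have gS := @schwartz_gaussian R n.
have mV := cmeas_stft (schwartz_cmeas fS) (schwartz_cmeas gS).
split=> // N.
have [B fB] := schwartz_bnd (N + 2 * n) (N + 2 * n + 2 * n) fS.
have [C C0 HC] := stft_decay (N + 2 * n) (N + 2 * n) gS.
apply: (integrable_dom _ (integrable_ijb2 (C * B))).
  apply: measurable_funM; last exact: measurable_normc.
  apply: measurable_funX; apply: measurable_funM.
    exact: (measurable_jb measurable_fst).
  exact: (measurable_jb measurable_snd).
move=> z; rewrite ger0_norm; last first.
  by rewrite mulr_ge0 ?normc_ge0// exprn_ge0// mulr_ge0 ?jb_ge0.
rewrite (mulrC (ijb z.1)) mulrA.
have V0 : 0 <= (jb z.1 * jb z.2) ^+ N * normc (stft (@gaussian R n) f z).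
  by rewrite mulr_ge0 ?normc_ge0// exprn_ge0// mulr_ge0 ?jb_ge0.
apply: le_ijb => //; apply: le_ijb; first by rewrite mulr_ge0 ?jbX_ge0.
apply: le_trans (HC f B fS fB z).
by rewrite exprMn !exprD le_eqVlt; apply/orP; left; apply/eqP; ring.
Qed.

Lemma measurable_vweight (s : R) d' (T : measurableType d') (x w : T -> 'rV[R]_d) :
  measurable_fun setT x -> measurable_fun setT w ->
  measurable_fun setT (fun t => vweight s (x t, w t)).
Proof.
move=> mx mw; apply: (measurableT_comp (measurable_powR _)).
by apply: measurable_funD; [apply: measurable_funD|] => //; exact: measurable_dotv.
Qed.

Lemma schwartz_M1 (s : R) (K : 'rV[R]_(d + d) -> R[i]) : 0 <= s -> schwartz K -> M1 s K.
Proof.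
move=> s0 KS; split; first exact: schwartz_S0.
have sN : s <= (Num.bound s)%:R by exact/ltW/archi_boundP.
have [mV wV] := all_weights_stft KS.
have m1 : measurable_fun setT (fst : 'rV[R]_(d + d) * 'rV[R]_(d + d) -> _) := measurable_fst.
have m2 : measurable_fun setT (snd : 'rV[R]_(d + d) * 'rV[R]_(d + d) -> _) := measurable_snd.
apply: (integrable_dom _ (wV (2 * Num.bound s)%N)).
  apply: measurable_funM; first exact: measurable_normc.
  apply: measurable_funM; apply: measurable_vweight.
  - exact: (measurable_lsubmx m1).
  - exact: (measurable_lsubmx m2).
  - exact: (measurable_rsubmx m1).
  - exact: (measurable_rsubmx m2).
move=> z; rewrite ger0_norm; last by rewrite !mulr_ge0 ?normc_ge0 ?powR_ge0.
rewrite mulrC ler_wpM2r ?normc_ge0//.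
have := vweight_le (lsubmx z.1) (rsubmx z.1) (lsubmx z.2) (rsubmx z.2) s0 sN.
by rewrite !hsubmxK.
Qed.

(** The difference of two functionals is a functional, so continuity at a point
reduces to the bound of the operator. *)
Lemma schwartz_kernel_M1_operators (s : R) (K : 'rV[R]_(d + d) -> R[i]) :
  0 <= s -> schwartz K ->
  M1_operators d s (fun sigma x => sigma (conj_section K x)).
Proof.
move=> s0 KS; split.
- by move=> sigma ds; apply: schwartz_S0; exact: schwartz_dual_section.
- by move=> c sigma tau _ _; exact: aeW.
- move=> sigma0 ds0 e e0; have [C C0 HC] := S0norm_dual_section KS.
  have C1 : 0 < C + 1 by rewrite ltr_wpDl.
  exists (e / (C + 1)) => [|sigma ds hd]; first by rewrite divr_gt0.
  have dt : S0dual (fun f => sigma f - sigma0 f).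
    split; last by exact: lt_trans hd (ltry _).
    move=> c f h Sf Sh; case: ds => l1 _; case: ds0 => l2 _.
    by rewrite l1// l2//; ring.
  apply: (le_lt_trans (HC _ dt)); rewrite lte_fin.
  have : fine (S0dual_norm (fun f => sigma f - sigma0 f)) < e / (C + 1).
    by rewrite -lte_fin fineK// S0dual_norm_fin.
  rewrite ltr_pdivlMr// => H; apply: le_lt_trans H.
  by rewrite mulrC ler_wpM2l ?lerDl ?fine_ge0 ?S0dual_norm_ge0.
- exists K; first exact: schwartz_M1.
  split; first by apply: aeW => x; exact/schwartz_S0/schwartz_conj_section.
  by move=> sigma _; exact: aeW.
Qed.

(** The kernel of a Weyl operator with a Schwartz symbol is Schwartz, and acts
on the whole dual. *)
Lemma schwartz_operators_sub :
  schwartz_operators R d `<=`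
  identified_by_kernel (\bigcap_(s in [set s : R | 0 <= s]) M1_operators d s).
Proof.
move=> T [a aS Ta].
have KS := schwartz_weyl_kernel aS.
exists (fun sigma x => sigma (conj_section (weyl_kernel a) x)).
  by move=> s /= s0; exact: schwartz_kernel_M1_operators.
exists (weyl_kernel a).
  split; first by apply: aeW => x; exact/schwartz_S0/schwartz_conj_section.
  by move=> sigma _; exact: aeW.
move=> f Sf; apply: filterS (Ta f Sf) => t ->.
by apply: weyl_integral => //; case: Sf.
Qed.

End weyl_kernels.

(** * Operators in all the classes have Schwartz symbols *)

Section symbols.
Context {R : realType} {d : nat}.
Notation lam := (@lebesgue_rV R).
Notation phase n := (@phase_measure R n).
Implicit Types (K L : 'rV[R]_(d + d) -> R[i]) (f phi : 'rV[R]_d -> R[i]).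

(** The integral of the modulus over the whole space vanishes, hence so does the
iterated one. *)
Lemma ae_row_mx m n (G : 'rV[R]_(m + n) -> R[i]) : cmeas G ->
  {ae lam (m + n)%N, forall v, G v = 0} ->
  {ae lam m, forall x, {ae lam n, forall y, G (row_mx x y) = 0}}.
Proof.
move=> mG aG; pose g v := (normc (G v))%:E.
have mg : measurable_fun setT g by apply/measurable_EFinP; exact: measurable_normc.
pose h (p : 'rV[R]_m * 'rV[R]_n) := g (row_mx p.1 p.2).
have mh : measurable_fun setT h := measurableT_comp mg (@measurable_row_mx2 R m n).
have h0 p : (0 <= h p)%E by rewrite lee_fin normc_ge0.
have I0 : (\int[lam (m + n)%N]_v `|g v| = 0)%E.
  apply/(ae_eq_integral_abs _ measurableT mg).
  by apply: filterS aG => v Gv _; rewrite /g Gv normc0.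
have {I0} : (\int[lam m]_x `|\int[lam n]_y h (x, y)| = 0)%E.
  have E0 : (\int[lam (m + n)%N]_v g v = 0)%E.
    by rewrite -I0; apply: eq_integral => v _; rewrite gee0_abs// lee_fin normc_ge0.
  rewrite -[RHS]E0 integral_row_mx// [RHS]fubini_tonelli1//.
  by apply: eq_integral => x _; rewrite gee0_abs// integral_ge0.
have mF : measurable_fun setT (fun x => \int[lam n]_y h (x, y))%E.
  exact: (@measurable_fun_fubini_tonelli_F _ _ _ _ _ (lam n) h mh h0).
move/(ae_eq_integral_abs _ measurableT mF); apply: filterS => x /(_ I)/= hx.
have mhx : measurable_fun setT (fun y => h (x, y)).
  exact: (measurableT_comp mh (pair1_measurable x)).
have : (\int[lam n]_y `|h (x, y)| = 0)%E by under eq_integral do rewrite gee0_abs//.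
move/(ae_eq_integral_abs _ measurableT mhx); apply: filterS => y /(_ I)/=.
by rewrite /h /g => -[]; exact: eq0_normc.
Qed.

(** Applied to the functional given by pairing with [f], the identity defining
the kernel of [S] is the integral formula for [T f]; so all kernels of [S]
are integral kernels of [T]. *)
Lemma kernel_action S (T : ('rV[R]_d -> R[i]) -> 'rV[R]_d -> R[i]) K L :
  has_kernel S K -> integral_kernel T K -> has_kernel S L -> integral_kernel T L.
Proof.
move=> [_ SK] TK [_ SL] f Sf.
have dp := pairing_S0dual Sf.
have E M x : pairing f (conj_section M x) =
    Cintegral (lam d) (fun y => M (row_mx x y) * f y).
  by congr Cintegral; apply/funext => y; rewrite /conj_section conjcK.
apply: filterS3 (TK f Sf) (SK _ dp) (SL _ dp) => x -> SKx SLx.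
by rewrite -!E -SKx.
Qed.

Lemma gaussian_row_mx m n (x : 'rV[R]_m) (y : 'rV[R]_n) :
  gaussian (row_mx x y) = gaussian x * gaussian y.
Proof. by rewrite /gaussian dotv_row_mx -rmorphM -expRD mulrDr opprD. Qed.

Lemma gaussian_neq0 n (x : 'rV[R]_n) : gaussian x != 0.
Proof. by apply/eqP => -[] /eqP; rewrite gt_eqF// expR_gt0. Qed.

Lemma cis_neq0 (t : R) : cis t != 0.
Proof.
have : normc (cis t) != 0 by rewrite normc_cis oner_neq0.
by apply: contra_neq => ->; rewrite normc0.
Qed.

(** The Gaussian on the product space is a tensor product, so the transform of a
kernel integrates, against a function of [x], the action of the operator on
a time-frequency shift of the Gaussian in [y]. *)
Lemma stft_kernel_unique K L : S0 K -> S0 L ->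
  (forall phi, schwartz phi -> {ae lam d, forall x,
    Cintegral (lam d) (fun y => K (row_mx x y) * phi y) =
    Cintegral (lam d) (fun y => L (row_mx x y) * phi y)}) ->
  stft (@gaussian R (d + d)) K = stft (@gaussian R (d + d)) L.
Proof.
move=> SK SL KL; apply/funext => -[Z W].
rewrite -(hsubmxK Z) -(hsubmxK W).
move: (lsubmx Z) (rsubmx Z) (lsubmx W) (rsubmx W) => z1 z2 w1 w2.
pose chi x := gaussian (x - z1) * cis (- (2 * pi * dotv x w1)).
pose phi y := gaussian (y - z2) * cis (- (2 * pi * dotv y w2)).
have phiS : schwartz phi.
  have := schwartz_cis (- (2 * pi) *: w2) (schwartz_shift (- z2) (@schwartz_gaussian R d)).
  by congr schwartz; apply/funext => y; rewrite /phi mulrC dotvZr mulNr.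
have mchi : cmeas chi.
  apply: cmeasM; first by apply: cmeas_gaussian; exact: measurable_rVB.
  by apply: cmeas_cisN_dotv => //; exact: measurable_cst.
have mphi := schwartz_cmeas phiS.
have m1 : measurable_fun setT (fst : 'rV[R]_d * 'rV[R]_d -> _) := measurable_fst.
have m2 : measurable_fun setT (snd : 'rV[R]_d * 'rV[R]_d -> _) := measurable_snd.
pose F (M : 'rV[R]_(d + d) -> R[i]) (p : 'rV[R]_d * 'rV[R]_d) :=
  chi p.1 * (M (row_mx p.1 p.2) * phi p.2).
have slice M : S0 M -> cint (lam d \x lam d)%E (F M) /\
    stft (@gaussian R (d + d)) M (row_mx z1 z2, row_mx w1 w2) =
    Cintegral (lam d \x lam d)%E (F M).
  move=> SM; pose u v := M v * gaussian (v - row_mx z1 z2) *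
    cis (- (2 * pi * dotv v (row_mx w1 w2))).
  have cu : cint (lam (d + d)%N) u.
    apply: (@cint_bndM _ _ _ _ _ _ 1) => [||v]; last by rewrite normc_cis.
      by apply: cint_sqM; [case: SM|exact: square_integrable_gaussian_shift].
    by apply: cmeas_cisN_dotv => //; exact: measurable_cst.
  have Fu : (fun p => u (row_mx p.1 p.2)) = F M.
    apply/funext => p; rewrite /u /F /chi /phi opp_row_mx add_row_mx gaussian_row_mx.
    by rewrite dotv_row_mx mulrDr opprD cisD; ring.
  split; first by have := cint_row_mx cu; rewrite Fu.
  rewrite -Fu -(Cintegral_row_mx (cint_cmeas cu)) /stft /u.
  by under eq_fun do rewrite conj_gaussian.
have chi0 x : chi x != 0.
  by rewrite mulf_neq0 ?gaussian_neq0 ?cis_neq0.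
have aslice M : S0 M -> {ae lam d, forall x, Cintegral (lam d) (fun y => F M (x, y)) =
    chi x * Cintegral (lam d) (fun y => M (row_mx x y) * phi y)}.
  move=> /slice[cF _]; apply: filterS (ae_cint_fubini cF) => x cFx.
  have := CintegralZ (chi x)^-1 cFx.
  have -> : (fun y => (chi x)^-1 * F M (x, y)) = (fun y => M (row_mx x y) * phi y).
    by apply/funext => y; rewrite /F /= mulKf.
  by move=> ->; rewrite mulVKf.
have [cK ->] := slice K SK; have [cL ->] := slice L SL.
rewrite (Cintegral_fubini1 cK) (Cintegral_fubini1 cL); apply: ae_eq_Cintegral.
- exact: (cmeas_Cintegral_param (lam d) (cint_cmeas cK)).
- exact: (cmeas_Cintegral_param (lam d) (cint_cmeas cL)).
- by apply: filterS3 (aslice K SK) (aslice L SL) (KL phi phiS) => x -> -> ->.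
Qed.

(** The weight of order 2 at [(x, w)] is at least a multiple of [jb x * jb w]: a
product is at most the mean of the squares. *)
Lemma jb_le_vweight (N : nat) : exists2 C : R, 0 <= C & forall x u w v : 'rV[R]_d,
  (jb (row_mx x u) * jb (row_mx w v)) ^+ N <=
  C * (vweight (2 * N)%:R (x, w) * vweight (2 * N)%:R (u, v)).
Proof.
(* The constant comparing [jb x ^+ 2] with [1 + |x|^2]. *)
pose c : R := 2 * d.+1%:R ^+ 2.
have c0 : 0 <= c by rewrite mulr_ge0 ?exprn_ge0.
have H (x w : 'rV[R]_d) : (jb x * jb w) ^+ N <= c ^+ N * vweight (2 * N)%:R (x, w).
  pose A : R := 1 + dotv x x + dotv w w.
  have A0 : 0 <= A by rewrite !addr_ge0 ?dotvv_ge0.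
  have -> : vweight (2 * N)%:R (x, w) = A ^+ N.
    rewrite /vweight /= -powR_mulrn//; congr (_ `^ _).
    by rewrite natrM mulrC mulKf// pnatr_eq0.
  rewrite -exprMn lerXn2r ?nnegrE ?mulr_ge0 ?jb_ge0//.
  have hx : jb x ^+ 2 <= c * A.
    by apply: (le_trans (jb_dotv x)); rewrite ler_wpM2l// lerDl dotvv_ge0.
  have hw : jb w ^+ 2 <= c * A.
    by apply: (le_trans (jb_dotv w)); rewrite ler_wpM2l// /A -addrA lerD2l lerDr dotvv_ge0.
  have := sqr_ge0 (jb x - jb w); nra.
exists (c ^+ N * c ^+ N) => [|x u w v]; first by rewrite mulr_ge0 ?exprn_ge0.
apply: (@le_trans _ _ ((jb x * jb w) ^+ N * (jb u * jb v) ^+ N)).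
  have jr (a b : 'rV[R]_d) : jb (row_mx a b) <= jb a * jb b :> R.
    by rewrite /jb l1_row_mx; have := mulr_ge0 (l1_ge0 a) (l1_ge0 b); lra.
  rewrite -exprMn mulrACA lerXn2r ?nnegrE ?mulr_ge0 ?jb_ge0//.
  by rewrite ler_pM ?jb_ge0.
rewrite mulrACA ler_pM ?exprn_ge0 ?mulr_ge0 ?jb_ge0//.
Qed.

(** The function of class [M1 s] may depend on [s], but its transform does not. *)
Lemma M1_all_weights K :
  (forall s : R, 0 <= s -> exists2 L, M1 s L &
    stft (@gaussian R (d + d)) L = stft (@gaussian R (d + d)) K) ->
  S0 K -> all_weights (stft (@gaussian R (d + d)) K).
Proof.
move=> HK SK; set V := stft _ K.
have mV : cmeas V.
  by apply: cmeas_stft; [exact: S0_cmeas|exact: (cint_cmeas (@cint_gaussian R _))].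
split=> // N; have [C C0 HC] := jb_le_vweight N.
have [|L [_ iL] LV] := HK (2 * N)%:R; first by [].
rewrite -/V in LV; rewrite LV in iL.
apply: (integrable_dom _ (integrableZl measurableT C iL)).
  apply: measurable_funM; last exact: measurable_normc.
  apply: measurable_funX; apply: measurable_funM.
    exact: (measurable_jb measurable_fst).
  exact: (measurable_jb measurable_snd).
move=> z; rewrite ger0_norm; last first.
  by rewrite mulr_ge0 ?normc_ge0// exprn_ge0// mulr_ge0 ?jb_ge0.
have := HC (lsubmx z.1) (rsubmx z.1) (lsubmx z.2) (rsubmx z.2); rewrite !hsubmxK => h.
by rewrite mulrCA [leRHS]mulrC ler_wpM2r ?normc_ge0.
Qed.

(** A kernel is brought back to midpoints and differences, and the symbol is its
inverse Fourier transform in the differences; Fourier inversion gives the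
kernel back. *)
Lemma schwartz_symbol K : schwartz K ->
  exists2 a, schwartz a & forall t y, weyl_kernel a (row_mx t y) = K (row_mx t y).
Proof.
move=> KS; pose L v := K (v *m weyl_inv_mx).
have LS : schwartz L.
  have := schwartz_aff_inv 0 weyl_inv_mxK KS.
  by under eq_fun do rewrite addr0.
pose D : 'M[R]_(d + d) := block_mx 1%:M 0 0 (- 1%:M).
have DE u x : row_mx u x *m D = row_mx u (- x) :> 'rV[R]_(d + d).
  by rewrite /D mul_row_block mulmxN !mulmx0 !mulmx1 addr0 add0r.
have DD : D *m D = 1%:M.
  rewrite /D mulmx_block !mulmx0 !mul0mx mulmxN mulNmx opprK !mulmx1 !addr0 add0r.
  by rewrite -scalar_mx_block.
pose a v := pft L (v *m D).
have aS : schwartz a.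
  have := schwartz_aff_inv 0 DD (schwartz_pft LS).
  by under eq_fun do rewrite addr0.
exists a => // t y.
have KL : K (row_mx t y) = L (row_mx (2^-1 *: (t + y)) (t - y)).
  by rewrite /L -weyl_mxE -mulmxA weyl_mxK mulmx1.
rewrite weyl_kernelE KL; move: (2^-1 *: (t + y)) (t - y) => u p.
pose h s := L (row_mx u s).
have hS : schwartz h by exact: schwartz_section.
have ha w : fourier h w = a (row_mx u w).
  rewrite /a DE /pft row_mxKl row_mxKr /fourier; congr Cintegral; apply/funext => s.
  by rewrite dotvNr mulrN mulrC.
have [B hB] := schwartz_bnd 0 0 hS.
have -> : L (row_mx u p) = h p by [].
rewrite (@fourier_inversion _ _ h B p (schwartz_cint hS)).
- rewrite /ifourier /pft row_mxKl row_mxKr; congr Cintegral; apply/funext => w.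
  by rewrite ha mulrC dotvC.
- exact: (cdiff_continuous (schwartz_cdiff hS)).
- by move=> x; exact: bnd_normc hB.
- rewrite (_ : fourier h = fun w => a (row_mx u w)); last exact/funext.
  exact/schwartz_cint/schwartz_section.
Qed.

(** The common short-time Fourier transform of the kernels has all weights, so
its synthesis is a Schwartz function, which is the kernel up to a null set
by inversion. *)
Lemma schwartz_operators_sup :
  identified_by_kernel (\bigcap_(s in [set s : R | 0 <= s]) M1_operators d s) `<=`
  schwartz_operators R d.
Proof.
move=> T [S SM [K1 SK1 TK1]].
have HK s : 0 <= s -> exists K, [/\ M1 s K, has_kernel S K & integral_kernel T K].
  move=> s0; have [_ _ _ [K MK SK]] := SM s s0; exists K; split => //.
  exact: kernel_action SK1 TK1 SK.
have [K [MK SK TK]] := HK 0 (lexx 0).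
have S0K : S0 K by case: MK.
have wV : all_weights (stft (@gaussian R (d + d)) K).
  apply: M1_all_weights => // s s0; have [L [ML SL TL]] := HK s s0.
  exists L => //; apply: stft_kernel_unique => //; first by case: ML.
  move=> phi phiS; have Sphi := schwartz_S0 phiS.
  by apply: filterS2 (TL _ Sphi) (TK _ Sphi) => x <- <-.
have gS := @schwartz_gaussian R (d + d).
pose c := @gaussian_mass R (d + d).
have c0 : c != 0 := gaussian_mass_neq0.
pose Kt v := c^-1 * synth (stft (@gaussian R (d + d)) K) (@gaussian R (d + d)) v.
have KtS : schwartz Kt by apply: schwartzZ; exact: schwartz_synth.
have mK := S0_cmeas S0K; have mKt := schwartz_cmeas KtS.
have KKt : {ae lam d, forall x, {ae lam d, forall y, K (row_mx x y) = Kt (row_mx x y)}}.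
  have mG : cmeas (fun v => K v - Kt v).
    have := cmeasD mK (cmeasM (cmeas_cst _ (-1)) mKt).
    by under eq_fun do rewrite mulN1r.
  have aG : {ae lam (d + d)%N, forall v, K v - Kt v = 0}.
    by apply: filterS (stft_inversion S0K) => v Hv; rewrite /Kt -Hv mulKf ?subrr.
  apply: filterS (ae_row_mx mG aG) => x; apply: filterS => y /eqP.
  by rewrite subr_eq0 => /eqP.
have [a aS aE] := schwartz_symbol KtS.
exists a => // f Sf; have mf := S0_cmeas Sf.
apply: filterS2 (TK f Sf) KKt => x -> Kx.
rewrite weyl_integral//; last by case: Sf.
have mrow : measurable_fun setT (fun y : 'rV[R]_d => row_mx x y).
  by apply: measurable_row_mx => //; exact: measurable_cst.
apply: ae_eq_Cintegral.
- by apply: cmeasM => //; exact: (cmeas_comp mK mrow).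
- apply: cmeasM => //.
  exact: (cmeas_comp (schwartz_cmeas (schwartz_weyl_kernel aS)) mrow).
- by apply: filterS Kx => y; rewrite aE => ->.
Qed.

End symbols.

Theorem theorem4p6 (R : realType) (d : nat) :
  schwartz_operators R d =
  identified_by_kernel
    (\bigcap_(s in [set s : R | 0 <= s]) M1_operators d s).
Proof.
by apply/seteqP; split; [exact: schwartz_operators_sub|exact: schwartz_operators_sup].
Qed.
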